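(* For each of the strategy classes of pure finite-state, finite-state, pure, and unrestricted strategies, TR-NCRSP$_{>}$ is undecidable. That is, there is no algorithm that, given a stochastic multiplayer game $\mathcal{G}$ in which every player has a terminal reachability objective and a rational number $\mu\in[0,1]$, decides whether there exists a strategy $\sigma_0$ of the system such that for every tuple $\bar\sigma_{-0}$ of environment strategies for which $(\sigma_0,\bar\sigma_{-0})$ is a 0-fixed Nash equilibrium, $\mathit{Pay}_0(\sigma_0,\bar\sigma_{-0})>\mu$ (all strategies ranging over the given class).
   Context: Game arena: a tuple $\mathcal{A}=\langle \Omega, V,(V_i)_{i\in\Omega\cup\{\mathit{nature}\}},\Delta,v_0\rangle$ where $\Omega=\{0,1,\dots,k\}$ is the set of players (player $0$ is the system, players $1,\dots,k$ are the environment players), $V$ is a finite set of vertices partitioned into sets $V_i$, $i\in\Omega\cup\{\mathit{nature}\}$, and $v_0$ is the initial vertex. $\Delta\subseteq (V_{\mathit{nature}}\times[0,1]\times V)\cup((\bigcup_{i\in\Omega}V_i)\times\{\bot\}\times V)$; for each $v\in V_{\mathit{nature}}$, $w\in V$ there is exactly one rational $p$ with $(v,p,w)\in\Delta$, forming a probability distribution over $V$. $\mathit{next}(v)=\{w\mid\exists p\in(0,1]\cup\{\bot\},(v,p,w)\in\Delta\}$, nonempty. A vertex $v$ is terminal if $\mathit{next}(v)=\{v\}$. Plays are infinite paths $\pi(0)\pi(1)\dots$ from $v_0$. For a set $F$ of terminal vertices, $\mathit{TR}(F)=\{\pi\mid\exists n.\ \pi(n)\in F\}$ is a terminal reachability objective;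 each player $i$ has such an objective $O_i$. Strategies: $\sigma_i:V^*V_i\to D(V)$ (distributions over successors). Pure: every value is a Dirac distribution. Finite-state: implementable by a Mealy machine with finitely many memory states (reading the history and outputting the distribution). A strategy profile $\bar\sigma$ determines a probability measure $\mathit{Pr}^{\bar\sigma}$ on plays; $\mathit{Pay}_i(\bar\sigma)=\mathit{Pr}^{\bar\sigma}(O_i)$. $\bar\sigma$ is a 0-fixed Nash equilibrium if for every environment player $i\ne0$ and every strategy $\tau$ of player $i$ in the class under consideration, $\mathit{Pay}_i(\bar\sigma_{-i},\tau)\le\mathit{Pay}_i(\bar\sigma)$, where $(\bar\sigma_{-i},\tau)$ replaces player $i$'s strategy by $\tau$. *)

(* Defs.v *)
From Stdlib Require Import Reals List Arith Lia.
From Coquelicot Require Import Coquelicot.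
Import ListNotations.

(* Model of computation: Minsky/register machines (Turing complete).   *)
(* Registers are indexed by nat; input in register 0, output in r. 0.  *)

Inductive instr : Type :=
| INC (r : nat)
| DEC (r : nat) (j : nat).

Definition program := list instr.

Definition mstate : Type := (nat * (nat -> nat))%type.

Definition set_reg (regs : nat -> nat) (r v : nat) : nat -> nat :=
  fun x => if Nat.eqb x r then v else regs x.

Definition mstep (P : program) (s : mstate) : mstate :=
  let (pc, regs) := s in
  match nth_error P pc with
  | None => s
  | Some (INC r) => (S pc, set_reg regs r (S (regs r)))
  | Some (DEC r j) =>
      match regs r with
      | O => (j, regs)
      | S n => (S pc, set_reg regs r n)
      end
  end.

Fixpoint mrun (P : program) (n : nat) (s : mstate) : mstate :=
  match n with O => s | S n' => mrun P n' (mstep P s) end.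

Definition init_state (x : nat) : mstate := (0%nat, fun r => if Nat.eqb r 0 then x else 0%nat).

Definition halts_with (P : program) (x y : nat) : Prop :=
  exists n, (length P <= fst (mrun P n (init_state x)))%nat /\
            snd (mrun P n (init_state x)) 0%nat = y.

(* Games (finite data, so that they can be given to an algorithm).     *)
(* Vertices are 0 .. nV-1; players are 0 .. k (0 = system).            *)

Record game : Type := mkGame {
  g_nV : nat;
  g_k : nat;                           (* number of environment players *)
  g_v0 : nat;
  g_owner : list (option nat);         (* Some i: v in V_i ; None: v in V_nature *)
  g_succ : list (list nat);            (* successors of player vertices *)
  g_prob : list (list (nat * nat));    (* nature: (num, den) of p(v,w) *)
  g_target : list (list nat)
}.

Definition owner (G : game) (v : nat) : option nat := nth v (g_owner G) None.

Definition qentry (G : game) (v w : nat) : nat * nat :=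
  nth w (nth v (g_prob G) []) (0%nat, 1%nat).

Definition natp (G : game) (v w : nat) : R :=
  INR (fst (qentry G v w)) / INR (snd (qentry G v w)).

Definition sumR (l : list R) : R := fold_right Rplus 0%R l.

Definition next (G : game) (v w : nat) : Prop :=
  match owner G v with
  | Some _ => In w (nth v (g_succ G) [])
  | None => (0 < fst (qentry G v w))%nat
  end.

Definition terminal (G : game) (v : nat) : Prop :=
  forall w, next G v w <-> w = v.

Definition target (G : game) (i v : nat) : Prop := In v (nth i (g_target G) []).

Definition target_b (G : game) (i v : nat) : bool :=
  existsb (Nat.eqb v) (nth i (g_target G) []).

Definition wf_game (G : game) : Prop :=
  (g_v0 G < g_nV G)%nat /\
  length (g_owner G) = g_nV G /\
  length (g_succ G) = g_nV G /\
  length (g_prob G) = g_nV G /\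
  length (g_target G) = S (g_k G) /\
  (forall v, (v < g_nV G)%nat ->
     match owner G v with
     | Some i => (i <= g_k G)%nat /\
                 (exists w, In w (nth v (g_succ G) [])) /\
                 (forall w, In w (nth v (g_succ G) []) -> (w < g_nV G)%nat)
     | None => length (nth v (g_prob G) []) = g_nV G /\
               (forall w, (w < g_nV G)%nat -> (0 < snd (qentry G v w))%nat) /\
               sumR (map (natp G v) (seq 0 (g_nV G))) = 1%R
     end) /\
  (forall i v, (i <= g_k G)%nat -> target G i v ->
     (v < g_nV G)%nat /\ terminal G v).

(* Strategies: histories (lists of vertices, last one owned by i)      *)
(* mapped to distributions over vertices.                              *)

Definition strategy : Type := list nat -> nat -> R.

Definition valid_hist (G : game) (h : list nat) : Prop :=
  List.Forall (fun v => (v < g_nV G)%nat) h.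

Definition is_strategy (G : game) (i : nat) (s : strategy) : Prop :=
  forall h v, valid_hist G (h ++ [v]) -> owner G v = Some i ->
    (forall w, (0 <= s (h ++ [v]) w)%R) /\
    (forall w, s (h ++ [v]) w <> 0%R -> next G v w) /\
    sumR (map (s (h ++ [v])) (seq 0 (g_nV G))) = 1%R.

Definition pure (G : game) (i : nat) (s : strategy) : Prop :=
  forall h v, valid_hist G (h ++ [v]) -> owner G v = Some i ->
    exists w, forall w', s (h ++ [v]) w' = if Nat.eqb w' w then 1%R else 0%R.

(* Implementable by a Mealy machine with memory states 0..m-1, initial
   memory m0, update upd (reads each vertex) and output out. *)
Definition finite_state (G : game) (i : nat) (s : strategy) : Prop :=
  exists (m m0 : nat) (upd : nat -> nat -> nat) (out : nat -> nat -> nat -> R),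
    (m0 < m)%nat /\ (forall q v, (q < m)%nat -> (upd q v < m)%nat) /\
    forall h v, valid_hist G (h ++ [v]) -> owner G v = Some i ->
      forall w, s (h ++ [v]) w = out (fold_left upd h m0) v w.

Inductive sclass : Type := PureFiniteState | FiniteState | Pure | Unrestricted.

Definition in_class (c : sclass) (G : game) (i : nat) (s : strategy) : Prop :=
  is_strategy G i s /\
  match c with
  | PureFiniteState => pure G i s /\ finite_state G i s
  | FiniteState => finite_state G i s
  | Pure => pure G i s
  | Unrestricted => True
  end.

(* Probability measure on plays, via cylinder sets.                    *)

Definition profile : Type := nat -> strategy.

Definition step (G : game) (p : profile) (h : list nat) (w : nat) : R :=
  let v := last h 0%nat in
  match owner G v with
  | None => natp G v w
  | Some i => p i h w
  end.

Fixpoint pprob (G : game) (p : profile) (pre rest : list nat) : R :=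
  match rest with
  | [] => 1%R
  | w :: r => (step G p pre w * pprob G p (pre ++ [w]) r)%R
  end.

Definition hprob (G : game) (p : profile) (h : list nat) : R :=
  match h with
  | [] => 0%R
  | v :: r => if Nat.eqb v (g_v0 G) then pprob G p [v] r else 0%R
  end.

Fixpoint all_lists (n len : nat) : list (list nat) :=
  match len with
  | O => [[]]
  | S l => flat_map (fun v => map (cons v) (all_lists n l)) (seq 0 n)
  end.

Definition reach_prob (G : game) (p : profile) (i n : nat) : R :=
  sumR (map (hprob G p)
         (filter (fun h => existsb (target_b G i) h) (all_lists (g_nV G) (S n)))).

(* Pay_i = Pr(TR(F_i)) = sup_n Pr(reach F_i within n steps) *)
Definition Pay (G : game) (p : profile) (i : nat) : Rbar :=
  Sup_seq (fun n => reach_prob G p i n).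

Definition update (p : profile) (i : nat) (t : strategy) : profile :=
  fun j => if Nat.eqb j i then t else p j.

Definition is_NE0 (c : sclass) (G : game) (p : profile) : Prop :=
  forall i, (1 <= i <= g_k G)%nat -> forall t, in_class c G i t ->
    Rbar_le (Pay G (update p i t) i) (Pay G p i).

Definition NCRSP_gt (c : sclass) (G : game) (mu : R) : Prop :=
  exists s0, in_class c G 0 s0 /\
    forall env : profile,
      (forall i, (1 <= i <= g_k G)%nat -> in_class c G i (env i)) ->
      is_NE0 c G (update env 0 s0) ->
      Rbar_lt (Finite mu) (Pay G (update env 0 s0) 0).

Definition cpair (a b : nat) : nat := ((a + b) * (a + b + 1) / 2 + b)%nat.

Fixpoint enc_list {A : Type} (e : A -> nat) (l : list A) : nat :=
  match l with
  | [] => 0%nat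
  | x :: r => S (cpair (e x) (enc_list e r))
  end.

Definition enc_opt (o : option nat) : nat :=
  match o with None => 0%nat | Some i => S i end.

Definition enc_qn (q : nat * nat) : nat := cpair (fst q) (snd q).

Definition encode_instance (G : game) (a b : nat) : nat :=
  enc_list (fun x => x)
    [g_nV G; g_k G; g_v0 G;
     enc_list enc_opt (g_owner G);
     enc_list (enc_list (fun x => x)) (g_succ G);
     enc_list (enc_list enc_qn) (g_prob G);
     enc_list (enc_list (fun x => x)) (g_target G);
     a; b].

(* An instance: a well-formed game and mu = a/b in [0,1]. *)
Definition valid_instance (G : game) (a b : nat) : Prop :=
  wf_game G /\ (0 < b)%nat /\ (a <= b)%nat.

(* Main.v *)
(** The system owns no vertex and the threshold is 0, so the question becomes whether some
    equilibrium of the environment gives the system payoff 0.  The game simulates a register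
    machine: a value [n] of register [r] is the probability [2^-n] with which player 1, who has no
    target, lets a side gadget succeed.  For each register and each parity of the phase there is a
    checker and an opponent with disjoint targets, both of which may leave to a lottery giving them
    [kappa] and [1 - kappa] while the system wins.  Hence in an equilibrium without payoff for the
    system the checker gets exactly [kappa] from there on; as it is paid by the gadgets of two
    consecutive phases only, this is a linear equation between the register contents before and
    after the phase, which holds for mixed strategies too.  Player 2 guesses the outcome of the zero
    tests and cannot randomise, because the two branches give it at most 3/8 and at least 5/8.

    The simulated machine is diagonal: from its input it computes the code of the very game that
    simulates it on this input, runs the alleged decision procedure on it, and stops at one of two
    locations according to the answer.  One location ends the simulation harmlessly, and the run
    gives a pure finite-state equilibrium; the other makes the system win, and there is no
    equilibrium giving it 0.  Either way the answer was wrong, for all four classes at once. *)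

Require Import Defs.
From Stdlib Require Import Reals List Arith Wf_nat Lia Lra Bool FunctionalExtensionality.
From Coquelicot Require Import Coquelicot.
Import ListNotations.
Open Scope R_scope.

(** * Sums over lists *)

Definition lsum {A : Type} (l : list A) (F : A -> R) : R := sumR (map F l).

Lemma lsum_nil {A} (F : A -> R) : lsum [] F = 0.
Proof. reflexivity. Qed.

Lemma lsum_cons {A} (a : A) l F : lsum (a :: l) F = F a + lsum l F.
Proof. reflexivity. Qed.

Lemma lsum_app {A} (l l' : list A) F : lsum (l ++ l') F = lsum l F + lsum l' F.
Proof.
  induction l as [|a l IH]; cbn [app]; rewrite ?lsum_nil, ?lsum_cons, ?IH; lra.
Qed.

Lemma lsum_map {A B} (f : A -> B) l F : lsum (map f l) F = lsum l (fun a => F (f a)).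
Proof. unfold lsum. now rewrite map_map. Qed.

Lemma lsum_ext {A} (l : list A) F F' :
  (forall a, In a l -> F a = F' a) -> lsum l F = lsum l F'.
Proof. intros H. unfold lsum. f_equal. now apply map_ext_in. Qed.

Lemma lsum_plus {A} (l : list A) F F' :
  lsum l (fun a => F a + F' a) = lsum l F + lsum l F'.
Proof.
  induction l as [|a l IH]; rewrite ?lsum_nil, ?lsum_cons, ?IH; lra.
Qed.

Lemma lsum_scal {A} (l : list A) c F : lsum l (fun a => c * F a) = c * lsum l F.
Proof.
  induction l as [|a l IH]; rewrite ?lsum_nil, ?lsum_cons, ?IH; lra.
Qed.

Lemma lsum_const {A} (l : list A) c : lsum l (fun _ => c) = INR (length l) * c.
Proof.
  induction l as [|a l IH]; [rewrite lsum_nil; simpl; lra|].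
  rewrite lsum_cons, IH. cbn [length]. rewrite S_INR. lra.
Qed.

Lemma lsum_zero {A} (l : list A) F : (forall a, In a l -> F a = 0) -> lsum l F = 0.
Proof. intros H. rewrite (lsum_ext l F (fun _ => 0) H), lsum_const. lra. Qed.

Lemma lsum_le {A} (l : list A) F F' :
  (forall a, In a l -> F a <= F' a) -> lsum l F <= lsum l F'.
Proof.
  induction l as [|a l IH]; intros H; rewrite ?lsum_nil, ?lsum_cons.
  - lra.
  - apply Rplus_le_compat; [apply H; now left | apply IH; intros; apply H; now right].
Qed.

Lemma lsum_nonneg {A} (l : list A) F : (forall a, In a l -> 0 <= F a) -> 0 <= lsum l F.
Proof.
  intros H. rewrite <- (lsum_zero l (fun _ => 0)) by easy. now apply lsum_le.
Qed.

Lemma lsum_middle {A} (l l' : list A) a F :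
  lsum (l ++ a :: l') F = F a + lsum (l ++ l') F.
Proof. rewrite !lsum_app, lsum_cons. lra. Qed.

Lemma lsum_lt {A} (l : list A) F F' a :
  (forall x, In x l -> F x <= F' x) -> In a l -> F a < F' a -> lsum l F < lsum l F'.
Proof.
  intros H Ha Hlt. apply in_split in Ha as (l1 & l2 & ->). rewrite !lsum_middle.
  apply Rplus_lt_le_compat; [easy|]. apply lsum_le. intros x Hx. apply H.
  apply in_app_iff in Hx. apply in_app_iff. simpl. tauto.
Qed.

Lemma lsum_term_le {A} (l : list A) F a :
  (forall x, In x l -> 0 <= F x) -> In a l -> F a <= lsum l F.
Proof.
  intros H Ha. apply in_split in Ha as (l1 & l2 & ->). rewrite lsum_middle.
  enough (0 <= lsum (l1 ++ l2) F) by lra. apply lsum_nonneg. intros x Hx. apply H.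
  apply in_app_iff in Hx. apply in_app_iff. simpl. tauto.
Qed.

Lemma lsum_single {A} (l : list A) a F :
  NoDup l -> In a l -> (forall x, In x l -> x <> a -> F x = 0) -> lsum l F = F a.
Proof.
  intros Hd Ha H. apply in_split in Ha as (l1 & l2 & ->).
  apply NoDup_remove_2 in Hd. rewrite lsum_middle, lsum_zero; [lra|].
  intros x Hx. apply H; [|now intros ->].
  apply in_app_iff in Hx. apply in_app_iff. simpl. tauto.
Qed.

Lemma lsum_pair {A} (l : list A) a b F :
  NoDup l -> In a l -> In b l -> a <> b ->
  (forall x, In x l -> x <> a -> x <> b -> F x = 0) -> lsum l F = F a + F b.
Proof.
  intros Hd Ha Hb Hab H. apply in_split in Ha as (l1 & l2 & ->). rewrite lsum_middle.
  pose proof (NoDup_remove_1 _ _ _ Hd) as Hd'. apply NoDup_remove_2 in Hd.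
  rewrite (lsum_single (l1 ++ l2) b); auto.
  - apply in_app_iff in Hb as [Hb|[Hb|Hb]]; [| |]; try apply in_app_iff; tauto.
  - intros x Hx Hxb. apply H; auto; [|now intros ->].
    apply in_app_iff in Hx. apply in_app_iff. simpl. tauto.
Qed.

Lemma lsum_seq_single n a F : (a < n)%nat ->
  (forall x, (x < n)%nat -> x <> a -> F x = 0) -> lsum (seq 0 n) F = F a.
Proof.
  intros Ha H. apply lsum_single; [apply seq_NoDup|apply in_seq; lia|].
  intros x Hx. apply in_seq in Hx. apply H. lia.
Qed.

Lemma lsum_filter {A} (f : A -> bool) l F :
  lsum (filter f l) F = lsum l (fun a => if f a then F a else 0).
Proof.
  induction l as [|a l IH]; [easy|]. cbn [filter]. rewrite lsum_cons.
  destruct (f a); rewrite ?lsum_cons, IH; lra.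
Qed.

Lemma lsum_flat_map {A B} (f : A -> list B) l F :
  lsum (flat_map f l) F = lsum l (fun a => lsum (f a) F).
Proof.
  induction l as [|a l IH]; [easy|]. cbn [flat_map].
  now rewrite lsum_app, lsum_cons, IH.
Qed.

Lemma lsum_swap {A B} (l : list A) (l' : list B) F :
  lsum l (fun a => lsum l' (F a)) = lsum l' (fun b => lsum l (fun a => F a b)).
Proof.
  induction l as [|a l IH].
  - symmetry. now apply lsum_zero.
  - rewrite lsum_cons, IH, <- lsum_plus. now apply lsum_ext.
Qed.

Lemma is_lim_seq_lsum {A} (l : list A) (F : nat -> A -> R) (L : A -> R) :
  (forall a, In a l -> is_lim_seq (fun n => F n a) (L a)) ->
  is_lim_seq (fun n => lsum l (F n)) (lsum l L).
Proof.
  induction l as [|a l IH]; intros H.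
  - apply is_lim_seq_const.
  - rewrite lsum_cons.
    apply is_lim_seq_ext with (fun n => F n a + lsum l (F n)); [easy|].
    apply is_lim_seq_plus'; [apply H; now left|]. apply IH. intros; apply H; now right.
Qed.

Definition dirac (w w' : nat) : R := if Nat.eqb w' w then 1 else 0.

Lemma dirac_same w : dirac w w = 1.
Proof. unfold dirac. now rewrite Nat.eqb_refl. Qed.

Lemma dirac_other w w' : w' <> w -> dirac w w' = 0.
Proof. intros H. unfold dirac. now apply Nat.eqb_neq in H as ->. Qed.

Lemma dirac_nonneg w w' : 0 <= dirac w w'.
Proof. unfold dirac. destruct (Nat.eqb w' w); lra. Qed.

Lemma dirac_nonzero w w' : dirac w w' <> 0 -> w' = w.
Proof. unfold dirac. now destruct (Nat.eqb_spec w' w). Qed.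

Lemma lsum_dirac n w F : (w < n)%nat -> lsum (seq 0 n) (fun w' => dirac w w' * F w') = F w.
Proof.
  intros Hw. rewrite (lsum_seq_single n w); auto.
  - rewrite dirac_same. lra.
  - intros w' _ Hne. rewrite dirac_other by auto. lra.
Qed.

Lemma dirac_total n w : (w < n)%nat -> lsum (seq 0 n) (dirac w) = 1.
Proof.
  intros Hw. rewrite <- (lsum_dirac n w (fun _ => 1) Hw). apply lsum_ext. intros; lra.
Qed.

(** * Values of histories *)

Definition expect (G : game) (p : profile) (h : list nat) (F : nat -> R) : R :=
  lsum (seq 0 (g_nV G)) (fun w => step G p h w * F w).

(* The probability, given the history [h], that the target of [i] contains the last vertex of [h]
   or is reached within [n] more steps. *)
Fixpoint reach_within (G : game) (p : profile) (i n : nat) (h : list nat) : R :=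
  if target_b G i (last h 0%nat) then 1
  else match n with
       | O => 0
       | S m => expect G p h (fun w => reach_within G p i m (h ++ [w]))
       end.

Definition value (G : game) (p : profile) (i : nat) (h : list nat) : R :=
  real (Lim_seq (fun n => reach_within G p i n h)).

Definition strat_profile (G : game) (p : profile) : Prop :=
  forall i, (i <= g_k G)%nat -> is_strategy G i (p i).

Inductive reach (G : game) (p : profile) : list nat -> Prop :=
| reach_init : reach G p [g_v0 G]
| reach_step h w : reach G p h -> (w < g_nV G)%nat -> 0 < step G p h w -> reach G p (h ++ [w]).

Lemma reach_within_target G p i n h :
  target_b G i (last h 0%nat) = true -> reach_within G p i n h = 1.
Proof. intros H. destruct n; simpl; now rewrite H. Qed.

Lemma reach_within_0 G p i h :
  target_b G i (last h 0%nat) = false -> reach_within G p i 0 h = 0.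
Proof. intros H. simpl. now rewrite H. Qed.

Lemma reach_within_S G p i n h : target_b G i (last h 0%nat) = false ->
  reach_within G p i (S n) h = expect G p h (fun w => reach_within G p i n (h ++ [w])).
Proof. intros H. cbn [reach_within]. now rewrite H. Qed.

Lemma value_target G p i h : target_b G i (last h 0%nat) = true -> value G p i h = 1.
Proof.
  intros Ht. unfold value. rewrite (Lim_seq_ext _ (fun _ => 1)).
  - now rewrite Lim_seq_const.
  - intros n. now apply reach_within_target.
Qed.

Lemma strat_profile_update G p i t :
  strat_profile G p -> is_strategy G i t -> strat_profile G (update p i t).
Proof.
  intros Hp Ht j Hj. unfold update. destruct (Nat.eqb_spec j i) as [->|]; auto.
Qed.

Lemma valid_hist_snoc G g v :
  valid_hist G (g ++ [v]) <-> valid_hist G g /\ (v < g_nV G)%nat.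
Proof.
  unfold valid_hist. rewrite Forall_app. split; intros [Hg Hv]; split; auto.
  now inversion Hv.
Qed.

Lemma valid_hist_last G g v : valid_hist G (g ++ [v]) -> (v < g_nV G)%nat.
Proof. intros H. now apply valid_hist_snoc in H. Qed.

Lemma valid_hist_next G g w : valid_hist G g -> (w < g_nV G)%nat -> valid_hist G (g ++ [w]).
Proof. intros. now apply valid_hist_snoc. Qed.

Lemma expect_plus G p h F F' :
  expect G p h (fun w => F w + F' w) = expect G p h F + expect G p h F'.
Proof.
  unfold expect. rewrite <- lsum_plus. apply lsum_ext. intros; lra.
Qed.

Lemma expect_mass G p h c :
  expect G p h (fun _ => c) = c * lsum (seq 0 (g_nV G)) (step G p h).
Proof. rewrite <- lsum_scal. apply lsum_ext. intros; lra. Qed.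

Lemma expect_dirac G p h w F : (w < g_nV G)%nat ->
  (forall w', step G p h w' = dirac w w') -> expect G p h F = F w.
Proof.
  intros Hw Hs. rewrite <- (lsum_dirac (g_nV G) w F Hw). apply lsum_ext.
  intros w' _. now rewrite Hs.
Qed.

Lemma target_b_target G i v : target_b G i v = true <-> target G i v.
Proof.
  unfold target_b, target. rewrite existsb_exists. split.
  - intros (v' & Hin & ->%Nat.eqb_eq). easy.
  - intros Hin. exists v. now rewrite Nat.eqb_refl.
Qed.

Section WellFormedGame.
Variable G : game.
Hypothesis Hwf : wf_game G.

Let nV := g_nV G.

Lemma target_final i v : target_b G i v = true -> (v < nV)%nat /\ terminal G v.
Proof.
  destruct Hwf as (_ & _ & _ & _ & Hlen & _ & Hterm).
  intros Ht%target_b_target. apply (Hterm i); auto.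
  destruct (le_lt_dec i (g_k G)) as [|Hi]; auto.
  unfold target in Ht. rewrite nth_overflow in Ht by lia. easy.
Qed.

Lemma qentry_overflow v w : (v < nV)%nat -> owner G v = None -> (nV <= w)%nat ->
  qentry G v w = (0%nat, 1%nat).
Proof.
  destruct Hwf as (_ & _ & _ & _ & _ & H & _). intros Hv Ho Hw.
  specialize (H v Hv). rewrite Ho in H. destruct H as (Hl & _).
  apply nth_overflow. fold nV in Hl. lia.
Qed.

Lemma next_lt v w : (v < nV)%nat -> next G v w -> (w < nV)%nat.
Proof.
  intros Hv Hn. destruct Hwf as (_ & _ & _ & _ & _ & H & _). specialize (H v Hv).
  unfold next in Hn. destruct (owner G v) eqn:Ho.
  - apply H, Hn.
  - destruct (le_lt_dec nV w); auto. rewrite qentry_overflow in Hn; auto. simpl in Hn; lia.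
Qed.

Lemma valid_hist_init : valid_hist G ([] ++ [g_v0 G]).
Proof. apply valid_hist_next; [constructor|apply Hwf]. Qed.

Lemma natp_nonneg v w : (v < nV)%nat -> owner G v = None -> 0 <= natp G v w.
Proof.
  intros Hv Ho. pose proof Hwf as (_ & _ & _ & _ & _ & H & _). specialize (H v Hv).
  rewrite Ho in H. destruct H as (_ & Hden & _).
  unfold natp. destruct (le_lt_dec nV w) as [Hw|Hw].
  - rewrite qentry_overflow by auto. simpl. lra.
  - apply Rmult_le_pos; [apply pos_INR|]. left. apply Rinv_0_lt_compat, lt_0_INR, Hden, Hw.
Qed.

Lemma natp_nonzero_next v w : owner G v = None -> natp G v w <> 0 -> next G v w.
Proof.
  unfold natp, next. intros -> H. destruct (fst (qentry G v w)); [simpl in H; lra|lia].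
Qed.

Section Profile.
Variable p : profile.
Hypothesis Hp : strat_profile G p.

Notation expect := (expect G p).
Notation reach_within := (reach_within G p).
Notation value := (value G p).

Lemma step_nonneg g v w : valid_hist G (g ++ [v]) -> 0 <= step G p (g ++ [v]) w.
Proof.
  intros Hv. pose proof (valid_hist_last _ _ _ Hv) as Hlt.
  unfold step. rewrite last_last. destruct (owner G v) as [i|] eqn:Ho.
  - pose proof Hwf as (_ & _ & _ & _ & _ & H & _). specialize (H v Hlt). rewrite Ho in H.
    apply (Hp i (proj1 H) g v Hv Ho).
  - now apply natp_nonneg.
Qed.

Lemma step_nonzero_next g v w : valid_hist G (g ++ [v]) ->
  step G p (g ++ [v]) w <> 0 -> next G v w.
Proof.
  intros Hv. pose proof (valid_hist_last _ _ _ Hv) as Hlt.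
  unfold step. rewrite last_last. destruct (owner G v) as [i|] eqn:Ho.
  - pose proof Hwf as (_ & _ & _ & _ & _ & H & _). specialize (H v Hlt). rewrite Ho in H.
    apply (Hp i (proj1 H) g v Hv Ho).
  - now apply natp_nonzero_next.
Qed.

Lemma step_total g v : valid_hist G (g ++ [v]) -> lsum (seq 0 nV) (step G p (g ++ [v])) = 1.
Proof.
  intros Hv. pose proof (valid_hist_last _ _ _ Hv) as Hlt.
  pose proof Hwf as (_ & _ & _ & _ & _ & H & _). specialize (H v Hlt).
  unfold step. rewrite last_last. destruct (owner G v) as [i|] eqn:Ho.
  - apply (Hp i (proj1 H) g v Hv Ho).
  - apply H.
Qed.

Lemma step_mult_le g v w a a' : valid_hist G (g ++ [v]) ->
  (0 < step G p (g ++ [v]) w -> a <= a') ->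
  step G p (g ++ [v]) w * a <= step G p (g ++ [v]) w * a'.
Proof.
  intros Hv H. destruct (Rle_lt_or_eq_dec 0 _ (step_nonneg g v w Hv)) as [Hpos|<-]; [|lra].
  apply Rmult_le_compat_l; [lra|auto].
Qed.

Lemma expect_le g v F F' : valid_hist G (g ++ [v]) ->
  (forall w, (w < nV)%nat -> 0 < step G p (g ++ [v]) w -> F w <= F' w) ->
  expect (g ++ [v]) F <= expect (g ++ [v]) F'.
Proof.
  intros Hv H. apply lsum_le. intros w Hw%in_seq. apply step_mult_le; auto. apply H. lia.
Qed.

Lemma expect_lt g v w F F' : valid_hist G (g ++ [v]) ->
  (forall w', (w' < nV)%nat -> 0 < step G p (g ++ [v]) w' -> F w' <= F' w') ->
  (w < nV)%nat -> 0 < step G p (g ++ [v]) w -> F w < F' w ->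
  expect (g ++ [v]) F < expect (g ++ [v]) F'.
Proof.
  intros Hv H Hw Hs Hlt. apply lsum_lt with w.
  - intros w' Hw'%in_seq. apply step_mult_le; auto. apply H. lia.
  - apply in_seq. lia.
  - now apply Rmult_lt_compat_l.
Qed.

Lemma expect_ext g v F F' : valid_hist G (g ++ [v]) ->
  (forall w, (w < nV)%nat -> 0 < step G p (g ++ [v]) w -> F w = F' w) ->
  expect (g ++ [v]) F = expect (g ++ [v]) F'.
Proof.
  intros Hv H. apply Rle_antisym; apply expect_le; auto; intros w Hw Hs;
  rewrite (H w Hw Hs); lra.
Qed.

Lemma expect_const g v c : valid_hist G (g ++ [v]) -> expect (g ++ [v]) (fun _ => c) = c.
Proof.
  intros Hv. rewrite expect_mass, step_total by auto. lra.
Qed.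

Lemma expect_attained g v c F : valid_hist G (g ++ [v]) ->
  (forall w, (w < nV)%nat -> 0 < step G p (g ++ [v]) w -> F w <= c) ->
  expect (g ++ [v]) F = c ->
  forall w, (w < nV)%nat -> 0 < step G p (g ++ [v]) w -> F w = c.
Proof.
  intros Hv Hle Heq w Hw Hs.
  destruct (Rle_lt_or_eq_dec _ _ (Hle w Hw Hs)) as [Hlt|]; auto.
  pose proof (expect_lt g v w F (fun _ => c) Hv Hle Hw Hs Hlt) as H.
  rewrite expect_const in H by auto. lra.
Qed.

Lemma reach_within_bounds i n : forall g v, valid_hist G (g ++ [v]) ->
  0 <= reach_within i n (g ++ [v]) <= 1.
Proof.
  induction n as [|n IH]; intros g v Hv;
    destruct (target_b G i (last (g ++ [v]) 0%nat)) eqn:Ht;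
    try (rewrite reach_within_target by easy; lra).
  - rewrite reach_within_0 by easy; lra.
  - rewrite reach_within_S by easy.
    rewrite <- (expect_const g v 0 Hv) at 1. rewrite <- (expect_const g v 1 Hv).
    split; apply expect_le; auto; intros w Hw _; apply IH; now apply valid_hist_next.
Qed.

Lemma reach_within_incr i n : forall g v, valid_hist G (g ++ [v]) ->
  reach_within i n (g ++ [v]) <= reach_within i (S n) (g ++ [v]).
Proof.
  induction n as [|n IH]; intros g v Hv;
    destruct (target_b G i (last (g ++ [v]) 0%nat)) eqn:Ht;
    try (rewrite !reach_within_target by easy; lra).
  - rewrite reach_within_0 by easy. now apply reach_within_bounds.
  - rewrite (reach_within_S G p i n), (reach_within_S G p i (S n)) by easy.
    apply expect_le; auto. intros w Hw _. apply IH. now apply valid_hist_next.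
Qed.

Lemma pprob_total n : forall g v, valid_hist G (g ++ [v]) ->
  lsum (all_lists nV n) (pprob G p (g ++ [v])) = 1.
Proof.
  induction n as [|n IH]; intros g v Hv.
  - unfold lsum; simpl; lra.
  - cbn [all_lists]. rewrite lsum_flat_map. rewrite <- (expect_const g v 1 Hv).
    apply lsum_ext. intros w Hw%in_seq. rewrite lsum_map.
    cbn [pprob]. rewrite lsum_scal, IH; auto. apply valid_hist_next; auto. lia.
Qed.

Lemma reach_within_pprob i n : forall g v, valid_hist G (g ++ [v]) ->
  reach_within i n (g ++ [v]) =
  lsum (all_lists nV n)
    (fun r => if existsb (target_b G i) (v :: r) then pprob G p (g ++ [v]) r else 0).
Proof.
  induction n as [|n IH]; intros g v Hv; destruct (target_b G i v) eqn:Ht.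
  - rewrite reach_within_target by now rewrite last_last.
    unfold lsum. simpl. rewrite Ht. simpl. lra.
  - rewrite reach_within_0 by now rewrite last_last.
    unfold lsum. simpl. rewrite Ht. simpl. lra.
  - rewrite reach_within_target by now rewrite last_last.
    rewrite <- (pprob_total (S n) g v Hv). apply lsum_ext.
    intros r _. cbn [existsb]. now rewrite Ht.
  - rewrite reach_within_S by now rewrite last_last.
    cbn [all_lists]. rewrite lsum_flat_map. apply lsum_ext.
    intros w Hw%in_seq. rewrite lsum_map, IH by (apply valid_hist_next; auto; lia).
    rewrite <- lsum_scal. apply lsum_ext. intros r _. cbn [existsb pprob]. rewrite Ht.
    cbn [orb]. destruct (_ || _)%bool; lra.
Qed.

Lemma reach_prob_reach_within i n : reach_prob G p i n = reach_within i n [g_v0 G].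
Proof.
  change [g_v0 G] with ([] ++ [g_v0 G]). rewrite reach_within_pprob by apply valid_hist_init.
  unfold reach_prob. fold nV.
  change (lsum (filter (fun h => existsb (target_b G i) h) (all_lists nV (S n))) (hprob G p) =
    lsum (all_lists nV n) (fun r =>
      if existsb (target_b G i) (g_v0 G :: r) then pprob G p ([] ++ [g_v0 G]) r else 0)).
  rewrite lsum_filter. cbn [all_lists]. rewrite lsum_flat_map.
  rewrite (lsum_seq_single nV (g_v0 G)).
  - rewrite lsum_map. apply lsum_ext. intros r _. cbn [hprob app]. now rewrite Nat.eqb_refl.
  - apply Hwf.
  - intros v _ Hv. rewrite lsum_map. apply lsum_zero. intros r _. cbn [hprob].
    apply Nat.eqb_neq in Hv as ->. now destruct (existsb _ _).
Qed.

Lemma value_lim i g v : valid_hist G (g ++ [v]) ->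
  is_lim_seq (fun n => reach_within i n (g ++ [v])) (value i (g ++ [v])).
Proof.
  intros Hv. apply Lim_seq_correct'.
  apply (ex_finite_lim_seq_incr _ 1).
  - intros n. now apply reach_within_incr.
  - intros n. now apply reach_within_bounds.
Qed.

Lemma reach_within_le_value i n g v : valid_hist G (g ++ [v]) ->
  reach_within i n (g ++ [v]) <= value i (g ++ [v]).
Proof.
  intros Hv. apply (is_lim_seq_incr_compare _ _ (value_lim i g v Hv)).
  intros m. now apply reach_within_incr.
Qed.

Lemma value_le i g v c : valid_hist G (g ++ [v]) ->
  (forall n, reach_within i n (g ++ [v]) <= c) -> value i (g ++ [v]) <= c.
Proof.
  intros Hv H. exact (is_lim_seq_le _ (fun _ => c) _ (Finite c) H
    (value_lim i g v Hv) (is_lim_seq_const c)).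
Qed.

Lemma value_bounds i g v : valid_hist G (g ++ [v]) -> 0 <= value i (g ++ [v]) <= 1.
Proof.
  intros Hv. split.
  - apply Rle_trans with (reach_within i 0 (g ++ [v])).
    + now apply reach_within_bounds.
    + now apply reach_within_le_value.
  - apply value_le; auto. intros n. now apply reach_within_bounds.
Qed.

Lemma Pay_value i : Pay G p i = Finite (value i [g_v0 G]).
Proof.
  apply is_sup_seq_unique. change [g_v0 G] with ([] ++ [g_v0 G]).
  intros eps. split.
  - intros n. simpl. rewrite reach_prob_reach_within.
    pose proof (reach_within_le_value i n [] (g_v0 G) valid_hist_init) as H. simpl in H.
    destruct eps as [e He]; simpl; lra.
  - pose proof (value_lim i [] (g_v0 G) valid_hist_init) as H.
    apply is_lim_seq_spec in H. destruct (H eps) as [N HN]. exists N. simpl.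
    rewrite reach_prob_reach_within. specialize (HN N (Nat.le_refl N)). simpl in HN.
    apply Rabs_lt_between in HN. lra.
Qed.

Lemma value_step i g v : valid_hist G (g ++ [v]) -> target_b G i v = false ->
  value i (g ++ [v]) = expect (g ++ [v]) (fun w => value i ((g ++ [v]) ++ [w])).
Proof.
  intros Hv Ht.
  pose proof (value_lim i g v Hv) as Hlim. apply is_lim_seq_incr_1 in Hlim.
  assert (Hexp : is_lim_seq (fun n => reach_within i (S n) (g ++ [v]))
                   (expect (g ++ [v]) (fun w => value i ((g ++ [v]) ++ [w])))).
  { apply is_lim_seq_ext with
      (fun n => expect (g ++ [v]) (fun w => reach_within i n ((g ++ [v]) ++ [w]))).
    - intros n. symmetry. apply reach_within_S. now rewrite last_last.
    - apply (is_lim_seq_lsum (seq 0 nV)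
        (fun n w => step G p (g ++ [v]) w * reach_within i n ((g ++ [v]) ++ [w]))
        (fun w => step G p (g ++ [v]) w * value i ((g ++ [v]) ++ [w]))).
      intros w Hw%in_seq. apply is_lim_seq_mult'; [apply is_lim_seq_const|].
      apply value_lim. apply valid_hist_next; auto. lia. }
  apply is_lim_seq_unique in Hlim, Hexp. rewrite Hlim in Hexp. now injection Hexp.
Qed.

Lemma reach_valid h : reach G p h -> valid_hist G h /\ exists g v, h = g ++ [v].
Proof.
  induction 1 as [|h w _ [IH _] Hw _].
  - split; [apply valid_hist_init|]. now exists [], (g_v0 G).
  - split; [now apply valid_hist_next|]. now exists h, w.
Qed.

Lemma value_supersolution i (D : list nat -> Prop) (W : list nat -> R) :
  (forall g v, D (g ++ [v]) -> valid_hist G (g ++ [v]) -> 0 <= W (g ++ [v]) /\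
     if target_b G i v then 1 <= W (g ++ [v])
     else (forall w, (w < nV)%nat -> 0 < step G p (g ++ [v]) w -> D ((g ++ [v]) ++ [w])) /\
          expect (g ++ [v]) (fun w => W ((g ++ [v]) ++ [w])) <= W (g ++ [v])) ->
  forall g v, D (g ++ [v]) -> valid_hist G (g ++ [v]) ->
  value i (g ++ [v]) <= W (g ++ [v]).
Proof.
  intros H g v HD Hv. apply value_le; auto. intros n. revert g v HD Hv.
  induction n as [|n IH]; intros g v HD Hv;
    destruct (H g v HD Hv) as [Hpos Hstep]; destruct (target_b G i v) eqn:Ht;
    try (rewrite reach_within_target by (now rewrite last_last); lra).
  - rewrite reach_within_0 by (now rewrite last_last); lra.
  - rewrite reach_within_S by now rewrite last_last.
    destruct Hstep as [Hclosed Hle]. eapply Rle_trans; [|apply Hle].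
    apply expect_le; auto. intros w Hw Hs. apply IH; auto. now apply valid_hist_next.
Qed.

Lemma value_pos_initial i h : reach G p h -> 0 < value i h -> 0 < value i [g_v0 G].
Proof.
  induction 1 as [|h w Hr IH Hw Hs]; auto. intros Hx. apply IH.
  destruct (reach_valid h Hr) as [Hv (g & v & ->)].
  destruct (target_b G i v) eqn:Ht.
  - rewrite value_target by (now rewrite last_last). lra.
  - rewrite value_step by auto. rewrite <- (expect_const g v 0 Hv).
    apply expect_lt with w; auto.
    intros w' Hw' _. apply value_bounds. now apply valid_hist_next.
Qed.

Lemma reach_within_avoiding i (C : nat -> Prop) :
  (forall v, C v -> target_b G i v = false) ->
  (forall v w, C v -> (v < nV)%nat -> next G v w -> C w) ->
  forall n g v, valid_hist G (g ++ [v]) -> C v -> reach_within i n (g ++ [v]) = 0.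
Proof.
  intros Ht Hc n. induction n as [|n IH]; intros g v Hv HC.
  - apply reach_within_0. rewrite last_last. auto.
  - rewrite reach_within_S by (rewrite last_last; auto).
    rewrite <- (expect_const g v 0 Hv). apply expect_ext; auto.
    intros w Hw Hs. apply IH; [now apply valid_hist_next|].
    apply Hc with v; auto.
    + now apply valid_hist_last in Hv.
    + apply step_nonzero_next with g; auto. lra.
Qed.

Lemma value_avoiding i (C : nat -> Prop) :
  (forall v, C v -> target_b G i v = false) ->
  (forall v w, C v -> (v < nV)%nat -> next G v w -> C w) ->
  forall g v, valid_hist G (g ++ [v]) -> C v -> value i (g ++ [v]) = 0.
Proof.
  intros Ht Hc g v Hv HC. apply Rle_antisym.
  - apply value_le; auto. intros n. rewrite (reach_within_avoiding i C); auto. lra.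
  - now apply value_bounds.
Qed.

Lemma reach_within_terminal i n g v : terminal G v -> target_b G i v = false ->
  valid_hist G (g ++ [v]) -> reach_within i n (g ++ [v]) = 0.
Proof.
  intros Hterm Ht Hv. apply reach_within_avoiding with (C := fun u => u = v); auto.
  - now intros u ->.
  - intros u w -> _ Hn. now apply Hterm.
Qed.

Lemma value_disjoint i j :
  (forall v, target_b G i v = true -> target_b G j v = false) ->
  forall g v, valid_hist G (g ++ [v]) -> value i (g ++ [v]) + value j (g ++ [v]) <= 1.
Proof.
  intros Hd.
  assert (Hn : forall n g v, valid_hist G (g ++ [v]) ->
     reach_within i n (g ++ [v]) + reach_within j n (g ++ [v]) <= 1).
  { induction n as [|n IH]; intros g v Hv;
      (destruct (target_b G i v) eqn:Hi; [|destruct (target_b G j v) eqn:Hj]);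
      try (rewrite (reach_within_terminal j) by (auto; now apply (target_final i));
           rewrite reach_within_target by (now rewrite last_last); lra);
      try (rewrite (reach_within_terminal i) by (auto; now apply (target_final j));
           rewrite reach_within_target by (now rewrite last_last); lra).
    - rewrite !reach_within_0 by (now rewrite last_last). lra.
    - rewrite !reach_within_S by (now rewrite last_last).
      rewrite <- expect_plus, <- (expect_const g v 1 Hv). apply expect_le; auto.
      intros w Hw _. apply IH. now apply valid_hist_next. }
  intros g v Hv.
  exact (is_lim_seq_le _ (fun _ => 1) _ (Finite 1) (fun n => Hn n g v Hv)
    (is_lim_seq_plus' _ _ _ _ (value_lim i g v Hv) (value_lim j g v Hv)) (is_lim_seq_const 1)).
Qed.

End Profile.

(** * Deviations at a single history *)

Section OneHistory.
Variables p p' : profile.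
Hypothesis Hp : strat_profile G p.
Hypothesis Hp' : strat_profile G p'.
Variable hs : list nat.
Hypothesis Hagree : forall h w, h <> hs -> step G p' h w = step G p h w.

Lemma expect_agree h F : h <> hs -> expect G p' h F = expect G p h F.
Proof. intros Hh. apply lsum_ext. intros w _. now rewrite Hagree. Qed.

Lemma reach_within_agree i n : forall h, (forall t, hs <> h ++ t) ->
  reach_within G p' i n h = reach_within G p i n h.
Proof.
  induction n as [|n IH]; intros h Hh; cbn [reach_within]; destruct (target_b G i _); auto.
  rewrite expect_agree.
  - apply lsum_ext. intros w _. rewrite IH; auto.
    intros t Ht. apply (Hh (w :: t)). now rewrite Ht, <- app_assoc.
  - intros ->. apply (Hh []). now rewrite app_nil_r.
Qed.

Lemma value_agree i h : (forall t, hs <> h ++ t) -> value G p' i h = value G p i h.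
Proof.
  intros Hh. unfold value. f_equal. apply Lim_seq_ext. intros n. now apply reach_within_agree.
Qed.

Lemma improvement_propagates i h : reach G p h -> (exists t, hs = h ++ t) ->
  value G p i h < value G p' i h -> value G p i [g_v0 G] < value G p' i [g_v0 G].
Proof.
  induction 1 as [|h w Hr IH Hw Hs]; auto. intros [t Ht] Hx.
  destruct (reach_valid p h Hr) as [Hv (g & v & Hgv)].
  apply IH; [exists (w :: t); now rewrite Ht, <- app_assoc|]. subst h.
  destruct (target_b G i v) eqn:Htg.
  - exfalso. assert (w = v) as ->.
    { apply (target_final i v Htg). apply (step_nonzero_next p Hp g); auto. lra. }
    rewrite !value_target in Hx by (now rewrite last_last). lra.
  - rewrite !value_step by auto. rewrite expect_agree.
    + apply expect_lt with w; auto.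
      intros w' _ _. destruct (Nat.eq_dec w' w) as [->|Hne]; [lra|].
      rewrite value_agree; [lra|]. intros t' Ht'. rewrite Ht in Ht'.
      rewrite <- !app_assoc in Ht'. apply app_inv_head in Ht'. apply app_inv_head in Ht'.
      simpl in Ht'. congruence.
    + rewrite Ht. intros Heq. apply (f_equal (@length nat)) in Heq.
      rewrite !length_app in Heq. simpl in Heq. lia.
Qed.

End OneHistory.

Definition redirect (s : strategy) (hs : list nat) (w : nat) : strategy :=
  fun h => if list_eq_dec Nat.eq_dec h hs then dirac w else s h.

Lemma redirect_same s hs w : redirect s hs w hs = dirac w.
Proof. unfold redirect. now destruct (list_eq_dec _ _ _). Qed.

Lemma redirect_other s hs w h : h <> hs -> redirect s hs w h = s h.
Proof. intros H. unfold redirect. now destruct (list_eq_dec _ _ _). Qed.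

Lemma redirect_strategy i s g v w : is_strategy G i s ->
  valid_hist G (g ++ [v]) -> next G v w -> is_strategy G i (redirect s (g ++ [v]) w).
Proof.
  intros Hs Hv Hn h u Hhu Hou.
  destruct (list_eq_dec Nat.eq_dec (h ++ [u]) (g ++ [v])) as [Heq|Hne].
  - rewrite Heq, redirect_same. apply app_inj_tail in Heq as [_ ->]. repeat split.
    + apply dirac_nonneg.
    + now intros w' ->%dirac_nonzero.
    + apply dirac_total. apply next_lt with v; auto. now apply valid_hist_last in Hv.
  - rewrite redirect_other by auto. now apply Hs.
Qed.

Lemma redirect_pure i s hs w : pure G i s -> pure G i (redirect s hs w).
Proof.
  intros H h u Hhu Hou. unfold redirect. destruct (list_eq_dec _ _ _); [|eauto].
  exists w. reflexivity.
Qed.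

(* The state of an automaton that recognises the history [hs]: the length of the prefix read so
   far, or [S (length hs)] after a mismatch. *)
Definition track (hs : list nat) (j v : nat) : nat :=
  if (Nat.ltb j (length hs) && Nat.eqb (nth j hs 0%nat) v)%bool then S j else S (length hs).

Lemma track_le hs j v : (track hs j v <= S (length hs))%nat.
Proof.
  unfold track. destruct (Nat.ltb_spec j (length hs)); simpl; try lia.
  destruct (Nat.eqb _ _); lia.
Qed.

Lemma track_overflow hs j v : (length hs <= j)%nat -> track hs j v = S (length hs).
Proof. intros H. unfold track. now destruct (Nat.ltb_spec j (length hs)); [lia|]. Qed.

Lemma track_mismatch hs h : fold_left (track hs) h (S (length hs)) = S (length hs).
Proof.
  induction h as [|v h IH]; auto. cbn [fold_left]. rewrite track_overflow by lia. exact IH.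
Qed.

Lemma track_recognises h : forall pre suf,
  fold_left (track (pre ++ suf)) h (length pre) = length (pre ++ suf) <-> h = suf.
Proof.
  induction h as [|v h IH]; intros pre suf; cbn [fold_left].
  - rewrite length_app. destruct suf; simpl; split; (easy || lia).
  - destruct suf as [|a suf].
    + rewrite app_nil_r, track_overflow, track_mismatch by lia. split; [lia|easy].
    + unfold track at 2. rewrite nth_middle.
      replace (Nat.ltb (length pre) (length (pre ++ a :: suf))) with true
        by (symmetry; apply Nat.ltb_lt; rewrite length_app; simpl; lia).
      cbn [andb]. destruct (Nat.eqb_spec a v) as [->|Hne].
      * replace (pre ++ v :: suf) with ((pre ++ [v]) ++ suf) by (now rewrite <- app_assoc).
        replace (S (length pre)) with (length (pre ++ [v])) by (rewrite length_app; simpl; lia).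
        rewrite IH. split; [now intros ->|now injection 1].
      * rewrite track_mismatch. split; [lia|]. congruence.
Qed.

(* A pair of states [q < m] and [j] is coded as [q + m * j]. *)
Lemma pair_state_decode m q j : (q < m)%nat ->
  ((q + m * j) / m = j /\ (q + m * j) mod m = q)%nat.
Proof.
  intros Hq. rewrite (Nat.mul_comm m j). split.
  - rewrite Nat.div_add, Nat.div_small; lia.
  - rewrite Nat.Div0.mod_add, Nat.mod_small; lia.
Qed.

Lemma fold_left_lt m (upd : nat -> nat -> nat) :
  (forall q v, (q < m)%nat -> (upd q v < m)%nat) ->
  forall h q, (q < m)%nat -> (fold_left upd h q < m)%nat.
Proof. intros Hupd h. induction h as [|v h IH]; intros q Hq; cbn [fold_left]; auto. Qed.

Lemma fold_left_pair_state m (upd upd' : nat -> nat -> nat) :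
  (forall q v, (q < m)%nat -> (upd q v < m)%nat) ->
  forall h q j, (q < m)%nat ->
  fold_left (fun s v => upd (s mod m) v + m * upd' (s / m) v)%nat h (q + m * j)%nat =
  (fold_left upd h q + m * fold_left upd' h j)%nat.
Proof.
  intros Hupd h. induction h as [|v h IH]; intros q j Hq; cbn [fold_left]; auto.
  destruct (pair_state_decode m q j Hq) as [-> ->]. now apply IH, Hupd.
Qed.

Lemma redirect_finite_state i s g v w : finite_state G i s ->
  finite_state G i (redirect s (g ++ [v]) w).
Proof.
  intros (m & m0 & upd & out & Hm & Hupd & Hout).
  exists (m * S (S (length g)))%nat, (m0 + m * 0)%nat,
    (fun q u => upd (q mod m) u + m * track g (q / m) u)%nat,
    (fun q u => if (Nat.eqb (q / m) (length g) && Nat.eqb u v)%bool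
                then dirac w else out (q mod m)%nat u).
  split; [nia|split].
  - intros q u _. pose proof (track_le g (q / m) u).
    pose proof (Hupd (q mod m)%nat u ltac:(apply Nat.mod_upper_bound; lia)). nia.
  - intros h u Hhu Hou w'. rewrite fold_left_pair_state by auto.
    pose proof (fold_left_lt m upd Hupd h m0 Hm) as Hlt.
    destruct (pair_state_decode m _ (fold_left (track g) h 0%nat) Hlt) as [-> ->].
    pose proof (track_recognises h [] g) as Htrack. cbn [app length] in Htrack.
    destruct (list_eq_dec Nat.eq_dec (h ++ [u]) (g ++ [v])) as [Heq|Hne].
    + rewrite Heq, redirect_same. apply app_inj_tail in Heq as [-> ->].
      now rewrite (proj2 Htrack eq_refl), !Nat.eqb_refl.
    + rewrite redirect_other, Hout by auto.
      destruct (Nat.eqb_spec (fold_left (track g) h 0%nat) (length g)) as [He|]; auto.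
      apply Htrack in He as ->. destruct (Nat.eqb_spec u v) as [->|]; easy.
Qed.

Lemma redirect_in_class c i s g v w : in_class c G i s ->
  valid_hist G (g ++ [v]) -> next G v w -> in_class c G i (redirect s (g ++ [v]) w).
Proof.
  intros [Hs Hc] Hv Hn. split; [now apply redirect_strategy|].
  destruct c; intuition auto using redirect_pure, redirect_finite_state.
Qed.

Lemma step_redirect_same p i g v w w' : owner G v = Some i ->
  step G (update p i (redirect (p i) (g ++ [v]) w)) (g ++ [v]) w' = dirac w w'.
Proof.
  intros Ho. unfold step. rewrite last_last, Ho. unfold update.
  now rewrite Nat.eqb_refl, redirect_same.
Qed.

Lemma step_redirect_other p i hs w h w' : h <> hs ->
  step G (update p i (redirect (p i) hs w)) h w' = step G p h w'.
Proof.
  intros Hh. unfold step. destruct (owner G (last h 0%nat)) as [j|]; auto.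
  unfold update. destruct (Nat.eqb_spec j i) as [->|]; auto. now rewrite redirect_other.
Qed.

Lemma NE_successor_le c p i g v w :
  strat_profile G p -> is_NE0 c G p -> (1 <= i <= g_k G)%nat -> in_class c G i (p i) ->
  reach G p (g ++ [v]) -> owner G v = Some i -> target_b G i v = false -> next G v w ->
  value G p i ((g ++ [v]) ++ [w]) <= value G p i (g ++ [v]).
Proof.
  intros Hp HNE Hi Hci Hr Ho Ht Hn.
  destruct (reach_valid p _ Hr) as [Hv _]. pose proof (valid_hist_last _ _ _ Hv) as Hlt.
  destruct (Rle_lt_dec (value G p i ((g ++ [v]) ++ [w])) (value G p i (g ++ [v]))) as [|Hx]; auto.
  exfalso. set (t := redirect (p i) (g ++ [v]) w). set (p' := update p i t).
  assert (Htc : in_class c G i t) by now apply redirect_in_class.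
  assert (Hp' : strat_profile G p') by (apply strat_profile_update; [easy|apply Htc]).
  assert (Hagree : forall h w', h <> g ++ [v] -> step G p' h w' = step G p h w')
    by (intros; now apply step_redirect_other).
  assert (Hgain : value G p i (g ++ [v]) < value G p' i (g ++ [v])).
  { rewrite (value_step p') by auto.
    rewrite (expect_dirac G p' (g ++ [v]) w); [|now apply next_lt with v|
      intros w'; now apply step_redirect_same].
    rewrite (value_agree p p' (g ++ [v]) Hagree); [lra|].
    intros t' Heq. apply (f_equal (@length nat)) in Heq. rewrite !length_app in Heq.
    simpl in Heq. lia. }
  pose proof (improvement_propagates p p' Hp Hp' (g ++ [v]) Hagree i (g ++ [v]) Hr
    ltac:(exists []; now rewrite app_nil_r) Hgain) as Hbetter.
  specialize (HNE i Hi t Htc). rewrite !Pay_value in HNE by auto. simpl in HNE.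
  fold p' in HNE. lra.
Qed.

End WellFormedGame.

(** * The game of a register machine *)

(* The effect of a phase on the probability [2^-n] that encodes a register. *)
Inductive effect : Type := Keep | Halve | Double | Annul.

(* In [Execute pc br] the flag [br] tells whether a [DEC] found its register nonzero. *)
Inductive phase : Type := Loading | Execute (pc : nat) (br : bool) | Accept.

Inductive side : Type := Checker | Opponent.

(* The flag [b] is the parity of the phase, and tells which family of checkers is checked.
   [VLoop], [VCoin], [VStop] form the gadget of a register: player 1 loops, reaching [VStop] with
   probability [2^-n] after [n] loops, and failing into [VPay r (negb b)] otherwise.  [VInput] is
   the gadget that loads the input.  At [VCheck] the [j]-th member of the family may leave to
   [VExit]; [VFork] distributes over the gadgets and the continuation.  At [VGuess] player 2
   chooses the branch of a [DEC], the nonzero one being confirmed at [VConfirm] by player 1.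
   [VPay r b] pays the checker of family [b] for register [r] and all opponents but its own,
   [VOpponents] all opponents, [VGuesser] moreover player 2, [VCheckers] all checkers,
   [VSysCheckers] the system and all checkers, [VSysOpponents] the system and all opponents. *)
Inductive vert : Type :=
| VInput
| VStop (k : effect) (b : bool) (r : nat)
| VPay (r : nat) (b : bool)
| VLoop (k : effect) (b : bool) (r : nat)
| VCoin (k : effect) (b : bool) (r : nat)
| VCheck (ph : phase) (b : bool) (j : nat)
| VFork (ph : phase) (b : bool)
| VGuess (pc : nat) (b : bool)
| VConfirm (pc : nat) (b : bool)
| VFinish (b : bool)
| VExit | VOpponents | VGuesser | VCheckers | VSysCheckers | VSysOpponents.

Definition effect_eq_dec (k k' : effect) : {k = k'} + {k <> k'}.
Proof. decide equality. Defined.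

Definition phase_eq_dec (ph ph' : phase) : {ph = ph'} + {ph <> ph'}.
Proof. decide equality; auto using Nat.eq_dec, bool_dec. Defined.

Definition vert_eq_dec (v v' : vert) : {v = v'} + {v <> v'}.
Proof.
  decide equality; auto using Nat.eq_dec, bool_dec, effect_eq_dec, phase_eq_dec.
Defined.

Fixpoint index {A : Type} (eq_dec : forall a b : A, {a = b} + {a <> b})
    (l : list A) (a : A) : nat :=
  match l with
  | [] => 0
  | a' :: l' => if eq_dec a' a then 0 else S (index eq_dec l' a)
  end%nat.

Lemma nth_index {A} eq_dec (l : list A) a d : In a l -> nth (index eq_dec l a) l d = a.
Proof.
  induction l as [|a' l IH]; [easy|]. intros H. simpl.
  destruct (eq_dec a' a) as [->|Hne]; auto. apply IH. now destruct H.
Qed.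

Lemma index_lt {A} eq_dec (l : list A) a : In a l -> (index eq_dec l a < length l)%nat.
Proof.
  induction l as [|a' l IH]; [easy|]. intros H. simpl.
  destruct (eq_dec a' a) as [->|Hne]; [lia|]. apply -> Nat.succ_lt_mono. apply IH. now destruct H.
Qed.

Lemma index_nth {A} eq_dec (l : list A) i d : NoDup l -> (i < length l)%nat ->
  index eq_dec l (nth i l d) = i.
Proof.
  intros Hd Hi. rewrite (NoDup_nth l d) in Hd. apply Hd; auto.
  - now apply index_lt, nth_In.
  - now apply nth_index, nth_In.
Qed.

Lemma nth_error_lt {A} (l : list A) n a : nth_error l n = Some a -> (n < length l)%nat.
Proof. intros H. apply nth_error_Some. congruence. Qed.

Definition bools := [true; false].
Definition effects := [Keep; Halve; Double; Annul].

Lemma in_bools b : In b bools.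
Proof. destruct b; simpl; auto. Qed.

Lemma in_effects k : In k effects.
Proof. destruct k; simpl; auto. Qed.

Definition side_index (s : side) : nat := match s with Checker => 0 | Opponent => 1 end.

Definition side_of_nat (j : nat) : side := if Nat.odd j then Opponent else Checker.

Lemma side_of_nat_member s r : side_of_nat (2 * r + side_index s) = s.
Proof.
  unfold side_of_nat. rewrite Nat.odd_add, Nat.odd_mul. now destruct s.
Qed.

Lemma div2_member s r : Nat.div2 (2 * r + side_index s) = r.
Proof.
  destruct s; cbn [side_index].
  - rewrite Nat.add_0_r. apply Nat.div2_double.
  - rewrite Nat.add_1_r. apply Nat.div2_succ_double.
Qed.

Lemma member_of_nat j : j = (2 * Nat.div2 j + side_index (side_of_nat j))%nat.
Proof.
  rewrite (Nat.div2_odd j) at 1. unfold side_of_nat. now destruct (Nat.odd j).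
Qed.

Definition rate (k : effect) : R :=
  INR (match k with Keep => 2 | Halve => 1 | Double => 4 | Annul => 0 end) / 8.

Lemma rate_bounds k : 0 <= rate k <= 1 / 2.
Proof. unfold rate. destruct k; simpl; lra. Qed.

Definition weight (n : nat) : R := (/ 2) ^ n.

Lemma weight_0 : weight 0 = 1.
Proof. reflexivity. Qed.

Lemma weight_S n : weight (S n) = / 2 * weight n.
Proof. reflexivity. Qed.

Lemma weight_bounds n : 0 <= weight n <= 1.
Proof.
  split; [apply pow_le; lra|]. unfold weight. rewrite pow_inv, <- Rinv_1.
  apply Rinv_le_contravar; [lra|]. apply pow_R1_Rle. lra.
Qed.

Lemma pow2_pos n : (0 < 2 ^ n)%nat.
Proof. apply Nat.neq_0_lt_0, Nat.pow_nonzero. lia. Qed.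

Lemma mrun_succ P n s : mrun P (S n) s = mstep P (mrun P n s).
Proof.
  revert s. induction n as [|n IH]; intros s; [easy|].
  change (mrun P (S n) (mstep P s) = mstep P (mrun P n (mstep P s))). apply IH.
Qed.

Lemma mrun_halted P s m n : (length P <= fst (mrun P m s))%nat -> (m <= n)%nat ->
  mrun P n s = mrun P m s.
Proof.
  intros Hm Hle. induction Hle as [|n Hle IH]; auto. rewrite mrun_succ, IH.
  destruct (mrun P m s) as [pc regs]. simpl in *. apply nth_error_None in Hm. now rewrite Hm.
Qed.

Lemma halting_time_least P s n : (length P <= fst (mrun P n s))%nat ->
  exists N, (length P <= fst (mrun P N s))%nat /\ (N <= n)%nat /\
    forall m, (m < N)%nat -> (fst (mrun P m s) < length P)%nat.
Proof.
  intros Hn.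
  destruct (dec_inh_nat_subset_has_unique_least_element
    (fun m => (length P <= fst (mrun P m s))%nat)) as (N & [HN Hleast] & _).
  - intros m. lia.
  - now exists n.
  - exists N. split; [easy|split; [now apply Hleast|]]. intros m Hm.
    destruct (le_lt_dec (length P) (fst (mrun P m s))) as [Hge|]; auto.
    specialize (Hleast m Hge). lia.
Qed.

Lemma le_list_max l n : In n l -> (n <= list_max l)%nat.
Proof.
  intros Hn. pose proof (proj1 (list_max_le l _) (Nat.le_refl _)) as Hall.
  rewrite Forall_forall in Hall. now apply Hall.
Qed.

Lemma bounded_on_rectangle (f : nat -> nat -> nat) a b :
  exists B, forall n r, (n <= a)%nat -> (r < b)%nat -> (f n r <= B)%nat.
Proof.
  exists (list_max (flat_map (fun n => map (f n) (seq 0 b)) (seq 0 (S a)))).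
  intros n r Hn Hr. apply le_list_max, in_flat_map. exists n.
  split; [apply in_seq; lia|]. apply in_map, in_seq. lia.
Qed.

Definition instr_reg (i : instr) : nat := match i with INC r | DEC r _ => r end.

Section Reduction.
(* The simulated machine, its number of registers, and its input. *)
Variable Q : program.
Variables nr x : nat.
Hypothesis Hnr : (0 < nr)%nat.

Definition phases : list phase :=
  Loading :: Accept :: flat_map (fun pc => [Execute pc true; Execute pc false]) (seq 0 (length Q)).

Definition gadget_vertices : list vert :=
  flat_map (fun b => flat_map (fun r =>
    VPay r b :: flat_map (fun k => [VStop k b r; VLoop k b r; VCoin k b r]) effects)
    (seq 0 nr)) bools.

Definition phase_vertices : list vert :=
  flat_map (fun b => flat_map (fun ph =>
    VFork ph b :: map (VCheck ph b) (seq 0 (2 * nr))) phases) bools.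

Definition guess_vertices : list vert :=
  flat_map (fun b => flat_map (fun pc => [VGuess pc b; VConfirm pc b]) (seq 0 (length Q))) bools.

Definition all_vertices : list vert :=
  [VInput; VExit; VFinish true; VFinish false; VOpponents; VGuesser; VCheckers; VSysCheckers;
   VSysOpponents] ++ gadget_vertices ++ phase_vertices ++ guess_vertices.

Definition valid_phase (ph : phase) : Prop :=
  match ph with Execute pc _ => (pc < length Q)%nat | _ => True end.

Definition valid_vertex (v : vert) : Prop :=
  match v with
  | VStop _ _ r | VLoop _ _ r | VCoin _ _ r | VPay r _ => (r < nr)%nat
  | VCheck ph _ j => valid_phase ph /\ (j < 2 * nr)%nat
  | VFork ph _ => valid_phase ph
  | VGuess pc _ | VConfirm pc _ => (pc < length Q)%nat
  | _ => True
  end.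

Lemma in_phases ph : In ph phases <-> valid_phase ph.
Proof.
  unfold phases. cbn [In]. rewrite in_flat_map. destruct ph as [|pc br|]; simpl; try tauto.
  split.
  - intros [H|[H|(pc' & Hpc%in_seq & H)]]; try easy.
    simpl in H. destruct H as [H|[H|[]]]; injection H as -> _; lia.
  - intros H. right; right. exists pc. split; [apply in_seq; lia|].
    destruct br; simpl; auto.
Qed.

Lemma all_vertices_valid v : In v all_vertices -> valid_vertex v.
Proof.
  unfold all_vertices, gadget_vertices, phase_vertices, guess_vertices.
  rewrite !in_app_iff, !in_flat_map. intros [H|[(b & _ & H)|[(b & _ & H)|(b & _ & H)]]].
  - simpl in H. repeat destruct H as [<-|H]; easy.
  - apply in_flat_map in H as (r & Hr%in_seq & H).
    simpl in H. repeat destruct H as [<-|H]; simpl; try lia; easy.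
  - apply in_flat_map in H as (ph & Hph%in_phases & [<-|H]); [easy|].
    apply in_map_iff in H as (j & <- & Hj%in_seq). split; [easy|lia].
  - apply in_flat_map in H as (pc & Hpc%in_seq & H).
    simpl in H. repeat destruct H as [<-|H]; simpl; try lia; easy.
Qed.

Lemma valid_in_all_vertices v : valid_vertex v -> In v all_vertices.
Proof.
  intros Hv. unfold all_vertices. rewrite !in_app_iff.
  assert (Hgadget : forall b r, (r < nr)%nat -> v = VPay r b \/
    (exists k, In v [VStop k b r; VLoop k b r; VCoin k b r]) -> In v gadget_vertices).
  { intros b r Hr H. apply in_flat_map. exists b. split; [apply in_bools|].
    apply in_flat_map. exists r. split; [apply in_seq; lia|].
    destruct H as [->|(k & Hk)]; [now left|right].
    apply in_flat_map. exists k. split; [apply in_effects|easy]. }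
  assert (Hphase : forall b ph, valid_phase ph ->
    In v (VFork ph b :: map (VCheck ph b) (seq 0 (2 * nr))) -> In v phase_vertices).
  { intros b ph Hph H. apply in_flat_map. exists b. split; [apply in_bools|].
    apply in_flat_map. exists ph. split; [now apply in_phases|easy]. }
  assert (Hguess : forall b pc, (pc < length Q)%nat -> In v [VGuess pc b; VConfirm pc b] ->
    In v guess_vertices).
  { intros b pc Hpc H. apply in_flat_map. exists b. split; [apply in_bools|].
    apply in_flat_map. exists pc. split; [apply in_seq; lia|easy]. }
  destruct v; simpl in Hv; try (left; destruct b; simpl; tauto); try (left; simpl; tauto).
  1-4: right; left; apply (Hgadget b r Hv); try now left.
  1-3: right; exists k; simpl; tauto.
  - right; right; left. apply (Hphase b ph); [easy|]. right. apply in_map, in_seq. lia.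
  - right; right; left. apply (Hphase b ph); [easy|]. now left.
  - right; right; right. apply (Hguess b pc Hv). simpl; tauto.
  - right; right; right. apply (Hguess b pc Hv). simpl; tauto.
Qed.

Definition special (v : vert) : bool :=
  match v with
  | VInput | VStop Keep true O | VPay O false => true
  | _ => false
  end.

Lemma special_cases v :
  special v = true -> v = VInput \/ v = VStop Keep true 0 \/ v = VPay 0 false.
Proof.
  destruct v; simpl; try easy; auto.
  - destruct k, b, r; easy || auto.
  - destruct r, b; easy || auto.
Qed.

Definition ordinary_vertices : list vert :=
  filter (fun v => negb (special v)) (nodup vert_eq_dec all_vertices).

(* The only row of the probability table that depends on [x] is that of [VInput]; it is put first,
   and the two successors of [VInput] next, to make the code of the game an explicit
   function of [2^x]. *)
Definition vertices : list vert :=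
  VInput :: VStop Keep true 0 :: VPay 0 false :: ordinary_vertices.

Lemma in_vertices v : In v vertices <-> valid_vertex v.
Proof.
  unfold vertices, ordinary_vertices. cbn [In]. rewrite filter_In, nodup_In. split.
  - intros [<-|[<-|[<-|[H _]]]]; try easy. now apply all_vertices_valid.
  - intros H%valid_in_all_vertices. destruct (special v) eqn:E; [|tauto].
    destruct (special_cases v E) as [->|[->| ->]]; auto.
Qed.

Lemma NoDup_vertices : NoDup vertices.
Proof.
  unfold vertices, ordinary_vertices.
  repeat (constructor; [cbn [In]; rewrite ?filter_In|]).
  - intros [H|[H|[_ H]]]; easy.
  - intros [H|[_ H]]; easy.
  - intros [_ H]; easy.
  - apply NoDup_filter, NoDup_nodup.
Qed.

Lemma vertices_eq :
  vertices = VInput :: VStop Keep true 0 :: VPay 0 false :: ordinary_vertices.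
Proof. reflexivity. Qed.

Opaque vertices.

Definition vcode (v : vert) : nat := index vert_eq_dec vertices v.
Definition vdecode (n : nat) : vert := nth n vertices VOpponents.

Lemma vdecode_vcode v : valid_vertex v -> vdecode (vcode v) = v.
Proof. intros H. apply nth_index, in_vertices, H. Qed.

Lemma vcode_vdecode n : (n < length vertices)%nat -> vcode (vdecode n) = n.
Proof. intros H. apply index_nth; auto using NoDup_vertices. Qed.

Lemma vcode_lt_length v : valid_vertex v -> (vcode v < length vertices)%nat.
Proof. intros H. apply index_lt, in_vertices, H. Qed.

Lemma vdecode_valid n : valid_vertex (vdecode n).
Proof.
  destruct (le_lt_dec (length vertices) n) as [H|H].
  - unfold vdecode. rewrite nth_overflow by lia. easy.
  - apply in_vertices. now apply nth_In.
Qed.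

Lemma vcode_inj u v : valid_vertex u -> valid_vertex v -> vcode u = vcode v -> u = v.
Proof. intros Hu Hv H. rewrite <- (vdecode_vcode u), <- (vdecode_vcode v), H; auto. Qed.

Definition checks_from (ph : phase) (b : bool) (j : nat) : vert :=
  if Nat.ltb j (2 * nr) then VCheck ph b j else VFork ph b.

Definition entry (l : nat) (b : bool) : vert :=
  match nth_error Q l with
  | Some (INC _) => checks_from (Execute l false) b 0
  | Some (DEC _ _) => VGuess l b
  | None => if Nat.eqb l (S (length Q)) then VFork Accept b else VSysOpponents
  end.

Definition continuation (ph : phase) (b : bool) : vert :=
  match ph with
  | Loading => entry 0 (negb b)
  | Execute pc br =>
      match nth_error Q pc with
      | Some (INC _) => entry (S pc) (negb b)
      | Some (DEC _ j) => entry (if br then S pc else j) (negb b)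
      | None => VSysOpponents
      end
  | Accept => VFinish b
  end.

Definition gadget (ph : phase) (b : bool) (r : nat) : vert :=
  match ph with
  | Loading => if Nat.eqb r 0 then VInput else VStop Keep b r
  | Execute pc br =>
      match nth_error Q pc with
      | Some (INC r0) => VLoop (if Nat.eqb r r0 then Halve else Keep) b r
      | Some (DEC r0 _) =>
          if Nat.eqb r r0 then (if br then VLoop Double b r else VStop Keep b r)
          else VLoop Keep b r
      | None => VLoop Keep b r
      end
  | Accept => VLoop Annul b r
  end.

Definition gadget_effect (ph : phase) (r : nat) : effect :=
  match ph with
  | Loading => Keep
  | Execute pc br =>
      match nth_error Q pc with
      | Some (INC r0) => if Nat.eqb r r0 then Halve else Keep
      | Some (DEC r0 _) => if (Nat.eqb r r0 && br)%bool then Double else Keep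
      | None => Keep
      end
  | Accept => Annul
  end.

Definition payout (ph : phase) : vert :=
  match ph with Execute _ true => VGuesser | _ => VOpponents end.

Definition lottery (v : vert) : list (vert * nat) :=
  match v with
  | VInput => [(VStop Keep true 0, 1%nat); (VPay 0 false, (2 ^ x - 1)%nat)]
  | VStop k b r =>
      let a := match k with Keep => 2 | Halve => 1 | Double => 4 | Annul => 0 end%nat in
      [(VPay r b, a); (VOpponents, (8 - a)%nat)]
  | VCoin k b r => [(VLoop k b r, 1%nat); (VPay r (negb b), 1%nat)]
  | VFork ph b => map (fun r => (gadget ph b r, 1%nat)) (seq 0 nr) ++
                 [(payout ph, (5 * nr)%nat); (continuation ph b, (2 * nr)%nat)]
  | VExit => [(VSysCheckers, 1%nat); (VSysOpponents, (30 * nr - 1)%nat)]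
  | VFinish b => (VCheckers, 1%nat) :: map (fun r => (VPay r b, 3%nat)) (seq 0 nr) ++
               [(VOpponents, (30 * nr - (1 + 3 * nr))%nat)]
  | VPay _ _ | VOpponents | VGuesser | VCheckers | VSysCheckers | VSysOpponents => [(v, 1%nat)]
  | VLoop _ _ _ | VCheck _ _ _ | VGuess _ _ | VConfirm _ _ => []
  end.

Definition denominator (v : vert) : nat :=
  match v with
  | VInput => 2 ^ x
  | VStop _ _ _ => 8
  | VCoin _ _ _ => 2
  | VFork _ _ => 8 * nr
  | VExit | VFinish _ => 30 * nr
  | _ => 1
  end.

(* Players: 0 is the system, 1 (without target) runs the register gadgets, 2 chooses the
   branches of [DEC]; the others are the members of the two families. *)
Definition member (s : side) (b : bool) (r : nat) : nat :=
  (3 + (if b then 0 else 2 * nr) + (2 * r + side_index s))%nat.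

Definition vowner (v : vert) : option nat :=
  match v with
  | VLoop _ _ _ | VConfirm _ _ => Some 1%nat
  | VGuess _ _ => Some 2%nat
  | VCheck _ b j => Some (3 + (if b then 0 else 2 * nr) + j)%nat
  | _ => None
  end.

Definition moves (v : vert) : list vert :=
  match v with
  | VLoop k b r => [VCoin k b r; VStop k b r]
  | VGuess pc b => [checks_from (Execute pc false) b 0; VConfirm pc b]
  | VConfirm pc b => [checks_from (Execute pc true) b 0; VSysOpponents]
  | VCheck ph b j => [checks_from ph b (S j); VExit]
  | _ => []
  end.

Definition final (v : vert) : bool :=
  match v with
  | VPay _ _ | VOpponents | VGuesser | VCheckers | VSysCheckers | VSysOpponents => true
  | _ => false
  end.

Definition pays_checker (b : bool) (r : nat) (v : vert) : bool :=
  match v with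
  | VPay r' b' => Nat.eqb r' r && Bool.eqb b' b
  | VCheckers | VSysCheckers => true
  | _ => false
  end.

Definition pays (s : side) (b : bool) (r : nat) (v : vert) : bool :=
  match s with
  | Checker => pays_checker b r v
  | Opponent => final v && negb (pays_checker b r v)
  end.

Definition wins (i : nat) (v : vert) : bool :=
  match i with
  | 0 => match v with VSysCheckers | VSysOpponents => true | _ => false end
  | 1 => false
  | 2 => match v with VGuesser => true | _ => false end
  | S (S (S j)) =>
      let b := Nat.ltb j (2 * nr) in
      let j' := if b then j else (j - 2 * nr)%nat in
      pays (side_of_nat j') b (Nat.div2 j') v
  end%nat.

Lemma wins_member s b r v : (r < nr)%nat -> wins (member s b r) v = pays s b r v.
Proof.
  intros Hr. change (wins (S (S (S ((if b then 0 else 2 * nr) + (2 * r + side_index s)))))%nat v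
    = pays s b r v). unfold wins.
  assert (Hs : (side_index s < 2)%nat) by (destruct s; simpl; lia).
  destruct b; cbv beta iota.
  - rewrite Nat.add_0_l.
    destruct (Nat.ltb_spec (2 * r + side_index s) (2 * nr)) as [_|Hge]; [|lia].
    now rewrite side_of_nat_member, div2_member.
  - destruct (Nat.ltb_spec (2 * nr + (2 * r + side_index s)) (2 * nr)) as [Hlt|_]; [lia|].
    replace (2 * nr + (2 * r + side_index s) - 2 * nr)%nat with (2 * r + side_index s)%nat by lia.
    now rewrite side_of_nat_member, div2_member.
Qed.

Lemma wins_final i v : wins i v = true -> final v = true.
Proof.
  destruct i as [|[|[|i]]]; simpl; try easy; try (now destruct v).
  unfold pays. destruct (side_of_nat _); [now destruct v|].
  intros H. now apply andb_prop in H as [H _].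
Qed.

Lemma wins_nonfinal i v : final v = false -> wins i v = false.
Proof.
  intros H. destruct (wins i v) eqn:E; auto. apply wins_final in E. congruence.
Qed.

Definition numerator (v w : vert) : nat :=
  list_sum (map (fun d => if vert_eq_dec (fst d) w then snd d else 0%nat) (lottery v)).

Definition probability (v w : vert) : nat * nat :=
  if Nat.eqb (numerator v w) 0 then (0%nat, 1%nat) else (numerator v w, denominator v).

Definition sim_game : game := {|
  g_nV := length vertices;
  g_k := 2 + 4 * nr;
  g_v0 := vcode (checks_from Loading true 0);
  g_owner := map vowner vertices;
  g_succ := map (fun v => map vcode (moves v)) vertices;
  g_prob := map (fun v => map (probability v) vertices) vertices;
  g_target := map (fun i => map vcode (filter (wins i) vertices)) (seq 0 (S (2 + 4 * nr)))
|}.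

Lemma denominator_pos v : (0 < denominator v)%nat.
Proof. destruct v; simpl; try lia. apply pow2_pos. Qed.

Lemma checks_from_valid ph b j : valid_phase ph -> valid_vertex (checks_from ph b j).
Proof.
  intros H. unfold checks_from. destruct (Nat.ltb_spec j (2 * nr)); simpl; auto.
Qed.

Lemma entry_valid l b : valid_vertex (entry l b).
Proof.
  unfold entry. destruct (nth_error Q l) as [[r|r j]|] eqn:E.
  - apply checks_from_valid. simpl. eapply nth_error_lt; eauto.
  - simpl. eapply nth_error_lt; eauto.
  - now destruct (Nat.eqb _ _).
Qed.

Lemma continuation_valid ph b : valid_vertex (continuation ph b).
Proof.
  destruct ph as [|pc br|]; simpl; auto using entry_valid.
  destruct (nth_error Q pc) as [[r|r j]|]; auto using entry_valid. easy.
Qed.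

Lemma gadget_cases ph b r :
  (ph = Loading /\ r = 0%nat /\ gadget ph b r = VInput) \/
  gadget ph b r = VStop (gadget_effect ph r) b r \/
  gadget ph b r = VLoop (gadget_effect ph r) b r.
Proof.
  destruct ph as [|pc br|]; simpl; auto.
  - destruct (Nat.eqb_spec r 0); auto.
  - destruct (nth_error Q pc) as [[r0|r0 j]|]; auto. destruct (Nat.eqb r r0), br; auto.
Qed.

Lemma gadget_valid ph b r : (r < nr)%nat -> valid_vertex (gadget ph b r).
Proof.
  intros Hr. now destruct (gadget_cases ph b r) as [(_ & _ & ->)|[->| ->]].
Qed.

Lemma payout_valid ph : valid_vertex (payout ph).
Proof. now destruct ph as [|pc [|]|]. Qed.

Lemma payout_final ph : final (payout ph) = true.
Proof. now destruct ph as [|pc [|]|]. Qed.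

Lemma payout_pays_no_checker ph b r : pays_checker b r (payout ph) = false.
Proof. now destruct ph as [|pc [|]|]. Qed.

Lemma in_lottery_VFork ph b d : In d (lottery (VFork ph b)) <->
  (exists r, (r < nr)%nat /\ d = (gadget ph b r, 1%nat)) \/
  d = (payout ph, 5 * nr)%nat \/ d = (continuation ph b, 2 * nr)%nat.
Proof.
  cbn [lottery]. rewrite in_app_iff, in_map_iff. cbn [In]. split.
  - intros [(r & <- & Hr%in_seq)|[<-|[<-|[]]]]; auto. left. exists r. split; [lia|easy].
  - intros [(r & Hr & ->)|[->| ->]]; auto. left. exists r. split; [easy|apply in_seq; lia].
Qed.

Definition outcomes (v : vert) : list vert := map fst (lottery v).

Lemma in_outcomes_VFork ph b w : In w (outcomes (VFork ph b)) <->
  (exists r, (r < nr)%nat /\ w = gadget ph b r) \/ w = payout ph \/ w = continuation ph b.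
Proof.
  unfold outcomes. rewrite in_map_iff. split.
  - intros (d & <- & [(r & Hr & ->)|[->| ->]]%in_lottery_VFork); eauto.
  - intros [(r & Hr & ->)|[->| ->]].
    + exists (gadget ph b r, 1%nat). rewrite in_lottery_VFork. eauto.
    + exists (payout ph, 5 * nr)%nat. rewrite in_lottery_VFork. auto.
    + exists (continuation ph b, 2 * nr)%nat. rewrite in_lottery_VFork. auto.
Qed.

Lemma in_outcomes_VFinish b w : In w (outcomes (VFinish b)) <->
  w = VCheckers \/ (exists r, (r < nr)%nat /\ w = VPay r b) \/ w = VOpponents.
Proof.
  unfold outcomes. cbn [lottery map In fst]. rewrite map_app, map_map, in_app_iff, in_map_iff.
  cbn [map In fst]. split.
  - intros [<-|[(r & <- & Hr%in_seq)|[<-|[]]]]; auto.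
    right; left. exists r. split; [lia|easy].
  - intros [->|[(r & Hr & ->)| ->]]; auto.
    right; left. exists r. split; [easy|apply in_seq; lia].
Qed.

Lemma outcome_valid v w : valid_vertex v -> In w (outcomes v) -> valid_vertex w.
Proof.
  intros Hv Hw. destruct v;
    try (simpl in Hw; repeat destruct Hw as [<-|Hw]; simpl in *; easy || auto; fail).
  - apply in_outcomes_VFork in Hw as [(r & Hr & ->)|[->| ->]];
      auto using gadget_valid, payout_valid, continuation_valid.
  - now apply in_outcomes_VFinish in Hw as [->|[(r & Hr & ->)| ->]].
Qed.

Lemma moves_valid v w : valid_vertex v -> In w (moves v) -> valid_vertex w.
Proof.
  intros Hv Hw. destruct v; simpl in Hw; try easy; simpl in Hv;
    repeat destruct Hw as [<-|Hw]; try easy; now apply checks_from_valid.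
Qed.

Lemma lottery_final u : final u = true -> lottery u = [(u, 1%nat)].
Proof. now destruct u. Qed.

Lemma final_owner u : final u = true -> vowner u = None.
Proof. now destruct u. Qed.

Lemma owner_nonfinal u i : vowner u = Some i -> final u = false.
Proof. now destruct u. Qed.

Lemma vowner_pos u i : vowner u = Some i -> (1 <= i)%nat.
Proof. destruct u; simpl; try easy; injection 1; lia. Qed.

(** ** Correctness of the encoding *)

Lemma owner_vdecode n : owner sim_game n = vowner (vdecode n).
Proof.
  unfold owner, vdecode. cbn [g_owner sim_game].
  change (@None nat) with (vowner VOpponents). apply map_nth.
Qed.

Lemma owner_vcode v : valid_vertex v -> owner sim_game (vcode v) = vowner v.
Proof. intros H. now rewrite owner_vdecode, vdecode_vcode. Qed.

Lemma succ_vcode v : valid_vertex v ->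
  nth (vcode v) (g_succ sim_game) [] = map vcode (moves v).
Proof.
  intros H. cbn [g_succ sim_game].
  change (@nil nat) with ((fun v => map vcode (moves v)) VOpponents). rewrite map_nth.
  fold (vdecode (vcode v)). now rewrite vdecode_vcode.
Qed.

Lemma prob_vcode v : valid_vertex v ->
  nth (vcode v) (g_prob sim_game) [] = map (probability v) vertices.
Proof.
  intros Hv. cbn [g_prob sim_game].
  rewrite (nth_indep _ [] (map (probability VOpponents) vertices))
    by (rewrite length_map; now apply vcode_lt_length).
  rewrite (map_nth (fun v => map (probability v) vertices)).
  fold (vdecode (vcode v)). now rewrite vdecode_vcode.
Qed.

Lemma target_sim_game i n : (i <= g_k sim_game)%nat -> target sim_game i n <->
  exists u, valid_vertex u /\ wins i u = true /\ n = vcode u.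
Proof.
  cbn [g_k sim_game]. intros Hi. unfold target. cbn [g_target sim_game].
  rewrite (nth_indep _ [] (map vcode (filter (wins 0%nat) vertices)))
    by (rewrite length_map, length_seq; lia).
  rewrite (map_nth (fun i => map vcode (filter (wins i) vertices)) _ 0%nat i).
  rewrite seq_nth, Nat.add_0_l by lia. rewrite in_map_iff. split.
  - intros (u & <- & Hu). apply filter_In in Hu as [Hu%in_vertices Hw]. eauto.
  - intros (u & Hu & Hw & ->). exists u. split; auto. apply filter_In. split; auto.
    now apply in_vertices.
Qed.

Lemma target_vcode i v : (i <= g_k sim_game)%nat -> valid_vertex v ->
  target_b sim_game i (vcode v) = wins i v.
Proof.
  intros Hi Hv. apply Bool.eq_iff_eq_true. rewrite target_b_target, target_sim_game by auto.
  split; [|eauto]. intros (u & Hu & Hw & He). apply vcode_inj in He; auto. now subst.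
Qed.

Lemma qentry_vcode v n : valid_vertex v -> (n < length vertices)%nat ->
  qentry sim_game (vcode v) n = probability v (vdecode n).
Proof.
  intros Hv Hn. unfold qentry. rewrite prob_vcode by auto.
  rewrite (nth_indep _ _ (probability v VOpponents)) by (now rewrite length_map).
  apply map_nth.
Qed.

Lemma qentry_vcode_overflow v n : valid_vertex v -> (length vertices <= n)%nat ->
  qentry sim_game (vcode v) n = (0, 1)%nat.
Proof.
  intros Hv Hn. unfold qentry. rewrite prob_vcode by auto.
  apply nth_overflow. now rewrite length_map.
Qed.

Lemma INR_numerator v w :
  INR (numerator v w) =
  lsum (lottery v) (fun d => if vert_eq_dec (fst d) w then INR (snd d) else 0).
Proof.
  unfold numerator. induction (lottery v) as [|d l IH]; [easy|].
  rewrite lsum_cons, <- IH. cbn [map]. change (list_sum (?a :: ?l)) with (a + list_sum l)%nat.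
  rewrite plus_INR. now destruct (vert_eq_dec (fst d) w).
Qed.

Lemma numerator_pos v w : (0 < numerator v w)%nat -> In w (outcomes v).
Proof.
  unfold numerator, outcomes. induction (lottery v) as [|d l IH]; [simpl; lia|]. cbn [map In].
  change (list_sum (?a :: ?l)) with (a + list_sum l)%nat.
  destruct (vert_eq_dec (fst d) w) as [|_]; auto.
Qed.

Lemma natp_vcode v n : valid_vertex v -> (n < length vertices)%nat ->
  natp sim_game (vcode v) n =
  lsum (lottery v)
    (fun d => if vert_eq_dec (fst d) (vdecode n) then INR (snd d) / INR (denominator v) else 0).
Proof.
  intros Hv Hn. unfold natp. rewrite qentry_vcode by auto.
  transitivity (INR (numerator v (vdecode n)) / INR (denominator v)).
  - unfold probability. destruct (Nat.eqb_spec (numerator v (vdecode n)) 0) as [->|]; [|easy].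
    unfold Rdiv. now rewrite !Rmult_0_l.
  - rewrite INR_numerator. unfold Rdiv. rewrite Rmult_comm, <- lsum_scal. apply lsum_ext.
    intros d _. destruct (vert_eq_dec _ _); lra.
Qed.

Definition mean (v : vert) (F : vert -> R) : R :=
  lsum (lottery v) (fun d => INR (snd d) / INR (denominator v) * F (fst d)).

Lemma natp_mean v F : valid_vertex v ->
  lsum (seq 0 (length vertices)) (fun n => natp sim_game (vcode v) n * F n) =
  mean v (fun u => F (vcode u)).
Proof.
  intros Hv.
  rewrite (lsum_ext _ _ (fun n => lsum (lottery v) (fun d =>
    if vert_eq_dec (fst d) (vdecode n) then INR (snd d) / INR (denominator v) * F n else 0))).
  - rewrite lsum_swap. apply lsum_ext. intros d Hd.
    pose proof (outcome_valid v (fst d) Hv (in_map fst _ d Hd)) as Hok.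
    rewrite (lsum_seq_single _ (vcode (fst d))) by
      (try apply vcode_lt_length; auto; intros n Hn Hne;
       destruct (vert_eq_dec (fst d) (vdecode n)) as [E|]; auto;
       exfalso; apply Hne; rewrite E; symmetry; now apply vcode_vdecode).
    rewrite vdecode_vcode by auto. now destruct (vert_eq_dec (fst d) (fst d)).
  - intros n Hn%in_seq. rewrite natp_vcode by (auto; lia).
    rewrite Rmult_comm, <- lsum_scal. apply lsum_ext. intros d _.
    destruct (vert_eq_dec _ _); lra.
Qed.

Lemma next_nature v n : valid_vertex v -> vowner v = None -> next sim_game (vcode v) n ->
  exists w, In w (outcomes v) /\ n = vcode w.
Proof.
  intros Hv Ho Hn. unfold next in Hn. rewrite owner_vcode, Ho in Hn by auto.
  destruct (le_lt_dec (length vertices) n) as [Hge|Hlt].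
  - rewrite qentry_vcode_overflow in Hn by auto. simpl in Hn. lia.
  - rewrite qentry_vcode in Hn by auto. exists (vdecode n).
    split; [|now rewrite vcode_vdecode]. apply numerator_pos. unfold probability in Hn.
    destruct (Nat.eqb_spec (numerator v (vdecode n)) 0); simpl in Hn; lia.
Qed.

Lemma next_player v n i : valid_vertex v -> vowner v = Some i ->
  (next sim_game (vcode v) n <-> exists w, In w (moves v) /\ n = vcode w).
Proof.
  intros Hv Ho. unfold next. rewrite owner_vcode, Ho, succ_vcode by auto.
  rewrite in_map_iff. split; intros (w & Hl & Hr); exists w; auto.
Qed.

(** ** Averages over lotteries *)

(* The probability of each gadget of a fork. *)
Definition rho : R := / (8 * INR nr).
Definition kappa : R := / (30 * INR nr).

Lemma INR_nr_pos : 0 < INR nr.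
Proof. apply lt_0_INR. exact Hnr. Qed.

Lemma kappa_pos : 0 < kappa.
Proof. pose proof INR_nr_pos. apply Rinv_0_lt_compat. lra. Qed.

Lemma rho_kappa : rho = 15 / 4 * kappa.
Proof. pose proof INR_nr_pos. unfold rho, kappa. field. lra. Qed.

Lemma rho_pos : 0 < rho.
Proof. pose proof kappa_pos. rewrite rho_kappa. lra. Qed.

Lemma rho_total : INR nr * rho = 1 / 8.
Proof. pose proof INR_nr_pos. unfold rho. field. lra. Qed.

Lemma kappa_le : kappa <= 1 / 30.
Proof.
  assert (1 <= INR nr) by (apply (le_INR 1); lia). pose proof rho_pos.
  assert (1 * rho <= INR nr * rho) by (apply Rmult_le_compat_r; lra).
  rewrite rho_total, rho_kappa in *. lra.
Qed.

Lemma mean_ext v F F' : (forall w, In w (outcomes v) -> F w = F' w) ->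
  mean v F = mean v F'.
Proof. intros H. apply lsum_ext. intros d Hd. rewrite H; auto. now apply in_map. Qed.

Lemma mean_plus v F F' : mean v (fun u => F u + F' u) = mean v F + mean v F'.
Proof. unfold mean. rewrite <- lsum_plus. apply lsum_ext. intros; lra. Qed.

Lemma mean_scal v a F : mean v (fun u => a * F u) = a * mean v F.
Proof. unfold mean. rewrite <- lsum_scal. apply lsum_ext. intros; lra. Qed.

Lemma mean_final v F : final v = true -> mean v F = F v.
Proof.
  intros Hf. unfold mean. rewrite lottery_final, lsum_cons, lsum_nil by auto.
  replace (denominator v) with 1%nat by now destruct v. simpl. lra.
Qed.

Lemma mean_VInput F :
  mean VInput F = weight x * F (VStop Keep true 0%nat) + (1 - weight x) * F (VPay 0%nat false).
Proof.
  unfold mean. cbn [lottery denominator]. rewrite !lsum_cons, lsum_nil. cbn [fst snd].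
  pose proof (pow2_pos x) as Hpos.
  unfold weight. rewrite minus_INR, pow_INR, pow_inv by lia. replace (INR 2) with 2 by (simpl; lra).
  assert (2 ^ x <> 0) by (apply pow_nonzero; lra). simpl INR. field. auto.
Qed.

Lemma mean_VStop k b r F :
  mean (VStop k b r) F = rate k * F (VPay r b) + (1 - rate k) * F VOpponents.
Proof.
  unfold mean. cbn [lottery denominator]. rewrite !lsum_cons, lsum_nil. cbn [fst snd].
  unfold rate. destruct k; simpl; lra.
Qed.

Lemma mean_VCoin k b r F :
  mean (VCoin k b r) F = 1 / 2 * F (VLoop k b r) + 1 / 2 * F (VPay r (negb b)).
Proof.
  unfold mean. cbn [lottery denominator]. rewrite !lsum_cons, lsum_nil. cbn [fst snd].
  simpl. lra.
Qed.

Lemma mean_VFork ph b F :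
  mean (VFork ph b) F =
  rho * lsum (seq 0 nr) (fun r => F (gadget ph b r)) + 5 / 8 * F (payout ph) +
  1 / 4 * F (continuation ph b).
Proof.
  unfold mean. cbn [lottery denominator]. rewrite lsum_app, lsum_map, !lsum_cons, lsum_nil.
  cbn [fst snd]. pose proof INR_nr_pos. rewrite <- lsum_scal, !mult_INR. unfold rho.
  rewrite (lsum_ext _ _ (fun r => / (8 * INR nr) * F (gadget ph b r))).
  - simpl. field. lra.
  - intros r _. simpl. field. lra.
Qed.

Lemma mean_VExit F : mean VExit F = kappa * F VSysCheckers + (1 - kappa) * F VSysOpponents.
Proof.
  unfold mean. cbn [lottery denominator]. rewrite !lsum_cons, lsum_nil. cbn [fst snd].
  pose proof INR_nr_pos. rewrite minus_INR, mult_INR by lia. unfold kappa. simpl. field. lra.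
Qed.

Lemma mean_VFinish b F :
  mean (VFinish b) F = kappa * F VCheckers +
    3 * kappa * lsum (seq 0 nr) (fun r => F (VPay r b)) + (9 / 10 - kappa) * F VOpponents.
Proof.
  unfold mean. cbn [lottery denominator].
  rewrite lsum_cons, lsum_app, lsum_map, lsum_cons, lsum_nil. cbn [fst snd].
  pose proof INR_nr_pos. rewrite minus_INR, plus_INR, !mult_INR, <- lsum_scal by lia.
  unfold kappa. rewrite (lsum_ext _ _ (fun r => 3 * / (30 * INR nr) * F (VPay r b))).
  - simpl. field. lra.
  - intros r _. simpl. field. lra.
Qed.

Lemma mean_const v c : vowner v = None -> mean v (fun _ => c) = c.
Proof.
  intros Ho. destruct v; try easy; rewrite ?mean_final by easy;
    rewrite ?mean_VInput, ?mean_VStop, ?mean_VCoin, ?mean_VExit; try lra.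
  - rewrite mean_VFork, lsum_const, length_seq.
    replace (rho * (INR nr * c)) with (INR nr * rho * c) by ring. rewrite rho_total. lra.
  - rewrite mean_VFinish, lsum_const, length_seq.
    replace (3 * kappa * (INR nr * c)) with (4 / 5 * (INR nr * rho) * c)
      by (rewrite rho_kappa; field). rewrite rho_total. lra.
Qed.

Lemma mean_zero v F : vowner v = None -> (forall w, In w (outcomes v) -> F w = 0) ->
  mean v F = 0.
Proof. intros Ho H. now rewrite (mean_ext v F (fun _ => 0) H), mean_const. Qed.

Lemma next_final v n : valid_vertex v -> final v = true ->
  (next sim_game (vcode v) n <-> n = vcode v).
Proof.
  intros Hv Hf. pose proof (final_owner v Hf) as Ho. split.
  - intros Hn. apply next_nature in Hn as (w & Hw & ->); auto.
    unfold outcomes in Hw. rewrite lottery_final in Hw by auto. now destruct Hw as [<-|[]].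
  - intros ->. unfold next. rewrite owner_vcode, Ho by auto.
    rewrite qentry_vcode, vdecode_vcode by auto using vcode_lt_length.
    unfold probability, numerator. rewrite lottery_final by auto. cbn [map fst snd].
    destruct (vert_eq_dec v v); [simpl; lia|easy].
Qed.

Lemma sim_game_player_wf u i : valid_vertex u -> vowner u = Some i ->
  (i <= g_k sim_game)%nat /\
  (exists w, In w (nth (vcode u) (g_succ sim_game) [])) /\
  (forall w, In w (nth (vcode u) (g_succ sim_game) []) -> (w < g_nV sim_game)%nat).
Proof.
  intros Hu Ho. rewrite succ_vcode by auto. split; [|split].
  - cbn [g_k sim_game]. destruct u; simpl in Ho; try easy; injection Ho as <-; try lia.
    simpl in Hu. destruct b; lia.
  - destruct u; try easy; eexists; left; reflexivity.
  - intros w (u' & <- & Hu')%in_map_iff. apply vcode_lt_length. eapply moves_valid; eauto.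
Qed.

Lemma sim_game_nature_wf u : valid_vertex u -> vowner u = None ->
  length (nth (vcode u) (g_prob sim_game) []) = g_nV sim_game /\
  (forall w, (w < g_nV sim_game)%nat -> (0 < snd (qentry sim_game (vcode u) w))%nat) /\
  sumR (map (natp sim_game (vcode u)) (seq 0 (g_nV sim_game))) = 1.
Proof.
  intros Hu Ho. split; [|split].
  - rewrite prob_vcode by auto. apply length_map.
  - intros w Hw. rewrite qentry_vcode by auto. unfold probability.
    destruct (Nat.eqb _ _); [simpl; lia|apply denominator_pos].
  - rewrite <- (mean_const u 1 Ho). rewrite <- (natp_mean u (fun _ => 1)) by auto.
    apply lsum_ext. intros; lra.
Qed.

Lemma sim_game_wf : wf_game sim_game.
Proof.
  split; [|split; [|split; [|split; [|split; [|split]]]]].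
  - apply vcode_lt_length. now apply checks_from_valid.
  - apply length_map.
  - apply length_map.
  - apply length_map.
  - cbn [g_target sim_game]. now rewrite length_map, length_seq.
  - intros n Hn. rewrite <- (vcode_vdecode n) by exact Hn. generalize (vdecode n) (vdecode_valid n).
    intros u Hu. rewrite owner_vcode by auto.
    destruct (vowner u) as [i|] eqn:Ho;
      [now apply sim_game_player_wf|now apply sim_game_nature_wf].
  - intros i n Hi (u & Hu & Hw%wins_final & ->)%target_sim_game; auto.
    split; [now apply vcode_lt_length|]. intros w. now apply next_final.
Qed.

(** * Values in the game *)

Lemma member_bounds s b r : (r < nr)%nat -> (1 <= member s b r <= g_k sim_game)%nat.
Proof. intros Hr. unfold member. cbn [g_k sim_game]. destruct b, s; simpl; lia. Qed.

Lemma member_le s b r : (r < nr)%nat -> (member s b r <= g_k sim_game)%nat.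
Proof. apply member_bounds. Qed.

Lemma guesser_le : (2 <= g_k sim_game)%nat.
Proof. cbn [g_k sim_game]. lia. Qed.

Lemma vcode_lt u : valid_vertex u -> (vcode u < g_nV sim_game)%nat.
Proof. apply vcode_lt_length. Qed.

Lemma vcode_vdecode_lt n : (n < g_nV sim_game)%nat -> vcode (vdecode n) = n.
Proof. apply vcode_vdecode. Qed.

Lemma target_vdecode i n : (i <= g_k sim_game)%nat -> (n < g_nV sim_game)%nat ->
  target_b sim_game i n = wins i (vdecode n).
Proof.
  intros Hi Hn. rewrite <- (vcode_vdecode_lt n Hn) at 1.
  apply target_vcode; auto using vdecode_valid.
Qed.

Local Hint Resolve sim_game_wf guesser_le member_le vcode_lt vdecode_valid checks_from_valid
  entry_valid continuation_valid gadget_valid payout_valid : core.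
Local Hint Extern 0 (valid_vertex _) => (exact I || assumption) : core.
Local Hint Extern 0 (valid_phase _) => (exact I || assumption) : core.

Section PlayValues.
Variable p : profile.
Hypothesis Hp : strat_profile sim_game p.

Notation hist g u := (valid_hist sim_game (g ++ [vcode u])).
Notation reached i n g u := (reach_within sim_game p i n (g ++ [vcode u])).
Notation val i g u := (value sim_game p i (g ++ [vcode u])).

Lemma hist_next g u w : hist g u -> valid_vertex w -> hist (g ++ [vcode u]) w.
Proof. intros H Hw. apply valid_hist_next; auto. Qed.

Local Hint Resolve hist_next : core.

Lemma expect_nature g u F : valid_vertex u -> vowner u = None ->
  expect sim_game p (g ++ [vcode u]) F = mean u (fun w => F (vcode w)).
Proof.
  intros Hu Ho. rewrite <- (natp_mean u F Hu). apply lsum_ext. intros n _.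
  unfold step. now rewrite last_last, owner_vcode, Ho.
Qed.

Lemma step_lottery_pos g u d : valid_vertex u -> vowner u = None -> In d (lottery u) ->
  (0 < snd d)%nat -> 0 < step sim_game p (g ++ [vcode u]) (vcode (fst d)).
Proof.
  intros Hu Ho Hd Hs. pose proof (outcome_valid u (fst d) Hu (in_map fst _ d Hd)) as Hw.
  unfold step. rewrite last_last, owner_vcode, Ho, natp_vcode by auto using vcode_lt_length.
  assert (Hden : 0 < INR (denominator u)) by apply lt_0_INR, denominator_pos.
  eapply Rlt_le_trans; [|apply lsum_term_le with (a := d)]; auto.
  - cbv beta. rewrite vdecode_vcode by auto. destruct (vert_eq_dec _ _); [|easy].
    apply Rdiv_lt_0_compat; auto. now apply lt_0_INR.
  - intros d' _. destruct (vert_eq_dec _ _); [|lra].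
    apply Rmult_le_pos; [apply pos_INR|]. left. now apply Rinv_0_lt_compat.
Qed.

Lemma val_bounds i g u : hist g u -> 0 <= val i g u <= 1.
Proof. apply value_bounds; auto. Qed.

Lemma val_step i g u : (i <= g_k sim_game)%nat -> valid_vertex u -> wins i u = false -> hist g u ->
  val i g u =
  expect sim_game p (g ++ [vcode u]) (fun n => value sim_game p i ((g ++ [vcode u]) ++ [n])).
Proof. intros. apply value_step; auto. now rewrite target_vcode. Qed.

Lemma val_nature i g u : (i <= g_k sim_game)%nat -> valid_vertex u -> vowner u = None ->
  wins i u = false -> hist g u -> val i g u = mean u (fun w => val i (g ++ [vcode u]) w).
Proof. intros. rewrite val_step by auto. now apply expect_nature. Qed.

Lemma reached_final i n g u : (i <= g_k sim_game)%nat -> valid_vertex u -> final u = true ->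
  hist g u -> reached i n g u = if wins i u then 1 else 0.
Proof.
  intros Hi Hu Hf Hv. pose proof (target_vcode i u Hi Hu) as Ht.
  destruct (wins i u).
  - apply reach_within_target. now rewrite last_last.
  - apply reach_within_terminal; auto. intros w. now apply next_final.
Qed.

Lemma val_final i g u : (i <= g_k sim_game)%nat -> valid_vertex u -> final u = true ->
  hist g u -> val i g u = if wins i u then 1 else 0.
Proof.
  intros Hi Hu Hf Hv. unfold value.
  rewrite (Lim_seq_ext _ (fun _ => if wins i u then 1 else 0)).
  - now rewrite Lim_seq_const.
  - intros n. now apply reached_final.
Qed.

Lemma reached_zero i g u : (i <= g_k sim_game)%nat -> valid_vertex u -> final u = false ->
  reached i 0 g u = 0.
Proof.
  intros Hi Hu Hf. apply reach_within_0. rewrite last_last, target_vcode by auto.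
  now apply wins_nonfinal.
Qed.

Lemma reached_step i n g u : (i <= g_k sim_game)%nat -> valid_vertex u -> final u = false ->
  reached i (S n) g u =
  expect sim_game p (g ++ [vcode u])
    (fun m => reach_within sim_game p i n ((g ++ [vcode u]) ++ [m])).
Proof.
  intros Hi Hu Hf. apply reach_within_S. rewrite last_last, target_vcode by auto.
  now apply wins_nonfinal.
Qed.

Lemma reached_nature i n g u : (i <= g_k sim_game)%nat -> valid_vertex u -> vowner u = None ->
  final u = false ->
  reached i (S n) g u = mean u (fun w => reached i n (g ++ [vcode u]) w).
Proof. intros. rewrite reached_step by auto. now apply expect_nature. Qed.

Lemma expect_two_moves g u i s1 s2 : valid_vertex u -> vowner u = Some i -> moves u = [s1; s2] ->
  s1 <> s2 -> hist g u ->
  exists q, 0 <= q <= 1 /\ step sim_game p (g ++ [vcode u]) (vcode s1) = q /\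
    step sim_game p (g ++ [vcode u]) (vcode s2) = 1 - q /\
    forall F, expect sim_game p (g ++ [vcode u]) F = q * F (vcode s1) + (1 - q) * F (vcode s2).
Proof.
  intros Hu Ho Hs Hne Hv.
  assert (Hs1 : valid_vertex s1) by (apply (moves_valid u); auto; rewrite Hs; simpl; auto).
  assert (Hs2 : valid_vertex s2) by (apply (moves_valid u); auto; rewrite Hs; simpl; auto).
  assert (Hexp : forall F, expect sim_game p (g ++ [vcode u]) F =
    step sim_game p (g ++ [vcode u]) (vcode s1) * F (vcode s1) +
    step sim_game p (g ++ [vcode u]) (vcode s2) * F (vcode s2)).
  { intros F. unfold expect.
    apply (lsum_pair (seq 0 (g_nV sim_game)) (vcode s1) (vcode s2)
             (fun w => step sim_game p (g ++ [vcode u]) w * F w)).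
    - apply seq_NoDup.
    - apply in_seq. split; [lia|]. now apply vcode_lt.
    - apply in_seq. split; [lia|]. now apply vcode_lt.
    - intros H%vcode_inj; auto.
    - intros w _ Hw1 Hw2.
      destruct (Req_dec (step sim_game p (g ++ [vcode u]) w) 0) as [->|Hn0]; [lra|].
      exfalso. apply (step_nonzero_next sim_game sim_game_wf p Hp) in Hn0; auto.
      apply (next_player u w i Hu Ho) in Hn0 as (w' & Hin & ->).
      rewrite Hs in Hin. destruct Hin as [<-|[<-|[]]]; easy. }
  pose proof (expect_const sim_game sim_game_wf p Hp g (vcode u) 1 Hv) as Htotal.
  rewrite Hexp in Htotal.
  pose proof (step_nonneg sim_game sim_game_wf p Hp g (vcode u) (vcode s1) Hv).
  pose proof (step_nonneg sim_game sim_game_wf p Hp g (vcode u) (vcode s2) Hv).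
  eexists. split; [|split; [reflexivity|split; [|intros F; rewrite Hexp]]]; try lra.
  f_equal. f_equal. lra.
Qed.

Definition exit_value (s : side) : R := match s with Checker => kappa | Opponent => 1 - kappa end.

Lemma val_VExit s b r g : (r < nr)%nat -> hist g VExit ->
  val (member s b r) g VExit = exit_value s.
Proof.
  intros Hr Hv. rewrite val_nature, mean_VExit by (auto; now apply wins_nonfinal).
  rewrite !val_final, !wins_member by auto.
  destruct s; simpl; lra.
Qed.

Lemma val_system_VExit g : hist g VExit -> val 0 g VExit = 1.
Proof.
  intros Hv. rewrite val_nature, mean_VExit by (auto; lia).
  rewrite !val_final by (auto; lia). simpl. lra.
Qed.

Lemma val_VFork i g ph b : (i <= g_k sim_game)%nat -> valid_phase ph -> hist g (VFork ph b) ->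
  val i g (VFork ph b) =
  rho * lsum (seq 0 nr) (fun r => val i (g ++ [vcode (VFork ph b)]) (gadget ph b r)) +
  5 / 8 * val i (g ++ [vcode (VFork ph b)]) (payout ph) +
  1 / 4 * val i (g ++ [vcode (VFork ph b)]) (continuation ph b).
Proof.
  intros Hi Hph Hv. rewrite val_nature by (auto; now apply wins_nonfinal).
  apply (mean_VFork ph b (fun w => val i (g ++ [vcode (VFork ph b)]) w)).
Qed.

Lemma val_VFork_bounds i g ph b : (i <= g_k sim_game)%nat -> valid_phase ph ->
  hist g (VFork ph b) ->
  5 / 8 * val i (g ++ [vcode (VFork ph b)]) (payout ph) <= val i g (VFork ph b) <=
  3 / 8 + 5 / 8 * val i (g ++ [vcode (VFork ph b)]) (payout ph).
Proof.
  intros Hi Hph Hv. rewrite val_VFork by auto.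
  pose proof (val_bounds i (g ++ [vcode (VFork ph b)]) (continuation ph b) ltac:(auto)).
  set (F := fun r => val i (g ++ [vcode (VFork ph b)]) (gadget ph b r)).
  assert (HF : forall r, In r (seq 0 nr) -> 0 <= F r <= 1).
  { intros r Hr%in_seq. apply val_bounds. apply hist_next; auto. apply gadget_valid. lia. }
  assert (0 <= lsum (seq 0 nr) F) by (apply lsum_nonneg; intros; now apply HF).
  assert (lsum (seq 0 nr) F <= INR nr * 1).
  { rewrite <- (length_seq nr 0) at 2. rewrite <- lsum_const.
    apply lsum_le. intros; now apply HF. }
  pose proof rho_pos. pose proof rho_total.
  assert (0 <= rho * lsum (seq 0 nr) F) by (apply Rmult_le_pos; lra).
  assert (rho * lsum (seq 0 nr) F <= rho * (INR nr * 1)) by (apply Rmult_le_compat_l; lra).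
  lra.
Qed.

(** ** Gadgets *)

Definition gadget_region (r : nat) (v : vert) : Prop :=
  match v with
  | VInput => r = 0%nat
  | VStop _ _ r' | VLoop _ _ r' | VCoin _ _ r' | VPay r' _ => r' = r
  | VOpponents => True
  | _ => False
  end.

Lemma gadget_region_next r v n : valid_vertex v -> gadget_region r v ->
  next sim_game (vcode v) n -> gadget_region r (vdecode n).
Proof.
  intros Hv Hc Hn. destruct (vowner v) as [i|] eqn:Ho.
  - apply (next_player v n i Hv Ho) in Hn as (w & Hw & ->).
    rewrite vdecode_vcode by (eapply moves_valid; eauto).
    destruct v; simpl in *; try easy; destruct Hw as [<-|[<-|[]]]; easy.
  - apply next_nature in Hn as (w & Hw & ->); auto.
    rewrite vdecode_vcode by (eapply outcome_valid; eauto).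
    destruct v; simpl in *; try easy; repeat destruct Hw as [<-|Hw]; easy.
Qed.

Lemma gadget_in_region ph b r : gadget_region r (gadget ph b r).
Proof. now destruct (gadget_cases ph b r) as [(_ & -> & ->)|[->| ->]]. Qed.

Lemma val_gadget_other b' ph b r r' g : (r < nr)%nat -> (r' < nr)%nat -> r <> r' ->
  hist g (gadget ph b r') -> val (member Checker b' r) g (gadget ph b r') = 0.
Proof.
  intros Hr Hr' Hne Hv.
  apply (value_avoiding sim_game sim_game_wf p Hp _
    (fun n => (n < g_nV sim_game)%nat /\ gadget_region r' (vdecode n))); auto.
  - intros n [Hlt Hreg]. rewrite target_vdecode, wins_member by auto.
    destruct (vdecode n); simpl in *; try easy.
    destruct (Nat.eqb_spec r0 r); [congruence|easy].
  - intros v w [Hlt Hreg] _ Hn. split; [now apply (next_lt sim_game sim_game_wf v)|].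
    apply gadget_region_next with (vdecode v); auto. now rewrite vcode_vdecode_lt.
  - split; auto. rewrite vdecode_vcode by auto. apply gadget_in_region.
Qed.

(* A gadget reaches [VStop] with some probability [s] and [VPay r (negb b)] with some [f]; the
   checker of [b] earns [rate k * s], its opponent [(1 - rate k) * s + f], the checker of
   [negb b] earns [f]. *)
Definition balanced (k : effect) (b : bool) (r : nat) (V : nat -> R) : Prop :=
  rate k * V (member Opponent b r) =
  (1 - rate k) * V (member Checker b r) + rate k * V (member Checker (negb b) r).

Lemma balanced_ext k b r V V' : (r < nr)%nat ->
  (forall i, (i <= g_k sim_game)%nat -> V i = V' i) -> balanced k b r V' -> balanced k b r V.
Proof. intros Hr H. unfold balanced. now rewrite !H by auto. Qed.

Lemma balanced_affine k b r q q' V V' : balanced k b r V -> balanced k b r V' ->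
  balanced k b r (fun i => q * V i + q' * V' i).
Proof.
  unfold balanced. intros H%(f_equal (Rmult q)) H'%(f_equal (Rmult q')). lra.
Qed.

Lemma balanced_zero k b r : balanced k b r (fun _ => 0).
Proof. unfold balanced. lra. Qed.

Lemma balanced_lim k b r V (L : nat -> R) : (forall n, balanced k b r (fun i => V i n)) ->
  (forall i, is_lim_seq (V i) (L i)) -> balanced k b r L.
Proof.
  intros H Hlim.
  pose proof (is_lim_seq_scal_l _ (rate k) _ (Hlim (member Opponent b r))) as Hl.
  pose proof (is_lim_seq_plus' _ _ _ _
    (is_lim_seq_scal_l _ (1 - rate k) _ (Hlim (member Checker b r)))
    (is_lim_seq_scal_l _ (rate k) _ (Hlim (member Checker (negb b) r)))) as Hr.
  simpl in Hl, Hr. apply (is_lim_seq_ext _ _ _ H) in Hl.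
  apply is_lim_seq_unique in Hl, Hr. rewrite Hl in Hr. now injection Hr.
Qed.

Inductive in_gadget (k : effect) (b : bool) (r : nat) : vert -> Prop :=
| in_gadget_loop : in_gadget k b r (VLoop k b r)
| in_gadget_coin : in_gadget k b r (VCoin k b r)
| in_gadget_stop : in_gadget k b r (VStop k b r)
| in_gadget_fail : in_gadget k b r (VPay r (negb b)).

Lemma in_gadget_valid k b r u : (r < nr)%nat -> in_gadget k b r u -> valid_vertex u.
Proof. now intros Hr []. Qed.

Lemma reached_VPay_balanced k b r n g : (r < nr)%nat -> hist g (VPay r (negb b)) ->
  balanced k b r (fun i => reached i n g (VPay r (negb b))).
Proof.
  intros Hr Hv. unfold balanced. rewrite !reached_final, !wins_member by auto.
  simpl. rewrite Nat.eqb_refl. destruct b; simpl; lra.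
Qed.

Lemma reached_VStop_balanced k b r n g : (r < nr)%nat -> hist g (VStop k b r) ->
  balanced k b r (fun i => reached i (S n) g (VStop k b r)).
Proof.
  intros Hr Hv. unfold balanced. rewrite !reached_nature, !mean_VStop by auto.
  rewrite !reached_final, !wins_member by auto.
  simpl. rewrite Nat.eqb_refl. destruct b; simpl; lra.
Qed.

Lemma reached_balanced k b r n : (r < nr)%nat -> forall g u, hist g u -> in_gadget k b r u ->
  balanced k b r (fun i => reached i n g u).
Proof.
  intros Hr. induction n as [|n IH]; intros g u Hv Hin; pose proof (in_gadget_valid k b r u Hr Hin).
  - destruct Hin; [| | |now apply reached_VPay_balanced];
      (apply (balanced_ext k b r _ (fun _ => 0) Hr); [|apply balanced_zero]);
      intros i Hi; now apply reached_zero.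
  - destruct Hin; [| |now apply reached_VStop_balanced|now apply reached_VPay_balanced].
    + destruct (expect_two_moves g (VLoop k b r) 1 (VCoin k b r) (VStop k b r))
        as (q & _ & _ & _ & Hexpect); try easy.
      set (g' := g ++ [vcode (VLoop k b r)]) in *.
      apply (balanced_ext k b r _ (fun i => q * reached i n g' (VCoin k b r) +
        (1 - q) * reached i n g' (VStop k b r)) Hr).
      * intros i Hi. cbv beta. unfold g'. now rewrite reached_step, Hexpect by auto.
      * apply balanced_affine; apply IH; unfold g'; auto; constructor.
    + set (g' := g ++ [vcode (VCoin k b r)]).
      apply (balanced_ext k b r _ (fun i => 1 / 2 * reached i n g' (VLoop k b r) +
        1 / 2 * reached i n g' (VPay r (negb b))) Hr).
      * intros i Hi. cbv beta. unfold g'. rewrite reached_nature by auto.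
        apply (mean_VCoin k b r (fun w => reached i n (g ++ [vcode (VCoin k b r)]) w)).
      * apply balanced_affine; apply IH; unfold g'; auto; constructor.
Qed.

Lemma val_balanced k b r g u : (r < nr)%nat -> hist g u -> in_gadget k b r u ->
  balanced k b r (fun i => val i g u).
Proof.
  intros Hr Hv Hin. apply (balanced_lim k b r (fun i n => reached i n g u)).
  - intros n. now apply reached_balanced.
  - intros i. now apply value_lim.
Qed.

Lemma val_gadget_balanced ph b r g : (r < nr)%nat -> (ph = Loading -> b = true) ->
  hist g (gadget ph b r) ->
  balanced (gadget_effect ph r) b r (fun i => val i g (gadget ph b r)).
Proof.
  intros Hr Hb Hv. destruct (gadget_cases ph b r) as [(-> & -> & _)|[E|E]].
  - rewrite (Hb eq_refl) in *. cbn [gadget gadget_effect Nat.eqb] in *.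
    set (g' := g ++ [vcode VInput]).
    apply (balanced_ext Keep true 0 _ (fun i => weight x * val i g' (VStop Keep true 0) +
      (1 - weight x) * val i g' (VPay 0 false)) Hr).
    + intros i Hi. cbv beta. unfold g'. rewrite val_nature by (auto; now apply wins_nonfinal).
      apply (mean_VInput (fun w => val i (g ++ [vcode VInput]) w)).
    + apply balanced_affine; apply val_balanced; unfold g'; auto; [constructor|].
      apply in_gadget_fail.
  - rewrite E in *. apply val_balanced; auto. constructor.
  - rewrite E in *. apply val_balanced; auto. constructor.
Qed.

Lemma val_VFork_checker b' g ph b r : (r < nr)%nat -> valid_phase ph -> hist g (VFork ph b) ->
  val (member Checker b' r) g (VFork ph b) =
  rho * val (member Checker b' r) (g ++ [vcode (VFork ph b)]) (gadget ph b r) +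
  1 / 4 * val (member Checker b' r) (g ++ [vcode (VFork ph b)]) (continuation ph b).
Proof.
  intros Hr Hph Hv. rewrite val_VFork by auto.
  rewrite (lsum_seq_single nr r) by (auto; intros r' Hr' Hne; apply val_gadget_other; auto).
  rewrite (val_final _ _ (payout ph)), wins_member by auto using payout_final.
  cbn [pays]. rewrite payout_pays_no_checker. lra.
Qed.

Lemma val_sides_le b r g u : (r < nr)%nat -> hist g u ->
  val (member Checker b r) g u + val (member Opponent b r) g u <= 1.
Proof.
  intros Hr Hv. apply (value_disjoint sim_game sim_game_wf); auto.
  intros n Hn. pose proof (proj1 (target_final sim_game sim_game_wf _ _ Hn)) as Hlt.
  rewrite target_vdecode, wins_member in Hn |- * by auto. cbn [pays] in *.
  rewrite Hn. apply andb_false_r.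
Qed.

Lemma val_sides_gadget ph b r g : (r < nr)%nat -> valid_phase ph -> hist g (VFork ph b) ->
  val (member Checker b r) g (VFork ph b) + val (member Opponent b r) g (VFork ph b) = 1 ->
  val (member Checker b r) (g ++ [vcode (VFork ph b)]) (gadget ph b r) +
  val (member Opponent b r) (g ++ [vcode (VFork ph b)]) (gadget ph b r) = 1.
Proof.
  intros Hr Hph Hv Hsum. rewrite !val_step, <- expect_plus in Hsum
    by (auto; now apply wins_nonfinal).
  apply (expect_attained sim_game sim_game_wf p Hp g (vcode (VFork ph b)) 1
    (fun n => value sim_game p (member Checker b r) ((g ++ [vcode (VFork ph b)]) ++ [n]) +
              value sim_game p (member Opponent b r) ((g ++ [vcode (VFork ph b)]) ++ [n]))); auto.
  - intros n Hn _. rewrite <- (vcode_vdecode_lt n Hn). apply val_sides_le; auto.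
  - apply (step_lottery_pos g (VFork ph b) (gadget ph b r, 1%nat)); auto.
    apply in_lottery_VFork. eauto.
Qed.

Lemma fork_equation ph b r g : (r < nr)%nat -> valid_phase ph -> (ph = Loading -> b = true) ->
  hist g (VFork ph b) ->
  val (member Checker b r) g (VFork ph b) = kappa ->
  val (member Opponent b r) g (VFork ph b) = 1 - kappa ->
  kappa = rho * (rate (gadget_effect ph r) *
    (1 - val (member Checker (negb b) r) (g ++ [vcode (VFork ph b)]) (gadget ph b r))) +
    1 / 4 * val (member Checker b r) (g ++ [vcode (VFork ph b)]) (continuation ph b).
Proof.
  intros Hr Hph Hb Hv Hchecker Hopponent.
  pose proof (val_sides_gadget ph b r g Hr Hph Hv ltac:(lra)) as Hsum.
  pose proof (val_gadget_balanced ph b r (g ++ [vcode (VFork ph b)]) Hr Hb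
    ltac:(auto)) as Hbalanced.
  rewrite <- Hchecker at 1. rewrite val_VFork_checker by auto.
  apply Rplus_eq_compat_r, Rmult_eq_compat_l.
  unfold balanced in Hbalanced. apply Rplus_eq_reg_l with (r := - rate (gadget_effect ph r) *
    val (member Checker b r) (g ++ [vcode (VFork ph b)]) (gadget ph b r)).
  replace (val (member Opponent b r) (g ++ [vcode (VFork ph b)]) (gadget ph b r)) with
    (1 - val (member Checker b r) (g ++ [vcode (VFork ph b)]) (gadget ph b r)) in Hbalanced by lra.
  lra.
Qed.

Lemma val_checker_VFinish b r g : (r < nr)%nat -> hist g (VFinish b) ->
  val (member Checker b r) g (VFinish b) = 4 * kappa.
Proof.
  intros Hr Hv. rewrite val_nature, mean_VFinish by (auto; now apply wins_nonfinal).
  rewrite (lsum_seq_single nr r); auto.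
  - rewrite !val_final, !wins_member by auto.
    simpl. rewrite Nat.eqb_refl, eqb_reflx. simpl. lra.
  - intros r' Hr' Hne.
    rewrite val_final, wins_member by auto.
    simpl. apply Nat.eqb_neq in Hne. now rewrite Hne.
Qed.

Lemma val_other_checker_VStop k b r g : (r < nr)%nat -> hist g (VStop k b r) ->
  val (member Checker (negb b) r) g (VStop k b r) = 0.
Proof.
  intros Hr Hv. rewrite val_nature, mean_VStop by (auto; now apply wins_nonfinal).
  rewrite !val_final, !wins_member by auto.
  simpl. rewrite Nat.eqb_refl. destruct b; simpl; lra.
Qed.

End PlayValues.

(** * Equilibria simulate the machine *)

(* The value of the checker of the other family where the checks of a phase begin, when the
   encoding of its register is [z]. *)
Definition promise (z : R) : R := rho * (1 - z) + kappa / 4.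

Definition branch_of (pc : nat) (regs : nat -> nat) : bool :=
  match nth_error Q pc with
  | Some (DEC r0 _) => negb (Nat.eqb (regs r0) 0)
  | _ => false
  end.

Lemma continuation_step pc regs b : (pc < length Q)%nat ->
  continuation (Execute pc (branch_of pc regs)) b = entry (fst (mstep Q (pc, regs))) (negb b).
Proof.
  intros Hpc. unfold branch_of, mstep. cbn [continuation].
  destruct (nth_error Q pc) as [[r0|r0 j]|] eqn:E; auto.
  - now destruct (regs r0).
  - apply nth_error_None in E. lia.
Qed.

Lemma weight_step pc regs r : (pc < length Q)%nat ->
  4 * rate (gadget_effect (Execute pc (branch_of pc regs)) r) * weight (regs r) =
  weight (snd (mstep Q (pc, regs)) r).
Proof.
  intros Hpc. unfold branch_of, mstep, rate. cbn [gadget_effect].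
  destruct (nth_error Q pc) as [[r0|r0 j]|] eqn:E; cbn [snd].
  - unfold set_reg. destruct (Nat.eqb_spec r r0) as [->|].
    + rewrite weight_S. simpl INR. lra.
    + simpl INR. lra.
  - destruct (regs r0) as [|n] eqn:En; cbn [negb Nat.eqb snd].
    + rewrite andb_false_r. simpl INR. lra.
    + rewrite andb_true_r. unfold set_reg. destruct (Nat.eqb_spec r r0) as [->|].
      * rewrite En, weight_S. simpl INR. lra.
      * simpl INR. lra.
  - apply nth_error_None in E. lia.
Qed.

(* The identity [4 kappa = rho + kappa / 4] makes the constants consistent. *)
Lemma promise_of_equation k f v :
  kappa = rho * (rate k * (1 - f)) + 1 / 4 * v -> v = promise (4 * rate k * (1 - f)).
Proof. unfold promise. rewrite rho_kappa. lra. Qed.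

Section Soundness.
Hypothesis Hregs : forall i, In i Q -> (instr_reg i < nr)%nat.

Variable c : sclass.
Variable p : profile.
Hypothesis Hp : strat_profile sim_game p.
Hypothesis Hclass : forall i, (1 <= i <= g_k sim_game)%nat -> in_class c sim_game i (p i).
Hypothesis HNE : is_NE0 c sim_game p.
Hypothesis Hzero : value sim_game p 0 [g_v0 sim_game] = 0.

Notation hist g u := (valid_hist sim_game (g ++ [vcode u])).
Notation val i g u := (value sim_game p i (g ++ [vcode u])).
Notation rch g u := (reach sim_game p (g ++ [vcode u])).

Local Hint Resolve hist_next : core.

Lemma rch_hist g u : rch g u -> hist g u.
Proof. intros H. now apply (reach_valid sim_game sim_game_wf p _ H). Qed.

Local Hint Resolve rch_hist : core.

Lemma rch_system_zero g u : rch g u -> val 0 g u = 0.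
Proof.
  intros H. pose proof (val_bounds p Hp 0 g u (rch_hist g u H)).
  destruct (Rle_lt_dec (val 0 g u) 0) as [|Hlt]; [lra|].
  pose proof (value_pos_initial sim_game sim_game_wf p Hp 0 _ H Hlt). lra.
Qed.

Lemma not_rch_VExit g : ~ rch g VExit.
Proof.
  intros H. pose proof (rch_system_zero g VExit H) as Hval.
  rewrite val_system_VExit in Hval by auto. lra.
Qed.

Lemma not_rch_VSysOpponents g : ~ rch g VSysOpponents.
Proof.
  intros H. pose proof (rch_system_zero g VSysOpponents H) as Hval.
  rewrite val_final in Hval by (auto; lia). simpl in Hval. lra.
Qed.

Lemma rch_continuation ph b g : valid_phase ph -> rch g (VFork ph b) ->
  rch (g ++ [vcode (VFork ph b)]) (continuation ph b).
Proof.
  intros Hph Hr. apply reach_step; auto.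
  apply (step_lottery_pos p g (VFork ph b) (continuation ph b, (2 * nr)%nat)); auto.
  - apply in_lottery_VFork. auto.
  - simpl. lia.
Qed.

Lemma rch_two_moves g u i s1 s2 : valid_vertex u -> vowner u = Some i -> moves u = [s1; s2] ->
  s1 <> s2 -> rch g u ->
  exists q, 0 <= q <= 1 /\
    (0 < q -> rch (g ++ [vcode u]) s1) /\ (q < 1 -> rch (g ++ [vcode u]) s2) /\
    forall j, (j <= g_k sim_game)%nat ->
       val j g u = q * val j (g ++ [vcode u]) s1 + (1 - q) * val j (g ++ [vcode u]) s2.
Proof.
  intros Hu Ho Hs Hne Hr.
  assert (Hs1 : valid_vertex s1) by (apply (moves_valid u); auto; rewrite Hs; simpl; auto).
  assert (Hs2 : valid_vertex s2) by (apply (moves_valid u); auto; rewrite Hs; simpl; auto).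
  destruct (expect_two_moves p Hp g u i s1 s2) as (q & Hq & Hstep1 & Hstep2 & Hexpect); auto.
  exists q. split; auto. split; [|split].
  - intros Hpos. apply reach_step; auto. lra.
  - intros Hpos. apply reach_step; auto. lra.
  - intros j Hj. pose proof (owner_nonfinal u i Ho).
    rewrite val_step by (auto using wins_nonfinal). apply Hexpect.
Qed.

Lemma move_le g u i w : valid_vertex u -> vowner u = Some i -> (i <= g_k sim_game)%nat ->
  In w (moves u) -> rch g u -> val i (g ++ [vcode u]) w <= val i g u.
Proof.
  intros Hu Ho Hi Hw Hr. pose proof (vowner_pos u i Ho).
  apply (NE_successor_le sim_game sim_game_wf c p i g (vcode u) (vcode w)); auto.
  - now rewrite owner_vcode.
  - rewrite target_vcode by auto. apply wins_nonfinal. eapply owner_nonfinal; eauto.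
  - apply (next_player u (vcode w) i); auto. now exists w.
Qed.

Definition leads_to (g : list nat) (u : vert) (g' : list nat) (u' : vert) : Prop :=
  rch g' u' /\ forall i, (i <= g_k sim_game)%nat -> val i g' u' = val i g u.

Lemma leads_to_refl g u : rch g u -> leads_to g u g u.
Proof. now split. Qed.

Lemma leads_to_trans g1 u1 g2 u2 g3 u3 :
  leads_to g1 u1 g2 u2 -> leads_to g2 u2 g3 u3 -> leads_to g1 u1 g3 u3.
Proof. intros [_ Hval] [Hr Hval']. split; auto. intros i Hi. rewrite Hval', Hval; auto. Qed.

Lemma forced_move g u i s1 s2 : valid_vertex u -> vowner u = Some i -> moves u = [s1; s2] ->
  s1 <> s2 -> rch g u -> (forall g', ~ rch g' s2) -> leads_to g u (g ++ [vcode u]) s1.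
Proof.
  intros Hu Ho Hs Hne Hr Hno.
  destruct (rch_two_moves g u i s1 s2) as (q & Hq & Hrch1 & Hrch2 & Hval); auto.
  assert (q = 1) as ->.
  { destruct (Rle_lt_dec 1 q); [lra|]. exfalso. eapply Hno, Hrch2; auto. }
  split; [apply Hrch1; lra|]. intros j Hj. rewrite Hval by auto. lra.
Qed.

Lemma checks_from_neq ph b j : checks_from ph b j <> VExit /\
  checks_from ph b j <> VSysOpponents /\ forall pc b', checks_from ph b j <> VConfirm pc b'.
Proof. unfold checks_from. case (Nat.ltb j (2 * nr)); repeat split; congruence. Qed.

Lemma checks_walk ph b : valid_phase ph -> forall d j g, (2 * nr - j = d)%nat ->
  (j <= 2 * nr)%nat -> rch g (checks_from ph b j) ->
  exists g', leads_to g (checks_from ph b j) g' (VFork ph b) /\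
    forall r s, (r < nr)%nat -> (j <= 2 * r + side_index s)%nat ->
      exit_value s <= val (member s b r) g (checks_from ph b j).
Proof.
  intros Hph d. induction d as [|d IH]; intros j g Hd Hj Hr; unfold checks_from in Hr |- *.
  - replace (Nat.ltb j (2 * nr)) with false in * by (symmetry; apply Nat.ltb_ge; lia).
    exists g. split; [now apply leads_to_refl|].
    intros r s Hrn Hle. destruct s; simpl in Hle; lia.
  - assert (Hlt : (j < 2 * nr)%nat) by lia.
    rewrite (proj2 (Nat.ltb_lt j (2 * nr)) Hlt) in Hr |- *.
    assert (Hok : valid_vertex (VCheck ph b j)) by (split; auto).
    pose proof (forced_move g (VCheck ph b j) _ (checks_from ph b (S j)) VExit Hok eq_refl
      eq_refl (proj1 (checks_from_neq ph b (S j))) Hr not_rch_VExit) as Hnext.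
    destruct (IH (S j) _ ltac:(lia) ltac:(lia) (proj1 Hnext)) as (g' & Hfork & Hge).
    exists g'. split; [eapply leads_to_trans; eauto|].
    intros r s Hrn Hle. destruct (Nat.eq_dec j (2 * r + side_index s)) as [->|Hne].
    + rewrite <- (val_VExit p Hp s b r (g ++ [vcode (VCheck ph b (2 * r + side_index s))]))
        by auto.
      apply move_le; auto. simpl; auto.
    + rewrite <- (proj2 Hnext) by auto. apply Hge; auto. lia.
Qed.

Lemma checks_passed ph b g : valid_phase ph -> rch g (checks_from ph b 0) ->
  exists g', leads_to g (checks_from ph b 0) g' (VFork ph b) /\
    forall r s, (r < nr)%nat -> val (member s b r) g' (VFork ph b) = exit_value s.
Proof.
  intros Hph Hr.
  destruct (checks_walk ph b Hph (2 * nr) 0 g ltac:(lia) ltac:(lia) Hr) as (g' & Hlead & Hge).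
  exists g'. split; auto. intros r s Hrn. rewrite (proj2 Hlead) by auto.
  pose proof (Hge r Checker Hrn (Nat.le_0_l _)). pose proof (Hge r Opponent Hrn (Nat.le_0_l _)).
  pose proof (val_sides_le p Hp b r g (checks_from ph b 0) Hrn (rch_hist _ _ Hr)).
  destruct s; simpl in *; lra.
Qed.

Lemma val_guesser_branch pc br b g : (pc < length Q)%nat ->
  rch g (checks_from (Execute pc br) b 0) ->
  if br then 5 / 8 <= val 2 g (checks_from (Execute pc true) b 0)
  else val 2 g (checks_from (Execute pc false) b 0) <= 3 / 8.
Proof.
  intros Hpc Hr.
  destruct (checks_passed (Execute pc br) b g Hpc Hr) as (g' & [Hr' Hval] & _).
  pose proof (val_VFork_bounds p Hp 2 g' (Execute pc br) b guesser_le Hpc (rch_hist _ _ Hr')) as Hb.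
  rewrite Hval, val_final in Hb by auto using payout_final. destruct br; simpl in Hb; lra.
Qed.

Lemma guess_is_pure pc b g : (pc < length Q)%nat -> rch g (VGuess pc b) ->
  exists br g', leads_to g (VGuess pc b) g' (checks_from (Execute pc br) b 0).
Proof.
  intros Hpc Hr.
  destruct (rch_two_moves g (VGuess pc b) 2 (checks_from (Execute pc false) b 0) (VConfirm pc b))
    as (q & Hq & Hrch1 & Hrch2 & Hval); auto; [apply checks_from_neq|].
  destruct (Req_dec q 1) as [->|Hq1].
  { exists false, (g ++ [vcode (VGuess pc b)]). split; [apply Hrch1; lra|].
    intros i Hi. rewrite Hval by auto. lra. }
  specialize (Hrch2 ltac:(lra)).
  assert (Hok : valid_vertex (VConfirm pc b)) by exact Hpc.
  pose proof (forced_move _ (VConfirm pc b) 1 (checks_from (Execute pc true) b 0) VSysOpponents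
    Hok eq_refl eq_refl (proj1 (proj2 (checks_from_neq _ b 0))) Hrch2 not_rch_VSysOpponents)
    as Hconfirm.
  exists true. eexists. eapply leads_to_trans; [|exact Hconfirm]. split; [exact Hrch2|].
  intros i Hi. rewrite (Hval i Hi). destruct (Req_dec q 0) as [->|Hq0]; [lra|]. exfalso.
  pose proof (val_guesser_branch pc false b _ Hpc (Hrch1 ltac:(lra))) as Hfalse.
  pose proof (val_guesser_branch pc true b _ Hpc (proj1 Hconfirm)) as Htrue.
  cbv iota in Hfalse, Htrue.
  pose proof (move_le g (VGuess pc b) 2 (VConfirm pc b) Hpc eq_refl guesser_le
    ltac:(simpl; auto) Hr) as Hle.
  rewrite (Hval 2%nat guesser_le), <- (proj2 Hconfirm 2%nat guesser_le) in Hle.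
  nra.
Qed.

Lemma entry_checked l b g r : (r < nr)%nat -> l <> S (length Q) -> rch g (entry l b) ->
  val (member Checker b r) g (entry l b) = kappa.
Proof.
  intros Hr Hl Hg.
  assert (Hchecks : forall ph g', valid_phase ph -> rch g' (checks_from ph b 0) ->
    val (member Checker b r) g' (checks_from ph b 0) = kappa).
  { intros ph g' Hph Hr'. destruct (checks_passed ph b g' Hph Hr') as (g0 & Hlead & Hval).
    rewrite <- (proj2 Hlead) by auto. now rewrite Hval. }
  unfold entry in *. destruct (nth_error Q l) as [[r0|r0 j]|] eqn:E.
  - apply nth_error_lt in E. now apply Hchecks.
  - apply nth_error_lt in E. destruct (guess_is_pure l b g E Hg) as (br & g' & Hg' & Hval).
    rewrite <- Hval by auto. now apply Hchecks.
  - apply Nat.eqb_neq in Hl. rewrite Hl in Hg. exfalso. eapply not_rch_VSysOpponents; eauto.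
Qed.

Lemma entry_le l b g r : (r < nr)%nat -> rch g (entry l b) ->
  val (member Checker b r) g (entry l b) <= rho + kappa.
Proof.
  intros Hr Hg. pose proof rho_pos.
  destruct (Nat.eq_dec l (S (length Q))) as [->|Hl]; [|rewrite entry_checked by auto; lra].
  unfold entry in *. destruct (nth_error Q (S (length Q))) eqn:E; [apply nth_error_lt in E; lia|].
  rewrite Nat.eqb_refl in *. rewrite val_VFork_checker by auto. cbn [continuation gadget].
  rewrite val_checker_VFinish by auto.
  pose proof (val_bounds p Hp (member Checker b r) (g ++ [vcode (VFork Accept b)])
    (VLoop Annul b r) ltac:(auto)) as Hb.
  assert (rho * val (member Checker b r) (g ++ [vcode (VFork Accept b)]) (VLoop Annul b r)
    <= rho * 1) by (apply Rmult_le_compat_l; lra).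
  lra.
Qed.

Lemma phase_equations ph b l g : valid_phase ph -> (ph = Loading -> b = true) ->
  continuation ph b = entry l (negb b) -> rch g (checks_from ph b 0) ->
  exists g0 g', rch g0 (VFork ph b) /\ rch g' (entry l (negb b)) /\
    forall r, (r < nr)%nat ->
    let f := val (member Checker (negb b) r) (g0 ++ [vcode (VFork ph b)]) (gadget ph b r) in
    val (member Checker (negb b) r) g (checks_from ph b 0) =
      rho * f + 1 / 4 * val (member Checker (negb b) r) g' (entry l (negb b)) /\
    kappa = rho * (rate (gadget_effect ph r) * (1 - f)) +
      1 / 4 * val (member Checker b r) g' (entry l (negb b)).
Proof.
  intros Hph Hb Hcont Hr.
  destruct (checks_passed ph b g Hph Hr) as (g0 & [Hfork Hval] & Hexit).
  exists g0, (g0 ++ [vcode (VFork ph b)]). split; auto.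
  rewrite <- Hcont. split; [now apply rch_continuation|].
  intros r Hrn. split.
  - rewrite <- Hval by auto. now apply val_VFork_checker; auto.
  - apply fork_equation; auto; now rewrite Hexit.
Qed.

Definition encodes (g : list nat) (u : vert) (b : bool) (regs : nat -> nat) : Prop :=
  forall r, (r < nr)%nat ->
  val (member Checker (negb b) r) g u = promise (weight (regs r)).

Lemma encodes_leads_to g u g' u' b regs :
  leads_to g u g' u' -> encodes g u b regs -> encodes g' u' b regs.
Proof. intros [_ Hval] H r Hr. rewrite Hval; auto. Qed.

Definition simulated (pc : nat) (regs : nat -> nat) : Prop :=
  exists g b, rch g (entry pc b) /\ encodes g (entry pc b) b regs.

Lemma simulated_step ph b l g regs regs' : valid_phase ph -> ph <> Loading ->
  continuation ph b = entry l (negb b) -> l <> S (length Q) ->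
  rch g (checks_from ph b 0) -> encodes g (checks_from ph b 0) b regs ->
  (forall r, (r < nr)%nat ->
     4 * rate (gadget_effect ph r) * weight (regs r) = weight (regs' r)) ->
  simulated l regs'.
Proof.
  intros Hph Hload Hcont Hl Hr Henc Hweight.
  destruct (phase_equations ph b l g) as (g0 & g' & _ & Hr' & Heqs); auto.
  exists g', (negb b). split; auto. intros r Hrn. rewrite negb_involutive.
  destruct (Heqs r Hrn) as [Hother Hown%promise_of_equation].
  rewrite Henc, entry_checked in Hother by auto.
  rewrite Hown, <- Hweight by auto. f_equal. f_equal.
  pose proof rho_pos. unfold promise in Hother.
  apply Rmult_eq_reg_l with rho; lra.
Qed.

Lemma val_loading_gadget r g : (r < nr)%nat -> hist g (gadget Loading true r) ->
  val (member Checker false r) g (gadget Loading true r) = 1 - weight (snd (init_state x) r).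
Proof.
  intros Hr Hv. cbn [gadget init_state snd] in *. destruct (Nat.eqb_spec r 0) as [->|Hne].
  - rewrite val_nature, mean_VInput by (auto; now apply wins_nonfinal).
    rewrite (val_other_checker_VStop p Hp Keep true 0) by auto.
    rewrite val_final, wins_member by auto. simpl. lra.
  - rewrite (val_other_checker_VStop p Hp Keep true r) by auto. rewrite weight_0. lra.
Qed.

Lemma simulated_init : simulated 0 (snd (init_state x)).
Proof.
  assert (Hr : rch [] (checks_from Loading true 0)) by apply reach_init.
  destruct (phase_equations Loading true 0 [] I (fun _ => eq_refl) eq_refl Hr)
    as (g0 & g' & Hfork & Hr' & Heqs).
  exists g', false. split; auto. intros r Hrn.
  destruct (Heqs r Hrn) as [_ Hown%promise_of_equation].
  rewrite val_loading_gadget in Hown by auto. cbn [negb] in *. rewrite Hown. f_equal.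
  unfold rate. simpl. lra.
Qed.

Lemma zero_branch_correct pc r0 j b g regs : nth_error Q pc = Some (DEC r0 j) ->
  rch g (checks_from (Execute pc false) b 0) ->
  encodes g (checks_from (Execute pc false) b 0) b regs -> regs r0 = 0%nat.
Proof.
  intros E Hr Henc. pose proof (nth_error_lt Q pc _ E) as Hpc.
  pose proof (Hregs _ (nth_error_In Q pc E)) as Hr0. cbn [instr_reg] in Hr0.
  destruct (phase_equations (Execute pc false) b j g) as (g0 & g' & Hfork & Hr' & Heqs);
    auto; [easy|cbn [continuation]; now rewrite E|].
  destruct (Heqs r0 Hr0) as [Hother _]. cbn [gadget] in Hother.
  rewrite E, Nat.eqb_refl, val_other_checker_VStop, Henc in Hother
    by (auto; apply hist_next; auto; apply rch_hist; auto).
  pose proof (entry_le j (negb b) g' r0 Hr0 Hr') as Hle.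
  destruct (regs r0) as [|n]; auto. exfalso. rewrite weight_S in Hother.
  pose proof (weight_bounds n). pose proof rho_pos.
  assert (rho * weight n <= rho * 1) by (apply Rmult_le_compat_l; lra).
  unfold promise in Hother. lra.
Qed.

Lemma nonzero_branch_correct pc r0 j b g regs : nth_error Q pc = Some (DEC r0 j) ->
  rch g (checks_from (Execute pc true) b 0) ->
  encodes g (checks_from (Execute pc true) b 0) b regs -> regs r0 <> 0%nat.
Proof.
  intros E Hr Henc Hz. pose proof (nth_error_lt Q pc _ E) as Hpc.
  pose proof (Hregs _ (nth_error_In Q pc E)) as Hr0. cbn [instr_reg] in Hr0.
  destruct (phase_equations (Execute pc true) b (S pc) g) as (g0 & g' & Hfork & Hr' & Heqs);
    auto; [easy|cbn [continuation]; now rewrite E|].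
  destruct (Heqs r0 Hr0) as [Hother Hown]. cbn [gadget_effect] in Hown.
  rewrite E, Nat.eqb_refl in Hown. rewrite Henc, Hz, weight_0 in Hother by auto.
  pose proof (val_bounds p Hp (member Checker (negb b) r0) _ _ (rch_hist _ _ Hr')).
  pose proof (val_bounds p Hp (member Checker b r0) _ _ (rch_hist _ _ Hr')).
  pose proof kappa_pos. unfold promise in Hother. unfold rate in Hown.
  cbn [andb] in Hown. simpl INR in Hown. rewrite rho_kappa in *. lra.
Qed.

Lemma correct_branch pc regs b g : (pc < length Q)%nat ->
  rch g (entry pc b) -> encodes g (entry pc b) b regs ->
  exists g', rch g' (checks_from (Execute pc (branch_of pc regs)) b 0) /\
    encodes g' (checks_from (Execute pc (branch_of pc regs)) b 0) b regs.
Proof.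
  intros Hpc Hr Henc. unfold entry, branch_of in *.
  destruct (nth_error Q pc) as [[r0|r0 j]|] eqn:E.
  - now exists g.
  - destruct (guess_is_pure pc b g Hpc Hr) as (br & g' & Hlead).
    pose proof (encodes_leads_to _ _ _ _ _ _ Hlead Henc) as Henc'.
    exists g'. enough (negb (Nat.eqb (regs r0) 0) = br) as -> by (split; [apply Hlead|easy]).
    destruct br.
    + apply (nonzero_branch_correct pc r0 j b g') in Henc'; auto; [|apply Hlead].
      apply Nat.eqb_neq in Henc'. now rewrite Henc'.
    + apply (zero_branch_correct pc r0 j b g') in Henc'; auto; [|apply Hlead].
      now rewrite Henc'.
  - apply nth_error_None in E. lia.
Qed.

Lemma simulated_mstep pc regs : (pc < length Q)%nat -> simulated pc regs ->
  fst (mstep Q (pc, regs)) <> S (length Q) ->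
  simulated (fst (mstep Q (pc, regs))) (snd (mstep Q (pc, regs))).
Proof.
  intros Hpc (g & b & Hr & Henc) Hnext.
  destruct (correct_branch pc regs b g Hpc Hr Henc) as (g' & Hr' & Henc').
  apply (simulated_step (Execute pc (branch_of pc regs)) b _ g' regs); auto; try easy.
  - now apply continuation_step.
  - intros r _. now apply weight_step.
Qed.

Lemma rejecting_run_absurd n :
  fst (mrun Q n (init_state x)) = length Q -> (0 < length Q)%nat -> False.
Proof.
  intros Hn Hlen.
  assert (Hnever : forall m, fst (mrun Q m (init_state x)) <> S (length Q)).
  { intros m Hm. destruct (Nat.le_ge_cases m n) as [Hle|Hle].
    - rewrite (mrun_halted Q (init_state x) m n) in Hn; lia.
    - rewrite (mrun_halted Q (init_state x) n m) in Hm; lia. }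
  assert (Hsim : forall m,
    simulated (fst (mrun Q m (init_state x))) (snd (mrun Q m (init_state x)))).
  { induction m as [|m IH]; [apply simulated_init|].
    pose proof (Hnever (S m)) as HS. rewrite mrun_succ in HS |- *.
    destruct (mrun Q m (init_state x)) as [pc regs].
    destruct (le_lt_dec (length Q) pc) as [Hge|Hlt]; [|now apply simulated_mstep].
    simpl. apply nth_error_None in Hge. now rewrite Hge. }
  destruct (Hsim n) as (g & b & Hg & _). rewrite Hn in Hg. unfold entry in Hg.
  rewrite (proj2 (nth_error_None Q (length Q)) (le_n _)) in Hg.
  destruct (Nat.eqb_spec (length Q) (S (length Q))); [lia|].
  eapply not_rch_VSysOpponents; eauto.
Qed.

End Soundness.

(** * An accepting simulation is an equilibrium *)

(* Memory of the equilibrium strategies: the number of phases simulated so far, or, inside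
   a gadget, the number of loops still to be done. *)
Inductive mem : Type := AtPhase (t : nat) | InGadget (n : nat).

Definition mem_code (m : mem) : nat :=
  match m with AtPhase t => 2 * t | InGadget n => 2 * n + 1 end.

Definition mem_decode (n : nat) : mem :=
  if Nat.odd n then InGadget (Nat.div2 n) else AtPhase (Nat.div2 n).

Lemma mem_decode_code m : mem_decode (mem_code m) = m.
Proof.
  unfold mem_decode. destruct m as [t|n]; cbn [mem_code].
  - rewrite Nat.odd_mul, Nat.div2_double. easy.
  - rewrite Nat.odd_add, Nat.odd_mul, Nat.add_1_r, Nat.div2_succ_double. easy.
Qed.

Lemma mem_code_decode n : mem_code (mem_decode n) = n.
Proof.
  rewrite (Nat.div2_odd n) at 2. unfold mem_decode.
  destruct (Nat.odd n); cbn [mem_code Nat.b2n]; lia.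
Qed.

Section AcceptingRun.
Variables N B : nat.

Definition config (n : nat) : mstate := mrun Q n (init_state x).

Hypothesis Hrun : forall n, (n < N)%nat -> (fst (config n) < length Q)%nat.
Hypothesis Hend : fst (config N) = S (length Q).
Hypothesis HB : forall n r, (n <= N)%nat -> (r < nr)%nat -> (snd (config n) r <= B)%nat.

Definition parity (t : nat) : bool := Nat.even t.

Lemma parity_S t : parity (S t) = negb (parity t).
Proof. unfold parity. now rewrite Nat.even_succ, <- Nat.negb_even. Qed.

Definition branch_at (n : nat) : bool := branch_of (fst (config n)) (snd (config n)).

(* Phase 0 loads the input; phase [S n] performs the [n]-th step of the machine. *)
Definition phase_at (t : nat) : phase :=
  match t with
  | O => Loading
  | S n => if Nat.ltb n N then Execute (fst (config n)) (branch_at n) else Accept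
  end.

Definition regs_at (t : nat) : nat -> nat := snd (config (pred t)).

Lemma config_S n : config (S n) = mstep Q (fst (config n), snd (config n)).
Proof. unfold config. rewrite mrun_succ. now destruct (mrun Q n (init_state x)). Qed.

Lemma phase_at_S t : (t < N)%nat -> phase_at (S t) = Execute (fst (config t)) (branch_at t).
Proof. intros H. simpl. apply Nat.ltb_lt in H. now rewrite H. Qed.

Lemma phase_at_end : phase_at (S N) = Accept.
Proof. simpl. now rewrite Nat.ltb_irrefl. Qed.

Lemma phase_at_valid t : valid_phase (phase_at t).
Proof.
  destruct t as [|n]; simpl; auto. destruct (Nat.ltb_spec n N); simpl; auto.
Qed.

Lemma continuation_run t : (t <= N)%nat ->
  continuation (phase_at t) (parity t) = entry (fst (config t)) (parity (S t)).
Proof.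
  intros Ht. rewrite parity_S. destruct t as [|n]; [easy|].
  rewrite phase_at_S, config_S by lia. now apply continuation_step, Hrun.
Qed.

Lemma entry_run t : (t <= N)%nat ->
  (exists j, entry (fst (config t)) (parity (S t)) =
             checks_from (phase_at (S t)) (parity (S t)) j) \/
  (t < N)%nat /\ entry (fst (config t)) (parity (S t)) = VGuess (fst (config t)) (parity (S t)).
Proof.
  intros Ht. unfold entry. destruct (Nat.eq_dec t N) as [->|Hne].
  - left. exists (2 * nr)%nat. rewrite Hend, phase_at_end, Nat.eqb_refl. unfold checks_from.
    rewrite Nat.ltb_irrefl. now rewrite (proj2 (nth_error_None Q (S (length Q)))) by lia.
  - assert (Hlt : (t < N)%nat) by lia. rewrite phase_at_S by auto.
    unfold branch_at, branch_of. destruct (nth_error Q (fst (config t))) as [[r0|r0 j]|] eqn:E.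
    + left. now exists 0%nat.
    + now right.
    + apply nth_error_None in E. pose proof (Hrun t Hlt). lia.
Qed.

Lemma weight_regs_next t r : (t <= N)%nat ->
  weight (regs_at (S t) r) = 4 * rate (gadget_effect (phase_at t) r) * weight (regs_at t r).
Proof.
  intros Ht. unfold regs_at. cbn [pred]. destruct t as [|n].
  - unfold rate. simpl. lra.
  - rewrite phase_at_S, config_S by lia. symmetry. now apply weight_step, Hrun.
Qed.

(** ** The strategy *)

Definition loops_left (m : mem) (r : nat) : nat :=
  match m with AtPhase t => Nat.min B (regs_at (pred t) r) | InGadget n => n end.

Definition next_mem (m : mem) (u : vert) : mem :=
  match u with
  | VFork _ _ => match m with AtPhase t => AtPhase (Nat.min (S t) (N + 2)) | InGadget _ => m end
  | VLoop _ _ r => InGadget (loops_left m r - 1)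
  | _ => m
  end.

Definition time_of (m : mem) (ph : phase) (b : bool) : option nat :=
  match m with
  | AtPhase t =>
      if ((if phase_eq_dec ph (phase_at t) then true else false) && Bool.eqb b (parity t) &&
          Nat.leb t (S N))%bool then Some t else None
  | InGadget _ => None
  end.

Definition reply (m : mem) (u : vert) : vert :=
  match u with
  | VCheck ph b j => checks_from ph b (S j)
  | VGuess pc b =>
      match time_of m (Execute pc true) b with
      | Some _ => VConfirm pc b
      | None => checks_from (Execute pc false) b 0
      end
  | VConfirm pc b =>
      match time_of m (Execute pc true) b with
      | Some _ => checks_from (Execute pc true) b 0
      | None => VSysOpponents
      end
  | VLoop k b r => if Nat.eqb (loops_left m r) 0 then VStop k b r else VCoin k b r
  | _ => VOpponents
  end.

Definition mem_of (h : list nat) : mem :=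
  fold_left (fun m n => next_mem m (vdecode n)) h (AtPhase 0).

Definition simulator : strategy := fun h =>
  dirac (vcode (reply (mem_of (removelast h)) (vdecode (last h 0%nat)))).

Lemma time_of_Some m ph b t : time_of m ph b = Some t ->
  m = AtPhase t /\ ph = phase_at t /\ b = parity t /\ (t <= S N)%nat.
Proof.
  unfold time_of. destruct m as [t'|n]; [|easy].
  destruct (phase_eq_dec ph (phase_at t')) as [->|]; [|easy].
  destruct (Bool.eqb_spec b (parity t')) as [->|]; [|easy].
  destruct (Nat.leb_spec t' (S N)) as [Ht|]; [|easy]. now injection 1 as <-.
Qed.

Lemma time_of_run t : (t <= S N)%nat -> time_of (AtPhase t) (phase_at t) (parity t) = Some t.
Proof.
  intros Ht. unfold time_of. destruct (phase_eq_dec _ _); [|easy].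
  rewrite eqb_reflx. apply Nat.leb_le in Ht. now rewrite Ht.
Qed.

Lemma time_of_branch t br : (t < N)%nat ->
  time_of (AtPhase (S t)) (Execute (fst (config t)) br) (parity (S t)) =
  if Bool.eqb br (branch_at t) then Some (S t) else None.
Proof.
  intros Ht. destruct (Bool.eqb_spec br (branch_at t)) as [->|Hne].
  - rewrite <- phase_at_S by auto. apply time_of_run. lia.
  - unfold time_of. destruct (phase_eq_dec _ _) as [E|]; [|easy].
    rewrite phase_at_S in E by auto. congruence.
Qed.

Lemma next_mem_VFork t ph b : (t <= S N)%nat ->
  next_mem (AtPhase t) (VFork ph b) = AtPhase (S t).
Proof. intros H. cbn [next_mem]. f_equal. lia. Qed.

Lemma next_mem_final m u : final u = true -> next_mem m u = m.
Proof. now destruct u. Qed.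

Lemma mem_of_snoc g u : valid_vertex u -> mem_of (g ++ [vcode u]) = next_mem (mem_of g) u.
Proof. intros Hu. unfold mem_of. rewrite fold_left_app. simpl. now rewrite vdecode_vcode. Qed.

Lemma simulator_snoc g u : valid_vertex u ->
  simulator (g ++ [vcode u]) = dirac (vcode (reply (mem_of g) u)).
Proof. intros Hu. unfold simulator. now rewrite removelast_last, last_last, vdecode_vcode. Qed.

Lemma reply_move m u j : vowner u = Some j -> In (reply m u) (moves u).
Proof.
  intros Ho. destruct u; simpl in *; try easy; auto.
  - case (Nat.eqb (loops_left m r) 0); auto.
  - case (time_of m (Execute pc true) b); auto.
  - case (time_of m (Execute pc true) b); auto.
Qed.

Lemma reply_valid m u j : valid_vertex u -> vowner u = Some j -> valid_vertex (reply m u).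
Proof. intros Hu Ho. apply (moves_valid u); auto. eapply reply_move; eauto. Qed.

Lemma simulator_strategy i : is_strategy sim_game i simulator.
Proof.
  intros h v Hv%valid_hist_last Ho. rewrite owner_vdecode in Ho.
  pose proof (reply_valid (mem_of h) (vdecode v) i (vdecode_valid v) Ho) as Hreply.
  rewrite <- (vcode_vdecode_lt v Hv), simulator_snoc by auto. split; [|split].
  - apply dirac_nonneg.
  - intros w ->%dirac_nonzero. apply (next_player (vdecode v) _ i); auto.
    eexists. split; [|reflexivity]. eapply reply_move; eauto.
  - now apply dirac_total, vcode_lt.
Qed.

Lemma simulator_pure i : pure sim_game i simulator.
Proof. intros h v _ _. eexists. intros w'. reflexivity. Qed.

Lemma simulator_finite_state i : finite_state sim_game i simulator.
Proof.
  exists (2 * (N + B + 4))%nat, 0%nat, (fun q v => mem_code (next_mem (mem_decode q) (vdecode v))),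
    (fun q v => dirac (vcode (reply (mem_decode q) (vdecode v)))).
  split; [lia|split].
  - intros q v Hq. pose proof (mem_code_decode q) as Hcode.
    destruct (mem_decode q) as [t|n]; destruct (vdecode v);
      cbn [next_mem loops_left mem_code] in *; lia.
  - intros h v _ _ w. unfold simulator. rewrite removelast_last, last_last.
    replace (mem_decode (fold_left _ h 0%nat)) with (mem_of h); auto.
    unfold mem_of. change (AtPhase 0) with (mem_decode 0). generalize 0%nat as q.
    induction h as [|a h IH]; intros q; auto. simpl. rewrite <- IH, mem_decode_code. easy.
Qed.

Lemma simulator_in_class c i : in_class c sim_game i simulator.
Proof.
  split; [apply simulator_strategy|].
  destruct c; auto using simulator_pure, simulator_finite_state.
Qed.

(** ** States of the simulation *)

Definition follows (m : mem) (u w : vert) : Prop :=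
  match vowner u with None => In w (outcomes u) | Some _ => w = reply m u end.

Definition ahead (W : mem -> vert -> R) (m : mem) (u : vert) : R :=
  match vowner u with
  | None => mean u (W (next_mem m u))
  | Some _ => W (next_mem m u) (reply m u)
  end.

Lemma ahead_final W m u : final u = true -> ahead W m u = W m u.
Proof.
  intros Hf. unfold ahead. now rewrite (final_owner u Hf), (next_mem_final m u Hf), mean_final.
Qed.

Lemma follows_valid m u w : valid_vertex u -> follows m u w -> valid_vertex w.
Proof.
  unfold follows. intros Hu. destruct (vowner u) as [j|] eqn:Ho.
  - intros ->. eapply reply_valid; eauto.
  - now apply outcome_valid.
Qed.

(* The states that occur when only exits are deviated to. *)
Definition on_run (m : mem) (u : vert) : Prop :=
  match u with
  | VCheck ph b j =>
      exists t, m = AtPhase t /\ (t <= S N)%nat /\ ph = phase_at t /\ b = parity t /\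
        (j < 2 * nr)%nat
  | VFork ph b => exists t, m = AtPhase t /\ (t <= S N)%nat /\ ph = phase_at t /\ b = parity t
  | VGuess pc b =>
      exists t, m = AtPhase (S t) /\ (t < N)%nat /\ pc = fst (config t) /\ b = parity (S t)
  | VConfirm pc b =>
      exists t, m = AtPhase (S t) /\ (t < N)%nat /\ pc = fst (config t) /\ b = parity (S t) /\
        branch_at t = true
  | VCoin _ _ r => (r < nr)%nat /\ exists n, m = InGadget n
  | VLoop _ _ r | VStop _ _ r | VPay r _ => (r < nr)%nat
  | _ => True
  end.

Definition harmless (u : vert) : Prop :=
  match u with VExit | VSysCheckers | VSysOpponents => False | _ => True end.

Lemma on_run_valid m u : on_run m u -> valid_vertex u.
Proof.
  destruct u; cbn [on_run valid_vertex]; try easy.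
  - intros (t & _ & Ht & -> & _ & Hj). auto using phase_at_valid.
  - intros (t & _ & Ht & -> & _). apply phase_at_valid.
  - intros (t & _ & Ht & -> & _). auto.
  - intros (t & _ & Ht & -> & _). auto.
Qed.

Lemma on_run_checks t j : (t <= S N)%nat ->
  on_run (AtPhase t) (checks_from (phase_at t) (parity t) j).
Proof.
  intros Ht. unfold checks_from. destruct (Nat.ltb_spec j (2 * nr)); exists t; auto.
Qed.

Lemma on_run_entry t : (t <= N)%nat ->
  on_run (AtPhase (S t)) (entry (fst (config t)) (parity (S t))).
Proof.
  intros Ht. destruct (entry_run t Ht) as [(j & ->)|(Hlt & ->)].
  - apply on_run_checks. lia.
  - now exists t.
Qed.

Lemma on_run_gadget m ph b r : (r < nr)%nat -> on_run m (gadget ph b r).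
Proof.
  intros Hr. now destruct (gadget_cases ph b r) as [(_ & _ & ->)|[->| ->]].
Qed.

Lemma harmless_checks ph b j : harmless (checks_from ph b j).
Proof. unfold checks_from. now destruct (Nat.ltb j (2 * nr)). Qed.

Lemma harmless_gadget ph b r : harmless (gadget ph b r).
Proof. now destruct (gadget_cases ph b r) as [(_ & _ & ->)|[->| ->]]. Qed.

Lemma harmless_entry t : (t <= N)%nat -> harmless (entry (fst (config t)) (parity (S t))).
Proof.
  intros Ht. destruct (entry_run t Ht) as [(j & ->)|(Hlt & ->)]; [apply harmless_checks|easy].
Qed.

Lemma on_run_fork_step t w : (t <= S N)%nat -> In w (outcomes (VFork (phase_at t) (parity t))) ->
  on_run (AtPhase (S t)) w /\ harmless w.
Proof.
  intros Ht [(r & Hr & ->)|[->| ->]]%in_outcomes_VFork.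
  - auto using on_run_gadget, harmless_gadget.
  - now destruct (phase_at t) as [|pc [|]|].
  - destruct (Nat.eq_dec t (S N)) as [->|Hne].
    + now rewrite phase_at_end.
    + rewrite continuation_run by lia. split; [apply on_run_entry|apply harmless_entry]; lia.
Qed.

Lemma on_run_step m u w : on_run m u -> follows m u w ->
  on_run (next_mem m u) w /\ (harmless u -> harmless w).
Proof.
  intros Hon Hw. destruct u; unfold follows in Hw; cbn [vowner] in Hw;
    try (cbn in Hw; repeat destruct Hw as [<-|Hw]; easy); cbn [reply next_mem] in *.
  - simpl in Hon. subst w. destruct (Nat.eqb (loops_left m r) 0); simpl; eauto.
  - destruct Hon as [Hr [n ->]]. destruct Hw as [<-|[<-|[]]]; simpl; auto.
  - destruct Hon as (t & -> & Ht & -> & -> & Hj). subst w.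
    split; [now apply on_run_checks|intros _; apply harmless_checks].
  - destruct Hon as (t & -> & Ht & -> & ->).
    destruct (on_run_fork_step t w Ht Hw) as [Hrun' Hharm]. split; auto.
    replace (Nat.min (S t) (N + 2)) with (S t) by lia. easy.
  - destruct Hon as (t & -> & Ht & -> & ->). subst w. rewrite time_of_branch by auto.
    pose proof (phase_at_S t Ht) as Hph. destruct (branch_at t) eqn:Hbr; cbn [Bool.eqb].
    + split; auto. exists t. auto.
    + rewrite <- Hph. split; [apply on_run_checks; lia|intros _; apply harmless_checks].
  - destruct Hon as (t & -> & Ht & -> & -> & Hbr). subst w.
    rewrite time_of_branch, Hbr by auto. cbn [Bool.eqb]. rewrite <- Hbr, <- phase_at_S by auto.
    split; [apply on_run_checks; lia|intros _; apply harmless_checks].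
  - apply in_outcomes_VFinish in Hw as [->|[(r & Hr & ->)| ->]]; simpl; auto.
Qed.

Inductive absorbed : mem -> vert -> Prop :=
| absorbed_final m u : final u = true -> absorbed m u
| absorbed_step m u : final u = false ->
    (forall w, follows m u w -> absorbed (next_mem m u) w) -> absorbed m u.

Lemma absorbed_VStop m k b r : absorbed m (VStop k b r).
Proof. apply absorbed_step; auto. intros w [<-|[<-|[]]]; now apply absorbed_final. Qed.

Lemma absorbed_VLoop n : forall m k b r, loops_left m r = n -> absorbed m (VLoop k b r).
Proof.
  induction n as [|n IH]; intros m k b r Hn; apply absorbed_step; auto; intros w ->;
    cbn [next_mem reply]; rewrite Hn; simpl.
  - apply absorbed_VStop.
  - apply absorbed_step; auto. intros w [<-|[<-|[]]]; simpl.
    + apply IH. simpl. lia.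
    + now apply absorbed_final.
Qed.

Lemma absorbed_gadget m ph b r : absorbed m (gadget ph b r).
Proof.
  destruct (gadget_cases ph b r) as [(_ & _ & ->)|[->| ->]];
    eauto using absorbed_VStop, absorbed_VLoop.
  apply absorbed_step; auto. intros w [<-|[<-|[]]]; [apply absorbed_VStop|].
  now apply absorbed_final.
Qed.

Lemma absorbed_VFinish m b : absorbed m (VFinish b).
Proof.
  apply absorbed_step; auto.
  intros w [->|[(r & Hr & ->)| ->]]%in_outcomes_VFinish; now apply absorbed_final.
Qed.

Lemma absorbed_checks m ph b : absorbed m (VFork ph b) -> forall d j, (2 * nr - j = d)%nat ->
  absorbed m (checks_from ph b j).
Proof.
  intros Hfork d. induction d as [|d IH]; intros j Hd; unfold checks_from;
    destruct (Nat.ltb_spec j (2 * nr)); auto; try lia.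
  apply absorbed_step; auto. intros w ->. apply IH. lia.
Qed.

Lemma absorbed_entry t : (t <= N)%nat ->
  absorbed (AtPhase (S t)) (VFork (phase_at (S t)) (parity (S t))) ->
  absorbed (AtPhase (S t)) (entry (fst (config t)) (parity (S t))).
Proof.
  intros Ht Hfork. destruct (entry_run t Ht) as [(j & ->)|(Hlt & ->)].
  - now apply (absorbed_checks _ _ _ Hfork _ _ eq_refl).
  - pose proof (absorbed_checks _ _ _ Hfork _ 0%nat eq_refl) as Hchecks.
    rewrite phase_at_S in Hchecks by auto.
    apply absorbed_step; auto. intros w ->. cbn [reply next_mem].
    rewrite time_of_branch by auto. destruct (branch_at t) eqn:Hbr; cbn [Bool.eqb]; auto.
    apply absorbed_step; auto. intros w ->. cbn [reply next_mem].
    rewrite time_of_branch, Hbr by auto. exact Hchecks.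
Qed.

Lemma absorbed_fork d : forall t, (S N - t = d)%nat -> (t <= S N)%nat ->
  absorbed (AtPhase t) (VFork (phase_at t) (parity t)).
Proof.
  induction d as [|d IH]; intros t Hd Ht; apply absorbed_step; auto;
    rewrite next_mem_VFork by auto; intros w [(r & Hr & ->)|[->| ->]]%in_outcomes_VFork;
    auto using absorbed_gadget, absorbed_final, payout_final.
  - assert (t = S N) as -> by lia. rewrite phase_at_end. apply absorbed_VFinish.
  - rewrite continuation_run by lia. apply absorbed_entry; [lia|]. apply IH; lia.
Qed.

Lemma absorbed_init : absorbed (AtPhase 0) (checks_from Loading true 0).
Proof.
  apply absorbed_checks with (2 * nr)%nat; [|lia]. now apply (absorbed_fork (S N) 0); lia.
Qed.

Lemma on_run_init : on_run (AtPhase 0) (checks_from Loading true 0).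
Proof. apply (on_run_checks 0). lia. Qed.

(** ** Values against the strategy *)

Section AgainstSimulator.
Variable P : profile.
Hypothesis HP : strat_profile sim_game P.
Variable i : nat.
Hypothesis Hi : (i <= g_k sim_game)%nat.

Notation hist g u := (valid_hist sim_game (g ++ [vcode u])).
Notation val g u := (value sim_game P i (g ++ [vcode u])).

Lemma step_simulator g u j : valid_vertex u -> vowner u = Some j -> P j = simulator ->
  forall n, step sim_game P (g ++ [vcode u]) n = dirac (vcode (reply (mem_of g) u)) n.
Proof.
  intros Hu Ho Hj n. unfold step. now rewrite last_last, owner_vcode, Ho, Hj, simulator_snoc.
Qed.

Lemma expect_ahead g u (F : nat -> R) W : valid_vertex u ->
  (forall j, vowner u = Some j -> P j = simulator) ->
  (forall w, valid_vertex w -> follows (mem_of g) u w ->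
     F (vcode w) = W (next_mem (mem_of g) u) w) ->
  expect sim_game P (g ++ [vcode u]) F = ahead W (mem_of g) u.
Proof.
  intros Hu HPj HF. unfold ahead, follows in *. destruct (vowner u) as [j|] eqn:Ho.
  - pose proof (reply_valid (mem_of g) u j Hu Ho) as Hreply.
    rewrite (expect_dirac sim_game P _ (vcode (reply (mem_of g) u))); auto.
    intros n. now apply (step_simulator g u j); auto.
  - rewrite (expect_nature P g u F Hu Ho). apply mean_ext. intros w Hw.
    apply HF; auto. now apply (outcome_valid u).
Qed.

Lemma value_exact W : (forall j, (1 <= j)%nat -> P j = simulator) ->
  (forall m u, on_run m u -> final u = true -> W m u = if wins i u then 1 else 0) ->
  (forall m u, on_run m u -> ahead W m u = W m u) ->
  forall m u, absorbed m u -> on_run m u -> forall g, mem_of g = m -> hist g u -> val g u = W m u.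
Proof.
  intros HPj Hfinal Hahead m u Habs.
  induction Habs as [m u Hf|m u Hf _ IH]; intros Hon g Hg Hv;
    pose proof (on_run_valid m u Hon) as Hu.
  - now rewrite val_final, Hfinal.
  - rewrite val_step by auto using wins_nonfinal. rewrite <- Hahead by auto. subst m.
    apply expect_ahead; auto.
    + intros j Ho. apply HPj. now apply (vowner_pos u).
    + intros w Hw Hfollows. apply IH; auto.
      * now apply on_run_step.
      * now apply mem_of_snoc.
      * now apply hist_next.
Qed.

Lemma step_pos_cases g u : (forall j, (1 <= j)%nat -> j <> i -> P j = simulator) ->
  valid_vertex u -> hist g u -> forall n, 0 < step sim_game P (g ++ [vcode u]) n ->
  exists w, valid_vertex w /\ n = vcode w /\
    (follows (mem_of g) u w \/ vowner u = Some i /\ In w (moves u)).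
Proof.
  intros HPj Hu Hv n Hn.
  assert (Hedge : next sim_game (vcode u) n)
    by (apply (step_nonzero_next sim_game sim_game_wf P HP g); auto; lra).
  unfold follows. destruct (vowner u) as [j|] eqn:Ho.
  - destruct (Nat.eq_dec j i) as [->|Hne].
    + apply (next_player u n i Hu Ho) in Hedge as (w & Hin & ->).
      exists w. pose proof (moves_valid u w Hu Hin). auto.
    + assert (Hj : P j = simulator) by (apply HPj; auto; now apply (vowner_pos u)).
      rewrite (step_simulator g u j Hu Ho Hj) in Hn.
      exists (reply (mem_of g) u). split; [now apply (reply_valid _ u j)|].
      split; [apply dirac_nonzero; lra|auto].
  - apply next_nature in Hedge as (w & Hin & ->); auto.
    exists w. pose proof (outcome_valid u w Hu Hin). auto.
Qed.

Lemma value_super (On : mem -> vert -> Prop) (W : mem -> vert -> R) :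
  (forall j, (1 <= j)%nat -> j <> i -> P j = simulator) ->
  (forall m u, On m u -> valid_vertex u) ->
  (forall m u w, On m u -> follows m u w -> On (next_mem m u) w) ->
  (forall m u w, On m u -> vowner u = Some i -> In w (moves u) ->
     On (next_mem m u) w /\ W (next_mem m u) w <= W m u) ->
  (forall m u, On m u -> 0 <= W m u) ->
  (forall m u, On m u -> wins i u = true -> 1 <= W m u) ->
  (forall m u, On m u -> wins i u = false -> ahead W m u <= W m u) ->
  forall g u, On (mem_of g) u -> hist g u -> val g u <= W (mem_of g) u.
Proof.
  intros HPj Hvalid Hfollows Hmoves Hpos Hwin Hahead g u Hon Hv.
  pose (lift := fun (A : Type) (f : mem -> vert -> A) h =>
    f (mem_of (removelast h)) (vdecode (last h 0%nat))).
  assert (Hlift : forall A f h w, valid_vertex w -> lift A f (h ++ [vcode w]) = f (mem_of h) w).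
  { intros A f h w Hw. unfold lift. now rewrite removelast_last, last_last, vdecode_vcode. }
  rewrite <- (Hlift R W) by eauto.
  apply (value_supersolution sim_game sim_game_wf P HP i (lift Prop On) (lift R W)); auto;
    [|now rewrite Hlift by eauto].
  clear g u Hon Hv. intros g v HD Hv. pose proof (valid_hist_last _ _ _ Hv) as Hlt.
  revert HD Hv. rewrite <- (vcode_vdecode_lt v Hlt). generalize (vdecode v) (vdecode_valid v).
  clear v Hlt. intros u Hu HD Hv. rewrite Hlift in HD |- * by auto.
  split; [auto|]. rewrite target_vcode by auto. destruct (wins i u) eqn:Hw; [auto|].
  specialize (Hahead _ _ HD Hw). pose proof (mem_of_snoc g u Hu) as Hmem.
  pose proof (step_pos_cases g u HPj Hu Hv) as Hnext.
  split.
  - intros n _ (w & Hok & -> & Hw')%Hnext. rewrite Hlift, Hmem by auto.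
    destruct Hw' as [Hw'|[Ho Hw']]; [eauto|now apply (Hmoves (mem_of g) u w)].
  - assert (Hown : {vowner u = Some i} + {vowner u <> Some i}) by (repeat decide equality).
    destruct Hown as [Ho|Ho].
    + rewrite <- (expect_const sim_game sim_game_wf P HP g (vcode u) (W (mem_of g) u) Hv).
      apply (expect_le sim_game sim_game_wf P HP); auto.
      intros n _ (w & Hok & -> & Hw')%Hnext. rewrite Hlift, Hmem by auto.
      apply (Hmoves (mem_of g) u w); auto. destruct Hw' as [Hw'|[_ Hw']]; auto.
      unfold follows in Hw'. rewrite Ho in Hw'. subst w. eapply reply_move; eauto.
    + rewrite (expect_ahead g u _ W); auto.
      * intros j Hj. apply HPj; [now apply (vowner_pos u)|congruence].
      * intros w Hok _. now rewrite Hlift, Hmem.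
Qed.

End AgainstSimulator.

(** ** The values of the checkers and opponents *)

Definition phase_value (b0 : bool) (r0 t : nat) : R :=
  if Bool.eqb b0 (parity t) then kappa else promise (weight (regs_at t r0)).

Definition gadget_value (b0 : bool) (r0 : nat) (k : effect) (b : bool) (r : nat) (z : R) : R :=
  if Nat.eqb r r0 then (if Bool.eqb b b0 then rate k * z else 1 - z) else 0.

Definition checker_value (b0 : bool) (r0 : nat) (m : mem) (u : vert) : R :=
  match u with
  | VCheck _ _ _ | VFork _ _ | VGuess _ _ | VConfirm _ _ =>
      match m with AtPhase t => phase_value b0 r0 t | InGadget _ => 0 end
  | VLoop k b r => gadget_value b0 r0 k b r (weight (loops_left m r))
  | VCoin k b r =>
      match m with InGadget n => gadget_value b0 r0 k b r (weight (S n)) | AtPhase _ => 0 end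
  | VStop k b r => gadget_value b0 r0 k b r 1
  | VInput => gadget_value b0 r0 Keep true 0 (weight x)
  | VExit => kappa
  | VFinish b => if Bool.eqb b b0 then 4 * kappa else kappa
  | _ => if pays_checker b0 r0 u then 1 else 0
  end.

Definition side_value (s : side) (b0 : bool) (r0 : nat) (m : mem) (u : vert) : R :=
  match s with
  | Checker => checker_value b0 r0 m u
  | Opponent => 1 - checker_value b0 r0 m u
  end.

Lemma promise_bounds z : 0 <= z <= 1 -> 0 <= promise z <= 1.
Proof.
  intros Hz. unfold promise. pose proof kappa_pos. pose proof kappa_le. rewrite rho_kappa.
  split; nra.
Qed.

Lemma phase_value_bounds b0 r0 t : 0 <= phase_value b0 r0 t <= 1.
Proof.
  unfold phase_value. pose proof kappa_pos. pose proof kappa_le.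
  destruct (Bool.eqb _ _); [lra|]. apply promise_bounds, weight_bounds.
Qed.

Lemma gadget_value_bounds b0 r0 k b r z : 0 <= z <= 1 -> 0 <= gadget_value b0 r0 k b r z <= 1.
Proof.
  intros Hz. unfold gadget_value. pose proof (rate_bounds k).
  destruct (Nat.eqb r r0), (Bool.eqb b b0); try lra. split; nra.
Qed.

Lemma checker_value_bounds b0 r0 m u : 0 <= checker_value b0 r0 m u <= 1.
Proof.
  pose proof kappa_pos. pose proof kappa_le.
  destruct u; cbn [checker_value]; try lra; try (destruct (pays_checker _ _ _); lra);
    try (apply gadget_value_bounds; (lra || apply weight_bounds));
    try (destruct (Bool.eqb _ _); lra); destruct m; try lra; auto using phase_value_bounds.
  apply gadget_value_bounds, weight_bounds.
Qed.

Lemma loops_left_run t r : (t <= S N)%nat -> (r < nr)%nat ->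
  loops_left (AtPhase (S t)) r = regs_at t r.
Proof.
  intros Ht Hr. cbn [loops_left pred]. apply Nat.min_r. unfold regs_at. apply HB; auto. lia.
Qed.

Lemma checker_value_gadget b0 r0 t r : (t <= S N)%nat -> (r < nr)%nat ->
  checker_value b0 r0 (AtPhase (S t)) (gadget (phase_at t) (parity t) r) =
  gadget_value b0 r0 (gadget_effect (phase_at t) r) (parity t) r (weight (regs_at t r)).
Proof.
  intros Ht Hr. pose proof (loops_left_run t r Ht Hr) as Hloops.
  destruct t as [|n].
  - cbn [phase_at gadget gadget_effect].
    change (regs_at 0 r) with (if Nat.eqb r 0 then x else 0%nat).
    now destruct (Nat.eqb_spec r 0) as [->|Hne].
  - destruct (le_lt_dec N n) as [Hge|Hlt].
    + replace n with N by lia. replace n with N in Hloops by lia. rewrite phase_at_end.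
      cbn [gadget gadget_effect checker_value]. now rewrite Hloops.
    + rewrite phase_at_S by auto. cbn [gadget gadget_effect]. unfold branch_at, branch_of.
      destruct (nth_error Q (fst (config n))) as [[r1|r1 j]|] eqn:E; cbn [checker_value].
      * now rewrite Hloops.
      * destruct (Nat.eqb_spec r r1) as [->|Hne]; [|cbn [andb checker_value]; now rewrite Hloops].
        change (regs_at (S n)) with (snd (config n)) in *.
        destruct (snd (config n) r1) as [|a]; cbn [negb Nat.eqb andb checker_value]; auto.
        now rewrite Hloops.
      * now rewrite Hloops.
Qed.

Lemma checker_value_checks b0 r0 t ph b j :
  checker_value b0 r0 (AtPhase t) (checks_from ph b j) = phase_value b0 r0 t.
Proof. unfold checks_from. now destruct (Nat.ltb j (2 * nr)). Qed.

Lemma checker_value_entry b0 r0 t : (t <= N)%nat ->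
  checker_value b0 r0 (AtPhase (S t)) (entry (fst (config t)) (parity (S t))) =
  phase_value b0 r0 (S t).
Proof.
  intros Ht. destruct (entry_run t Ht) as [(j & ->)|(Hlt & ->)]; auto.
  apply checker_value_checks.
Qed.

Lemma phase_value_step b0 r0 t : (t <= S N)%nat -> (r0 < nr)%nat ->
  rho * gadget_value b0 r0 (gadget_effect (phase_at t) r0) (parity t) r0 (weight (regs_at t r0)) +
  1 / 4 * checker_value b0 r0 (AtPhase (S t)) (continuation (phase_at t) (parity t)) =
  phase_value b0 r0 t.
Proof.
  intros Ht Hr. unfold gadget_value, phase_value. rewrite Nat.eqb_refl.
  destruct (Nat.eq_dec t (S N)) as [->|Hne].
  - rewrite phase_at_end. cbn [continuation gadget_effect checker_value]. unfold rate, promise.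
    simpl INR. destruct b0, (parity (S N)); cbn [Bool.eqb]; lra.
  - rewrite continuation_run, checker_value_entry by lia. unfold phase_value.
    rewrite parity_S, weight_regs_next by lia. unfold promise. rewrite rho_kappa.
    destruct b0, (parity t); cbn [Bool.eqb negb]; lra.
Qed.

Lemma checker_value_ahead_fork b0 r0 t : (r0 < nr)%nat -> (t <= S N)%nat ->
  ahead (checker_value b0 r0) (AtPhase t) (VFork (phase_at t) (parity t)) = phase_value b0 r0 t.
Proof.
  intros Hr Ht. unfold ahead. cbn [vowner]. rewrite next_mem_VFork, mean_VFork by auto.
  rewrite (lsum_seq_single nr r0); auto.
  - rewrite checker_value_gadget by auto.
    replace (checker_value b0 r0 (AtPhase (S t)) (payout (phase_at t))) with 0
      by now destruct (phase_at t) as [|pc [|]|].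
    rewrite <- phase_value_step by auto. lra.
  - intros r Hr' Hne. rewrite checker_value_gadget by auto.
    unfold gadget_value. apply Nat.eqb_neq in Hne. now rewrite Hne.
Qed.

Lemma checker_value_ahead b0 r0 m u : (r0 < nr)%nat -> on_run m u ->
  ahead (checker_value b0 r0) m u = checker_value b0 r0 m u.
Proof.
  intros Hr Hon. destruct u; try (now apply ahead_final);
    try (unfold ahead; cbn [vowner next_mem reply checker_value]).
  - rewrite mean_VInput. cbn [checker_value pays_checker]. unfold gadget_value, rate.
    simpl INR. destruct (Nat.eqb 0 r0), b0; cbn [Bool.eqb andb]; lra.
  - rewrite mean_VStop. cbn [checker_value pays_checker]. unfold gadget_value.
    destruct (Nat.eqb r r0), b, b0; cbn [Bool.eqb andb]; lra.
  - destruct (Nat.eqb_spec (loops_left m r) 0) as [->|E]; cbn [checker_value]; auto.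
    do 2 f_equal. lia.
  - destruct Hon as [_ [n ->]]. rewrite mean_VCoin. cbn [checker_value pays_checker loops_left].
    unfold gadget_value. rewrite weight_S.
    destruct (Nat.eqb r r0), b, b0; cbn [Bool.eqb andb negb]; lra.
  - destruct Hon as (t & -> & _). apply checker_value_checks.
  - destruct Hon as (t & -> & Ht & -> & ->). now apply checker_value_ahead_fork.
  - destruct Hon as (t & -> & _). destruct (time_of _ _ _); [easy|apply checker_value_checks].
  - destruct Hon as (t & -> & Ht & -> & -> & Hbr). rewrite time_of_branch, Hbr by auto.
    apply checker_value_checks.
  - rewrite mean_VFinish. cbn [checker_value pays_checker].
    rewrite (lsum_seq_single nr r0); auto.
    + rewrite Nat.eqb_refl. destruct b, b0; cbn [Bool.eqb andb]; lra.
    + intros r _ Hne. apply Nat.eqb_neq in Hne. now rewrite Hne.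
  - rewrite mean_VExit. cbn [checker_value pays_checker]. lra.
Qed.

Lemma side_value_final s b0 r0 m u : (r0 < nr)%nat -> final u = true ->
  side_value s b0 r0 m u = if wins (member s b0 r0) u then 1 else 0.
Proof.
  intros Hr Hf. rewrite wins_member by auto. unfold side_value, pays. rewrite Hf.
  replace (checker_value b0 r0 m u) with (if pays_checker b0 r0 u then 1 else 0)
    by now destruct u.
  destruct s, (pays_checker b0 r0 u); simpl; lra.
Qed.

Lemma side_value_ahead s b0 r0 m u : (r0 < nr)%nat -> on_run m u ->
  ahead (side_value s b0 r0) m u = side_value s b0 r0 m u.
Proof.
  intros Hr Hon. pose proof (checker_value_ahead b0 r0 m u Hr Hon) as H.
  destruct s; auto. cbn [side_value]. rewrite <- H. unfold ahead.
  destruct (vowner u) eqn:Ho; auto. cbn [side_value].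
  rewrite <- (mean_const u 1 Ho) at 1.
  replace (mean u (fun _ => 1) - mean u (checker_value b0 r0 (next_mem m u))) with
    (mean u (fun _ => 1) + -1 * mean u (checker_value b0 r0 (next_mem m u))) by lra.
  rewrite <- mean_scal, <- mean_plus. apply mean_ext. intros w _. unfold side_value. lra.
Qed.

Lemma vowner_member u s b r : valid_vertex u -> (r < nr)%nat ->
  vowner u = Some (member s b r) -> exists ph j, u = VCheck ph b j.
Proof.
  intros Hu Hr Ho. destruct u; try easy; unfold member in Ho; cbn [vowner] in Ho;
    injection Ho as Ho; try lia.
  assert (b0 = b) as ->; [|eauto].
  destruct Hu as [_ Hj]. destruct b0, b, s; cbn [side_index] in Ho; auto; lia.
Qed.

Lemma side_value_move s b r m u w : (r < nr)%nat -> on_run m u ->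
  vowner u = Some (member s b r) -> In w (moves u) ->
  on_run (next_mem m u) w /\ side_value s b r (next_mem m u) w <= side_value s b r m u.
Proof.
  intros Hr Hon Ho Hw.
  destruct (vowner_member u s b r (on_run_valid m u Hon) Hr Ho) as (ph & j & ->).
  destruct Hon as (t & -> & Ht & -> & -> & Hj). cbn [next_mem]. unfold side_value.
  destruct Hw as [<-|[<-|[]]].
  - split; [now apply on_run_checks|]. rewrite checker_value_checks. destruct s; simpl; lra.
  - split; [easy|]. cbn [checker_value]. unfold phase_value. rewrite eqb_reflx.
    destruct s; lra.
Qed.

(** ** The value of the guesser *)

Definition guess_gain (ph : phase) : R := match ph with Execute _ true => 5 / 8 | _ => 0 end.

Fixpoint guess_value_for (d t : nat) : R :=
  match d with
  | O => 0
  | S d' => guess_gain (phase_at t) + 1 / 4 * guess_value_for d' (S t)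
  end.

Definition guess_value (t : nat) : R := guess_value_for (S N - t) t.

Definition guesser_phase_value (m : mem) (ph : phase) (b : bool) : R :=
  match time_of m ph b with
  | Some t => guess_value t
  | None => match ph with Execute _ false => 3 / 8 | _ => 1 end
  end.

(* Off the simulated run, the trivial bound 1 is enough, except that entering a zero branch
   is worth at most [3 / 8] to player 2, and nothing if player 1 punishes. *)
Definition guesser_value (m : mem) (u : vert) : R :=
  match u with
  | VCheck ph b _ | VFork ph b => guesser_phase_value m ph b
  | VGuess pc b =>
      match time_of m (Execute pc true) b, time_of m (Execute pc false) b with
      | Some t, _ | None, Some t => guess_value t
      | None, None => 1
      end
  | VConfirm pc b =>
      match time_of m (Execute pc true) b with Some t => guess_value t | None => 0 end
  | VGuesser => 1
  | _ => 0
  end.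

Lemma guess_value_bounds t : 0 <= guess_value t <= 1.
Proof.
  unfold guess_value. generalize (S N - t)%nat as d. intros d. revert t.
  induction d as [|d IH]; intros t; simpl guess_value_for; [lra|].
  specialize (IH (S t)). destruct (phase_at t) as [|pc [|]|]; simpl; lra.
Qed.

Lemma guess_value_step t : (t <= N)%nat ->
  guess_value t = guess_gain (phase_at t) + 1 / 4 * guess_value (S t).
Proof.
  intros Ht. unfold guess_value. replace (S N - t)%nat with (S (S N - S t)) by lia. reflexivity.
Qed.

Lemma guess_value_end : guess_value (S N) = 0.
Proof. unfold guess_value. now rewrite Nat.sub_diag. Qed.

Lemma guesser_value_bounds m u : 0 <= guesser_value m u <= 1.
Proof.
  pose proof guess_value_bounds as Hb.
  destruct u; cbn [guesser_value]; unfold guesser_phase_value; try lra;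
    repeat (destruct (time_of _ _ _); auto); try lra; destruct ph as [|pc [|]|]; lra.
Qed.

Lemma guesser_value_checks m ph b j :
  guesser_value m (checks_from ph b j) = guesser_phase_value m ph b.
Proof. unfold checks_from. now destruct (Nat.ltb j (2 * nr)). Qed.

Lemma guesser_phase_value_run t : (t <= S N)%nat ->
  guesser_phase_value (AtPhase t) (phase_at t) (parity t) = guess_value t.
Proof. intros Ht. unfold guesser_phase_value. now rewrite time_of_run. Qed.

Lemma guesser_value_guess t : (t < N)%nat ->
  guesser_value (AtPhase (S t)) (VGuess (fst (config t)) (parity (S t))) = guess_value (S t).
Proof.
  intros Ht. cbn [guesser_value]. rewrite !time_of_branch by auto. now destruct (branch_at t).
Qed.

Lemma guesser_value_gadget m ph b r : guesser_value m (gadget ph b r) = 0.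
Proof. now destruct (gadget_cases ph b r) as [(_ & _ & ->)|[->| ->]]. Qed.

Lemma guesser_value_payout m ph : 5 / 8 * guesser_value m (payout ph) = guess_gain ph.
Proof. destruct ph as [|pc [|]|]; simpl; lra. Qed.

Lemma guesser_value_ahead_fork m ph b :
  ahead guesser_value m (VFork ph b) =
  guess_gain ph + 1 / 4 * guesser_value (next_mem m (VFork ph b)) (continuation ph b).
Proof.
  unfold ahead. cbn [vowner].
  rewrite mean_VFork, guesser_value_payout, lsum_zero by (intros; apply guesser_value_gadget).
  lra.
Qed.

Lemma guesser_value_ahead_run t : (t <= S N)%nat ->
  ahead guesser_value (AtPhase t) (VFork (phase_at t) (parity t)) = guess_value t.
Proof.
  intros Ht. rewrite guesser_value_ahead_fork, next_mem_VFork by auto.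
  destruct (Nat.eq_dec t (S N)) as [->|Hne].
  - rewrite guess_value_end, phase_at_end. simpl. lra.
  - rewrite continuation_run, (guess_value_step t) by lia. do 2 f_equal.
    destruct (entry_run t ltac:(lia)) as [(j & ->)|(Hlt & ->)].
    + rewrite guesser_value_checks. apply guesser_phase_value_run. lia.
    + now apply guesser_value_guess.
Qed.

Lemma guesser_value_ahead_nature m u : vowner u = None -> final u = false ->
  match u with VFork _ _ => False | _ => True end -> ahead guesser_value m u = 0.
Proof.
  intros Ho Hf Hu. unfold ahead. rewrite Ho. apply mean_zero; auto. intros w Hw.
  destruct u; try easy; try (repeat destruct Hw as [<-|Hw]; easy).
  now apply in_outcomes_VFinish in Hw as [->|[(r & Hr & ->)| ->]].
Qed.

Lemma guesser_value_ahead m u : on_run m u -> ahead guesser_value m u = guesser_value m u.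
Proof.
  intros Hon. destruct u; try (now apply ahead_final); try (now apply guesser_value_ahead_nature);
    [| |destruct Hon as (t & -> & Ht & -> & ->); cbn [guesser_value];
        now rewrite guesser_value_ahead_run, guesser_phase_value_run| |];
    unfold ahead; cbn [vowner next_mem reply].
  - now destruct (Nat.eqb (loops_left m r) 0).
  - apply guesser_value_checks.
  - destruct Hon as (t & -> & Ht & -> & ->). rewrite guesser_value_guess by auto.
    rewrite time_of_branch by auto. pose proof (phase_at_S t Ht) as Hph.
    destruct (branch_at t) eqn:Hbr; cbn [Bool.eqb].
    + cbn [guesser_value]. now rewrite time_of_branch, Hbr.
    + rewrite guesser_value_checks, <- Hph. apply guesser_phase_value_run. lia.
  - destruct Hon as (t & -> & Ht & -> & -> & Hbr). cbn [guesser_value].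
    rewrite time_of_branch, Hbr by auto. cbn [Bool.eqb].
    rewrite guesser_value_checks, <- Hbr, <- phase_at_S by auto.
    apply guesser_phase_value_run. lia.
Qed.

Lemma guesser_value_move m pc b w : In w (moves (VGuess pc b)) ->
  guesser_value m w <= guesser_value m (VGuess pc b).
Proof.
  intros Hw. cbn [guesser_value]. destruct (time_of m (Execute pc true) b) as [t|] eqn:Et.
  - pose proof (time_of_Some _ _ _ _ Et) as (-> & Hph & -> & Ht).
    destruct Hw as [<-|[<-|[]]]; [|cbn [guesser_value]; rewrite Et; lra].
    rewrite guesser_value_checks. unfold guesser_phase_value.
    destruct (time_of (AtPhase t) (Execute pc false) (parity t)) as [t'|] eqn:Ef.
    + apply time_of_Some in Ef as ([= <-] & Hph' & _). congruence.
    + assert (t <> S N) by (intros ->; now rewrite phase_at_end in Hph).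
      rewrite guess_value_step, <- Hph by lia. pose proof (guess_value_bounds (S t)). simpl. lra.
  - destruct Hw as [<-|[<-|[]]].
    + rewrite guesser_value_checks. unfold guesser_phase_value.
      destruct (time_of m (Execute pc false) b); lra.
    + cbn [guesser_value]. rewrite Et. pose proof guess_value_bounds as Hb.
      destruct (time_of m (Execute pc false) b); [apply Hb|lra].
Qed.

Lemma guesser_value_ahead_fork_le m ph b :
  ahead guesser_value m (VFork ph b) <= guesser_value m (VFork ph b).
Proof.
  cbn [guesser_value]. unfold guesser_phase_value. destruct (time_of m ph b) as [t|] eqn:E.
  - apply time_of_Some in E as (-> & -> & -> & Ht). right. now apply guesser_value_ahead_run.
  - rewrite guesser_value_ahead_fork.
    pose proof (guesser_value_bounds (next_mem m (VFork ph b)) (continuation ph b)).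
    destruct ph as [|pc [|]|]; cbn [guess_gain]; lra.
Qed.

Lemma guesser_value_ahead_le m u : wins 2 u = false -> ahead guesser_value m u <= guesser_value m u.
Proof.
  intros Hw. destruct u; try (now right; apply ahead_final);
    try (now right; apply guesser_value_ahead_nature);
    [| |apply guesser_value_ahead_fork_le| |]; unfold ahead; cbn [vowner next_mem reply].
  - destruct (Nat.eqb (loops_left m r) 0); simpl; lra.
  - right. apply guesser_value_checks.
  - apply guesser_value_move. now apply (reply_move m (VGuess pc b) 2).
  - destruct (time_of m (Execute pc true) b) as [t|] eqn:E; cbn [guesser_value]; rewrite E.
    + rewrite guesser_value_checks. unfold guesser_phase_value. rewrite E. lra.
    + lra.
Qed.

(** ** The equilibrium *)

Lemma player_cases i : (1 <= i <= g_k sim_game)%nat ->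
  i = 1%nat \/ i = 2%nat \/ exists s b r, (r < nr)%nat /\ i = member s b r.
Proof.
  cbn [g_k sim_game]. intros Hi. destruct i as [|[|[|j]]]; auto; [lia|]. right; right.
  destruct (le_lt_dec (2 * nr) j) as [Hge|Hlt].
  - pose proof (member_of_nat (j - 2 * nr)) as Hj.
    exists (side_of_nat (j - 2 * nr)), false, (Nat.div2 (j - 2 * nr)).
    unfold member. rewrite <- Hj. lia.
  - pose proof (member_of_nat j) as Hj. exists (side_of_nat j), true, (Nat.div2 j).
    unfold member. rewrite <- Hj. lia.
Qed.

Section Equilibrium.
Variable c : sclass.
Variable s0 : strategy.
Hypothesis Hs0 : in_class c sim_game 0 s0.

Notation P := (update (fun _ => simulator) 0 s0).
Notation init := [vcode (checks_from Loading true 0)].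

Lemma equilibrium_strat_profile : strat_profile sim_game P.
Proof. apply strat_profile_update; [|apply Hs0]. intros j _. apply simulator_strategy. Qed.

Lemma equilibrium_simulator j : (1 <= j)%nat -> P j = simulator.
Proof. intros Hj. unfold update. now destruct (Nat.eqb_spec j 0); [lia|]. Qed.

Lemma deviation_simulator i t j : (1 <= j)%nat -> j <> i -> update P i t j = simulator.
Proof.
  intros Hj Hne. unfold update at 1. apply Nat.eqb_neq in Hne. rewrite Hne.
  now apply equilibrium_simulator.
Qed.

Lemma hist_init : valid_hist sim_game ([] ++ init).
Proof. apply (valid_hist_init sim_game sim_game_wf). Qed.

Local Hint Resolve equilibrium_strat_profile equilibrium_simulator deviation_simulator hist_init
  on_run_valid on_run_init : core.

Lemma idle_player_payoff P' : strat_profile sim_game P' -> value sim_game P' 1 init = 0.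
Proof.
  intros HP'. apply (value_avoiding sim_game sim_game_wf P' HP' 1
    (fun n => (n < g_nV sim_game)%nat)) with (g := []); auto.
  - intros n Hn. apply target_vdecode; auto. cbn [g_k sim_game]. lia.
  - intros v w Hv _ Hn. now apply (next_lt sim_game sim_game_wf v).
Qed.

Lemma guesser_payoff_le t : strat_profile sim_game (update P 2 t) ->
  value sim_game (update P 2 t) 2 init <= value sim_game P 2 init.
Proof.
  intros HP'. change init with ([] ++ init).
  rewrite (value_exact P equilibrium_strat_profile 2 guesser_le guesser_value)
    with (m := AtPhase 0); auto using guesser_value_ahead, absorbed_init.
  - apply (value_super _ HP' 2 guesser_le (fun _ u => valid_vertex u) guesser_value); auto.
    + intros m u w. apply follows_valid.
    + intros m u w Hu Ho Hw. split; [now apply (moves_valid u)|].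
      destruct u; try easy. now apply guesser_value_move.
    + intros m u _. apply guesser_value_bounds.
    + intros m u _ Hw. now destruct u.
    + intros m u _. apply guesser_value_ahead_le.
  - intros m u _ Hf. now destruct u.
Qed.

Lemma side_payoff_le s b r t : (r < nr)%nat ->
  strat_profile sim_game (update P (member s b r) t) ->
  value sim_game (update P (member s b r) t) (member s b r) init <=
  value sim_game P (member s b r) init.
Proof.
  intros Hr HP'. pose proof (member_le s b r Hr) as Hi. change init with ([] ++ init).
  rewrite (value_exact P equilibrium_strat_profile _ Hi (side_value s b r)) with (m := AtPhase 0);
    auto using side_value_ahead, side_value_final, absorbed_init.
  apply (value_super _ HP' _ Hi on_run (side_value s b r)); auto.
  - apply on_run_valid.
  - intros m u w. apply on_run_step.
  - intros m u w. now apply side_value_move.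
  - intros m u _. pose proof (checker_value_bounds b r m u). destruct s; simpl; lra.
  - intros m u _ Hw. rewrite side_value_final, Hw by eauto using wins_final. lra.
  - intros m u Hon _. right. now apply side_value_ahead.
Qed.

Lemma simulator_NE : is_NE0 c sim_game P.
Proof.
  intros i Hi t Ht.
  assert (HP' : strat_profile sim_game (update P i t))
    by (apply strat_profile_update; [auto|apply Ht]).
  rewrite !Pay_value by auto.
  change (value sim_game (update P i t) i init <= value sim_game P i init).
  destruct (player_cases i Hi) as [->|[->|(s & b & r & Hr & ->)]].
  - rewrite !idle_player_payoff by auto. lra.
  - now apply guesser_payoff_le.
  - now apply side_payoff_le.
Qed.

Lemma simulator_system_payoff : Pay sim_game P 0 = Finite 0.
Proof.
  rewrite Pay_value by auto. f_equal. change (value sim_game P 0 ([] ++ init) = 0).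
  apply Rle_antisym; [|apply (value_bounds sim_game sim_game_wf P); auto].
  apply (value_super P equilibrium_strat_profile 0 (Nat.le_0_l _)
    (fun m u => on_run m u /\ harmless u) (fun _ _ => 0)); auto.
  - intros m u [Hon _]. eauto.
  - intros m u w [Hon Hh] Hw. destruct (on_run_step m u w Hon Hw). auto.
  - intros m u w _ Ho%vowner_pos. lia.
  - intros; lra.
  - intros m u [_ Hh] Hw. now destruct u.
  - intros m u _ _. unfold ahead. destruct (vowner u) eqn:Ho; [lra|].
    rewrite mean_const by auto. lra.
  - split; [auto|apply harmless_checks].
Qed.

End Equilibrium.
End AcceptingRun.

(** * The answer for the game *)

Lemma accepting_run_not_NCRSP c n :
  fst (mrun Q n (init_state x)) = S (length Q) -> ~ NCRSP_gt c sim_game 0.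
Proof.
  intros Hn (s0 & Hs0 & Hall).
  destruct (halting_time_least Q (init_state x) n) as (N & Hge & HN & Hrun); [lia|].
  assert (Hend : fst (mrun Q N (init_state x)) = S (length Q))
    by (rewrite <- Hn; f_equal; symmetry; now apply mrun_halted).
  destruct (bounded_on_rectangle (fun m => snd (mrun Q m (init_state x))) N nr) as [B HB].
  specialize (Hall (fun _ => simulator N B) ltac:(intros; now apply simulator_in_class)
    (simulator_NE N B Hrun Hend HB c s0 Hs0)).
  rewrite (simulator_system_payoff N B Hrun Hend c s0 Hs0) in Hall. simpl in Hall. lra.
Qed.

Lemma system_owns_no_vertex v : owner sim_game v <> Some 0%nat.
Proof. rewrite owner_vdecode. intros H%vowner_pos. lia. Qed.

Lemma system_strategy_in_class c s : in_class c sim_game 0 s.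
Proof.
  assert (Hno : forall v, owner sim_game v = Some 0%nat -> False) by apply system_owns_no_vertex.
  assert (Hpure : pure sim_game 0 s) by (intros h v _ Ho; now apply Hno in Ho).
  assert (Hfinite : finite_state sim_game 0 s).
  { exists 1%nat, 0%nat, (fun _ _ => 0%nat), (fun _ _ _ => 0). repeat split; auto.
    intros h v _ Ho. now apply Hno in Ho. }
  split; [intros h v _ Ho; now apply Hno in Ho|]. destruct c; auto.
Qed.

Lemma rejecting_run_NCRSP c n : (forall i, In i Q -> (instr_reg i < nr)%nat) ->
  (0 < length Q)%nat -> fst (mrun Q n (init_state x)) = length Q -> NCRSP_gt c sim_game 0.
Proof.
  intros Hregs Hlen Hn. exists (fun _ _ => 0). split; [apply system_strategy_in_class|].
  intros env Henv HNE. set (p := update env 0 (fun _ _ => 0)) in *.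
  assert (Hclass : forall i, (i <= g_k sim_game)%nat -> in_class c sim_game i (p i)).
  { intros i Hi. unfold p, update. destruct (Nat.eqb_spec i 0) as [->|];
      [apply system_strategy_in_class|apply Henv; lia]. }
  assert (Hp : strat_profile sim_game p) by (intros i Hi; now apply Hclass).
  rewrite Pay_value by auto. cbn [Rbar_lt].
  pose proof (value_bounds sim_game sim_game_wf p Hp 0 [] _ (valid_hist_init _ sim_game_wf)) as Hb.
  destruct (Rle_lt_or_eq_dec _ _ (proj1 Hb)) as [Hpos|Hzero]; auto. exfalso.
  apply (rejecting_run_absurd Hregs c p Hp) with n; auto. intros i Hi. apply Hclass. lia.
Qed.

End Reduction.

Lemma probability_VInput_row Q nr x : map (probability Q nr x VInput) (vertices Q nr) =
  (0, 1)%nat :: (1, 2 ^ x)%nat :: (2 ^ x - 1, 2 ^ x)%nat ::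
  map (fun _ => (0, 1)%nat) (ordinary_vertices Q nr).
Proof.
  pose proof (pow2_pos x) as Hpos. rewrite vertices_eq. cbn [map].
  apply f_equal2; [easy|]. apply f_equal2; [easy|]. apply f_equal2.
  - unfold probability, numerator. cbn [lottery denominator map fst snd].
    destruct (vert_eq_dec (VStop Keep true 0) (VPay 0 false)) as [|_]; [easy|].
    destruct (vert_eq_dec (VPay 0 false) (VPay 0 false)) as [_|]; [|easy].
    cbn [list_sum fold_right]. rewrite Nat.add_0_l, Nat.add_0_r.
    destruct (Nat.eqb_spec (2 ^ x - 1) 0) as [E|]; auto. rewrite E. f_equal. lia.
  - apply map_ext_in. intros v Hv. apply filter_In in Hv as [_ Hv].
    unfold probability, numerator. cbn [lottery map fst snd].
    destruct (vert_eq_dec (VStop Keep true 0) v) as [<-|]; [easy|].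
    destruct (vert_eq_dec (VPay 0 false) v) as [<-|]; easy.
Qed.

Lemma ordinary_vertex_neq Q nr v : In v (ordinary_vertices Q nr) -> v <> VInput.
Proof. intros [_ Hv]%filter_In ->. easy. Qed.

Lemma probability_independent Q nr x x' v w : v <> VInput ->
  probability Q nr x v w = probability Q nr x' v w.
Proof. intros H. now destruct v. Qed.

Lemma sim_game_prob Q nr x : g_prob (sim_game Q nr x) =
  ((0, 1)%nat :: (1, 2 ^ x)%nat :: (2 ^ x - 1, 2 ^ x)%nat ::
     map (fun _ => (0, 1)%nat) (ordinary_vertices Q nr)) ::
  map (fun v => map (probability Q nr 0 v) (vertices Q nr))
    (VStop Keep true 0 :: VPay 0 false :: ordinary_vertices Q nr).
Proof.
  transitivity (map (fun v => map (probability Q nr x v) (vertices Q nr))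
    (VInput :: VStop Keep true 0 :: VPay 0 false :: ordinary_vertices Q nr)); [easy|].
  cbn [map]. rewrite probability_VInput_row.
  apply f_equal2; [easy|]. apply f_equal2; [|apply f_equal2].
  - apply map_ext. intros w. now apply probability_independent.
  - apply map_ext. intros w. now apply probability_independent.
  - apply map_ext_in. intros v Hv%ordinary_vertex_neq. apply map_ext. intros w.
    now apply probability_independent.
Qed.

(** * Structured programs *)

Close Scope R_scope.

Inductive cmd : Type :=
| CInc (r : nat)
| CDec (r : nat)
| CSeq (c1 c2 : cmd)
| CWhile (r : nat) (c : cmd)
| CIf (r : nat) (c1 c2 : cmd).

Inductive exec : cmd -> (nat -> nat) -> (nat -> nat) -> Prop :=
| exec_inc r s : exec (CInc r) s (set_reg s r (S (s r)))
| exec_dec r s : exec (CDec r) s (set_reg s r (pred (s r)))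
| exec_seq c1 c2 s s1 s2 : exec c1 s s1 -> exec c2 s1 s2 -> exec (CSeq c1 c2) s s2
| exec_while_stop r c s : s r = 0 -> exec (CWhile r c) s s
| exec_while_loop r c s s1 s2 : s r <> 0 -> exec c s s1 -> exec (CWhile r c) s1 s2 ->
    exec (CWhile r c) s s2
| exec_if_nonzero r c1 c2 s s1 : s r <> 0 -> exec c1 s s1 -> exec (CIf r c1 c2) s s1
| exec_if_zero r c1 c2 s s1 : s r = 0 -> exec c2 s s1 -> exec (CIf r c1 c2) s s1.

Fixpoint code_length (c : cmd) : nat :=
  match c with
  | CInc _ | CDec _ => 1
  | CSeq c1 c2 => code_length c1 + code_length c2
  | CWhile _ c => code_length c + 3
  | CIf _ c1 c2 => code_length c1 + code_length c2 + 3
  end.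

(* Register [z] must be zero: [DEC z j] is then an unconditional jump to [j].  A nonzero test
   decrements its register, hence the [INC r] that follows it. *)
Fixpoint compile (z o : nat) (c : cmd) : program :=
  match c with
  | CInc r => [INC r]
  | CDec r => [DEC r (S o)]
  | CSeq c1 c2 => compile z o c1 ++ compile z (o + code_length c1) c2
  | CWhile r c =>
      [DEC r (o + (code_length c + 3)); INC r] ++ compile z (o + 2) c ++ [DEC z o]
  | CIf r c1 c2 =>
      [DEC r (o + code_length c1 + 3); INC r] ++ compile z (o + 2) c1 ++
      [DEC z (o + (code_length c1 + code_length c2 + 3))] ++ compile z (o + code_length c1 + 3) c2
  end.

Lemma length_compile z c : forall o, length (compile z o c) = code_length c.
Proof.
  induction c; intros o; simpl; auto; rewrite ?length_app; simpl; rewrite ?length_app;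
    rewrite ?IHc, ?IHc1, ?IHc2; simpl; rewrite ?IHc2; lia.
Qed.

Fixpoint avoids (z : nat) (c : cmd) : Prop :=
  match c with
  | CInc r | CDec r => r <> z
  | CSeq c1 c2 => avoids z c1 /\ avoids z c2
  | CWhile r c => r <> z /\ avoids z c
  | CIf r c1 c2 => r <> z /\ avoids z c1 /\ avoids z c2
  end.

Lemma set_reg_same s r v : set_reg s r v r = v.
Proof. unfold set_reg. now rewrite Nat.eqb_refl. Qed.

Lemma set_reg_other s r v q : q <> r -> set_reg s r v q = s q.
Proof. intros H. unfold set_reg. now apply Nat.eqb_neq in H as ->. Qed.

Lemma set_reg_id s r : set_reg s r (s r) = s.
Proof.
  apply functional_extensionality. intros q. unfold set_reg.
  destruct (Nat.eqb_spec q r); congruence.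
Qed.

Lemma set_reg_twice s r v w : set_reg (set_reg s r v) r w = set_reg s r w.
Proof.
  apply functional_extensionality. intros q. unfold set_reg. now destruct (Nat.eqb_spec q r).
Qed.

Lemma exec_avoids z c s s' : exec c s s' -> avoids z c -> s' z = s z.
Proof.
  induction 1 as [r s|r s|c1 c2 s s1 s2 _ IH1 _ IH2|r c s Hr|r c s s1 s2 _ _ IH1 _ IH2
    |r c1 c2 s s1 _ _ IH|r c1 c2 s s1 _ _ IH]; simpl; intros Ha; auto;
    try (apply set_reg_other; congruence).
  - rewrite IH2, IH1; tauto.
  - rewrite IH2, IH1; simpl; tauto.
  - tauto.
  - tauto.
Qed.

Definition code_at (P : program) (o : nat) (l : program) : Prop :=
  exists pre post, P = pre ++ l ++ post /\ length pre = o.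

Lemma code_at_app P o l1 l2 : code_at P o (l1 ++ l2) ->
  code_at P o l1 /\ code_at P (o + length l1) l2.
Proof.
  intros (pre & post & -> & <-). split.
  - exists pre, (l2 ++ post). now rewrite <- app_assoc.
  - exists (pre ++ l1), post. rewrite <- !app_assoc. split; auto. now rewrite length_app.
Qed.

Lemma code_at_nth P o l i a : code_at P o l -> nth_error l i = Some a ->
  nth_error P (o + i) = Some a.
Proof.
  intros (pre & post & -> & <-) Ha. pose proof (nth_error_lt l i a Ha).
  rewrite nth_error_app2, nth_error_app1 by lia. rewrite <- Ha. f_equal. lia.
Qed.

Lemma code_at_head P o a l : code_at P o (a :: l) -> nth_error P o = Some a.
Proof.
  intros H. rewrite <- (Nat.add_0_r o). now apply (code_at_nth P o (a :: l)).
Qed.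

Lemma code_at_while P z o r c : code_at P o (compile z o (CWhile r c)) ->
  code_at P o [DEC r (o + (code_length c + 3)); INC r] /\
  code_at P (o + 2) (compile z (o + 2) c) /\
  code_at P (o + 2 + code_length c) [DEC z o].
Proof.
  intros [Htest Hrest]%code_at_app. split; [easy|].
  apply code_at_app in Hrest. now rewrite length_compile in Hrest.
Qed.

Lemma code_at_if P z o r c1 c2 : code_at P o (compile z o (CIf r c1 c2)) ->
  code_at P o [DEC r (o + code_length c1 + 3); INC r] /\
  code_at P (o + 2) (compile z (o + 2) c1) /\
  code_at P (o + 2 + code_length c1) [DEC z (o + (code_length c1 + code_length c2 + 3))] /\
  code_at P (o + code_length c1 + 3) (compile z (o + code_length c1 + 3) c2).
Proof.
  intros [Htest Hrest]%code_at_app. split; [easy|].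
  apply code_at_app in Hrest as [Hthen Hrest]. split; [easy|].
  apply code_at_app in Hrest as [Hjump Helse]. rewrite length_compile in *. simpl length in *.
  split; [easy|].
  now replace (o + code_length c1 + 3) with (o + 2 + code_length c1 + 1) at 1 by lia.
Qed.

Definition steps (P : program) (s s' : mstate) : Prop := exists n, mrun P n s = s'.

Lemma steps_refl P s : steps P s s.
Proof. now exists 0. Qed.

Lemma steps_trans P s1 s2 s3 : steps P s1 s2 -> steps P s2 s3 -> steps P s1 s3.
Proof.
  intros [n Hn] [m Hm]. exists (n + m). revert s1 Hn.
  induction n as [|n IH]; intros s1 Hn; simpl in *; [now subst|]. now apply IH.
Qed.

Lemma steps_inc P o r l s : code_at P o (INC r :: l) -> steps P (o, s) (S o, set_reg s r (S (s r))).
Proof. intros Hc%code_at_head. exists 1. simpl. now rewrite Hc. Qed.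

Lemma steps_dec P o r j l s : code_at P o (DEC r j :: l) -> s r <> 0 ->
  steps P (o, s) (S o, set_reg s r (pred (s r))).
Proof.
  intros Hc%code_at_head Hs. exists 1. simpl. rewrite Hc. now destruct (s r).
Qed.

Lemma steps_jump P o r j l s : code_at P o (DEC r j :: l) -> s r = 0 -> steps P (o, s) (j, s).
Proof. intros Hc%code_at_head Hs. exists 1. simpl. now rewrite Hc, Hs. Qed.

Lemma steps_test P o r j s : code_at P o [DEC r j; INC r] -> s r <> 0 ->
  steps P (o, s) (o + 2, s).
Proof.
  intros Hc Hs. pose proof Hc as Hinc.
  apply (code_at_app P o [DEC r j]) in Hinc as [_ Hinc].
  apply (steps_inc _ _ _ _ (set_reg s r (pred (s r)))) in Hinc. simpl length in Hinc.
  rewrite set_reg_same, set_reg_twice, Nat.succ_pred, set_reg_id in Hinc by auto.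
  eapply steps_trans; [eapply steps_dec; eauto|].
  replace (o + 2) with (S (o + 1)) by lia. rewrite <- Nat.add_1_r. exact Hinc.
Qed.

Lemma compile_correct z P c s s' : exec c s s' -> avoids z c -> s z = 0 ->
  forall o, code_at P o (compile z o c) -> steps P (o, s) (o + code_length c, s').
Proof.
  induction 1 as [r s|r s|c1 c2 s s1 s2 Hexec IH1 _ IH2|r c s Hr
    |r c s s1 s2 Hr Hexec IH1 _ IH2|r c1 c2 s s1 Hr Hexec IH1|r c1 c2 s s1 Hr Hexec IH1];
    intros Ha Hz o Hc.
  - cbn [code_length]. rewrite Nat.add_1_r. eapply steps_inc; eauto.
  - cbn [code_length]. rewrite Nat.add_1_r. destruct (Nat.eq_dec (s r) 0) as [E|E].
    + rewrite E. simpl. rewrite <- E, set_reg_id. eapply steps_jump; eauto.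
    + eapply steps_dec; eauto.
  - destruct Ha as [Ha1 Ha2]. cbn [compile code_length] in *.
    apply code_at_app in Hc as [Hc1 Hc2]. rewrite length_compile in Hc2.
    eapply steps_trans; [now apply IH1|]. rewrite Nat.add_assoc. apply IH2; auto.
    now rewrite (exec_avoids z c1 s s1).
  - apply code_at_while in Hc as (Htest & _). eapply steps_jump; eauto.
  - pose proof Ha as [_ Ha1]. pose proof (exec_avoids z c s s1 Hexec Ha1) as Hz1.
    pose proof (code_at_while _ _ _ _ _ Hc) as (Htest & Hbody & Hback).
    eapply steps_trans; [eapply steps_test; eauto|].
    eapply steps_trans; [now apply IH1|].
    eapply steps_trans; [eapply steps_jump; eauto; congruence|].
    apply IH2; auto. congruence.
  - destruct Ha as (_ & Ha1 & _). apply code_at_if in Hc as (Htest & Hthen & Hjump & _).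
    eapply steps_trans; [eapply steps_test; eauto|].
    eapply steps_trans; [now apply IH1|]. cbn [code_length].
    eapply steps_jump; eauto. now rewrite (exec_avoids z c1 s s1).
  - destruct Ha as (_ & _ & Ha2). apply code_at_if in Hc as (Htest & _ & _ & Helse).
    eapply steps_trans; [eapply steps_jump; eauto|]. cbn [code_length].
    replace (o + (code_length c1 + code_length c2 + 3)) with
      (o + code_length c1 + 3 + code_length c2) by lia.
    now apply IH1.
Qed.

(** * Computing the code of the game *)

Definition regs_of (l : list nat) : nat -> nat := fun r => nth r l 0.

Fixpoint list_set (l : list nat) (r v : nat) : list nat :=
  match r, l with
  | 0, [] => [v]
  | 0, _ :: t => v :: t
  | S r', [] => 0 :: list_set [] r' v
  | S r', a :: t => a :: list_set t r' v
  end.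

Lemma set_reg_regs_of l r v : set_reg (regs_of l) r v = regs_of (list_set l r v).
Proof.
  apply functional_extensionality. intros q. unfold set_reg, regs_of. revert l r.
  induction q as [|q IH]; intros l r; destruct r as [|r], l as [|a l]; simpl; auto.
  - now destruct q.
  - rewrite <- IH. destruct (Nat.eqb q r); auto. now destruct q.
Qed.

Lemma exec_eq c s s' s'' : exec c s s' -> s' = s'' -> exec c s s''.
Proof. now intros H <-. Qed.

Lemma exec_inc_regs r l : exec (CInc r) (regs_of l) (regs_of (list_set l r (S (nth r l 0)))).
Proof. rewrite <- set_reg_regs_of. exact (exec_inc r (regs_of l)). Qed.

Lemma exec_dec_regs r l : exec (CDec r) (regs_of l) (regs_of (list_set l r (pred (nth r l 0)))).
Proof. rewrite <- set_reg_regs_of. exact (exec_dec r (regs_of l)). Qed.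

Fixpoint CBlock (c : cmd) (l : list cmd) : cmd :=
  match l with [] => c | d :: l' => CSeq c (CBlock d l') end.

Definition CMove (r1 r2 : nat) : cmd := CWhile r1 (CSeq (CDec r1) (CInc r2)).

Lemma exec_move r1 r2 : r1 <> r2 -> forall n s, s r1 = n ->
  exec (CMove r1 r2) s (set_reg (set_reg s r1 0) r2 (n + s r2)).
Proof.
  intros Hne n. induction n as [|n IH]; intros s Hs.
  - cbn [Nat.add]. rewrite <- Hs, !set_reg_id. now apply exec_while_stop.
  - eapply exec_while_loop; [lia|eapply exec_seq; [apply exec_dec|apply exec_inc]|].
    rewrite Hs, set_reg_other by auto. simpl pred.
    eapply exec_eq; [apply IH; rewrite set_reg_other, set_reg_same; auto|].
    apply functional_extensionality. intros q. rewrite set_reg_same. unfold set_reg.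
    destruct (Nat.eqb_spec q r2); [lia|]. now destruct (Nat.eqb_spec q r1).
Qed.

Lemma exec_move_regs r1 r2 l : r1 <> r2 -> exec (CMove r1 r2) (regs_of l)
  (regs_of (list_set (list_set l r1 0) r2 (nth r1 l 0 + nth r2 l 0))).
Proof.
  intros H. rewrite <- !set_reg_regs_of. now apply (exec_move r1 r2 H (nth r1 l 0) (regs_of l)).
Qed.

Fixpoint triangular (n : nat) : nat := match n with 0 => 0 | S m => S m + triangular m end.

Lemma cpair_triangular a b : cpair a b = triangular (a + b) + b.
Proof.
  unfold cpair. f_equal. generalize (a + b). intros n. symmetry.
  apply Nat.div_unique with 0; [lia|].
  induction n as [|n IH]; [easy|]. cbn [triangular]. lia.
Qed.

Ltac solve_regs := apply (f_equal regs_of); repeat (apply f_equal2; [nia|]); reflexivity.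

(* One round of a loop whose body is a block of increments and decrements, then the hypothesis
   [IH] for the remaining rounds. *)
Ltac exec_round IH :=
  eapply exec_while_loop; [discriminate
  | repeat (eapply exec_seq; [solve [apply exec_dec_regs | apply exec_inc_regs]|]);
    apply exec_inc_regs
  | cbn [list_set nth pred]; eapply exec_eq; [apply IH|solve_regs]].

Ltac exec_first_move := eapply exec_seq; [apply exec_move_regs; discriminate|];
  cbn [list_set nth Nat.add]; rewrite ?Nat.add_0_r.

(* The registers hold: 0 the remaining input, 1 the result, 2 a constant, 3 the power of two,
   4 to 7 scratch, 8 always zero. *)
Definition CDistribute (r1 r2 r3 : nat) : cmd := CWhile r1 (CBlock (CDec r1) [CInc r2; CInc r3]).

Lemma exec_distribute_6_7_5 x t c y u b : forall a k,
  exec (CDistribute 6 7 5) (regs_of [x;t;c;y;u;a;b;k;0]) (regs_of [x;t;c;y;u;a + b;0;k + b;0]).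
Proof.
  induction b as [|b IH]; intros a k.
  - rewrite !Nat.add_0_r. now apply exec_while_stop.
  - exec_round IH.
Qed.

Lemma exec_distribute_5_7_6 x t c y u a : forall b k,
  exec (CDistribute 5 7 6) (regs_of [x;t;c;y;u;a;b;k;0]) (regs_of [x;t;c;y;u;0;b + a;k + a;0]).
Proof.
  induction a as [|a IH]; intros b k.
  - rewrite !Nat.add_0_r. now apply exec_while_stop.
  - exec_round IH.
Qed.

Definition CTriangular : cmd :=
  CWhile 5 (CBlock (CDistribute 5 7 6) [CDec 6; CMove 6 5]).

Lemma exec_triangular x t c y u n : forall k,
  exec CTriangular (regs_of [x;t;c;y;u;n;0;k;0]) (regs_of [x;t;c;y;u;0;0;k + triangular n;0]).
Proof.
  induction n as [|n IH]; intros k.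
  - rewrite Nat.add_0_r. now apply exec_while_stop.
  - eapply exec_while_loop; [discriminate| |].
    + eapply exec_seq; [apply exec_distribute_5_7_6|].
      eapply exec_seq; [apply exec_dec_regs|apply exec_move_regs; discriminate].
    + cbn [list_set nth pred Nat.add]. rewrite Nat.add_0_r. eapply exec_eq; [apply IH|].
      cbn [triangular]. solve_regs.
Qed.

Definition CPair : cmd := CSeq (CDistribute 6 7 5) CTriangular.

Lemma exec_pair x t c y u a b :
  exec CPair (regs_of [x;t;c;y;u;a;b;0;0]) (regs_of [x;t;c;y;u;0;0;cpair a b;0]).
Proof.
  eapply exec_seq; [apply exec_distribute_6_7_5|]. eapply exec_eq; [apply exec_triangular|].
  rewrite cpair_triangular. solve_regs.
Qed.

Definition next_pair (ab : nat * nat) : nat * nat :=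
  match ab with (S a, b) => (a, S b) | (0, b) => (S b, 0) end.

Lemma iter_next_pair n : forall a b, cpair a b = n -> Nat.iter n next_pair (0, 0) = (a, b).
Proof.
  induction n as [|n IH]; intros a b H; rewrite cpair_triangular in H.
  - destruct a as [|a], b as [|b]; simpl in *; try lia. easy.
  - simpl. destruct b as [|b].
    + destruct a as [|a]; [simpl in H; lia|]. rewrite (IH 0 a); [easy|].
      rewrite cpair_triangular. replace (S a + 0) with (S a) in H by lia.
      cbn [triangular] in H. simpl. lia.
    + rewrite (IH (S a) b); [easy|]. rewrite cpair_triangular.
      replace (S a + b) with (a + S b) by lia. lia.
Qed.

Definition CNextPair : cmd :=
  CIf 5 (CSeq (CDec 5) (CInc 6)) (CSeq (CInc 5) (CMove 6 5)).

Lemma exec_next_pair n t c y u k ab :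
  exec CNextPair (regs_of [n;t;c;y;u;fst ab;snd ab;k;0])
    (regs_of [n;t;c;y;u;fst (next_pair ab);snd (next_pair ab);k;0]).
Proof.
  destruct ab as [[|a] b]; cbn [next_pair fst snd].
  - apply exec_if_zero; [reflexivity|].
    eapply exec_seq; [apply exec_inc_regs|]. cbn [list_set nth].
    eapply exec_eq; [apply exec_move_regs; discriminate|]. cbn [list_set nth]. solve_regs.
  - apply exec_if_nonzero; [discriminate|].
    eapply exec_seq; [apply exec_dec_regs|]. cbn [list_set nth pred].
    eapply exec_eq; [apply exec_inc_regs|]. cbn [list_set nth]. solve_regs.
Qed.

Definition CUnpair : cmd := CWhile 0 (CSeq (CDec 0) CNextPair).

Lemma exec_unpair_iter t c y u k n : forall ab,
  exec CUnpair (regs_of [n;t;c;y;u;fst ab;snd ab;k;0])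
    (regs_of [0;t;c;y;u;fst (Nat.iter n next_pair ab);snd (Nat.iter n next_pair ab);k;0]).
Proof.
  induction n as [|n IH]; intros ab.
  - now apply exec_while_stop.
  - rewrite Nat.iter_succ_r. eapply exec_while_loop; [discriminate| |apply IH].
    eapply exec_seq; [apply exec_dec_regs|apply exec_next_pair].
Qed.

Lemma exec_unpair a b t c y u k :
  exec CUnpair (regs_of [cpair a b;t;c;y;u;0;0;k;0]) (regs_of [0;t;c;y;u;a;b;k;0]).
Proof.
  pose proof (exec_unpair_iter t c y u k (cpair a b) (0, 0)) as H.
  now rewrite (iter_next_pair _ a b eq_refl) in H.
Qed.

Definition CPop : cmd := CBlock CUnpair [CMove 6 0; CMove 5 2].
Definition CConsLeft : cmd := CBlock (CMove 2 5) [CMove 1 6; CPair; CMove 7 1; CInc 1].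
Definition CConsRight : cmd := CBlock (CMove 1 5) [CMove 2 6; CPair; CMove 7 1; CInc 1].

Lemma exec_pop c x t y :
  exec CPop (regs_of [cpair c x;t;0;y;0;0;0;0;0]) (regs_of [x;t;c;y;0;0;0;0;0]).
Proof.
  eapply exec_seq; [apply exec_unpair|]. exec_first_move.
  eapply exec_eq; [apply exec_move_regs; discriminate|]. cbn [list_set nth]. solve_regs.
Qed.

Lemma exec_cons_left x t c y :
  exec CConsLeft (regs_of [x;t;c;y;0;0;0;0;0]) (regs_of [x;S (cpair c t);0;y;0;0;0;0;0]).
Proof.
  exec_first_move. exec_first_move. eapply exec_seq; [apply exec_pair|]. exec_first_move.
  apply exec_inc_regs.
Qed.

Lemma exec_cons_right x t c y :
  exec CConsRight (regs_of [x;t;c;y;0;0;0;0;0]) (regs_of [x;S (cpair t c);0;y;0;0;0;0;0]).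
Proof.
  exec_first_move. exec_first_move. eapply exec_seq; [apply exec_pair|]. exec_first_move.
  apply exec_inc_regs.
Qed.

Lemma exec_double x t c y : forall u a b k,
  exec (CDistribute 3 4 4) (regs_of [x;t;c;y;u;a;b;k;0]) (regs_of [x;t;c;0;u + 2 * y;a;b;k;0]).
Proof.
  induction y as [|y IH]; intros u a b k.
  - rewrite Nat.add_0_r. now apply exec_while_stop.
  - exec_round IH.
Qed.

Definition CShiftLeft : cmd :=
  CWhile 5 (CBlock (CDec 5) [CInc 0; CDistribute 3 4 4; CMove 4 3]).

Lemma exec_shift_left n : forall x y,
  exec CShiftLeft (regs_of [x;0;0;y;0;n;0;0;0]) (regs_of [x + n;0;0;2 ^ n * y;0;0;0;0;0]).
Proof.
  induction n as [|n IH]; intros x y.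
  - rewrite Nat.add_0_r, Nat.mul_1_l. now apply exec_while_stop.
  - eapply exec_while_loop; [discriminate| |].
    + eapply exec_seq; [apply exec_dec_regs|]. cbn [list_set nth pred].
      eapply exec_seq; [apply exec_inc_regs|]. cbn [list_set nth].
      eapply exec_seq; [apply exec_double|]. apply exec_move_regs; discriminate.
    + cbn [list_set nth]. rewrite Nat.add_0_r. eapply exec_eq; [apply IH|].
      rewrite Nat.pow_succ_r'. solve_regs.
Qed.

Definition CExp : cmd := CBlock (CMove 0 5) [CInc 3; CShiftLeft].

Lemma exec_exp x : exec CExp (regs_of [x;0;0;0;0;0;0;0;0]) (regs_of [x;0;0;2 ^ x;0;0;0;0;0]).
Proof.
  exec_first_move. eapply exec_seq; [apply exec_inc_regs|]. cbn [list_set nth].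
  eapply exec_eq; [apply exec_shift_left|]. solve_regs.
Qed.

Definition CTriplicate : cmd := CWhile 3 (CBlock (CDec 3) [CInc 4; CInc 5; CInc 6]).

Lemma exec_triplicate x t c k y : forall u a b,
  exec CTriplicate (regs_of [x;t;c;y;u;a;b;k;0]) (regs_of [x;t;c;0;u + y;a + y;b + y;k;0]).
Proof.
  induction y as [|y IH]; intros u a b.
  - rewrite !Nat.add_0_r. now apply exec_while_stop.
  - exec_round IH.
Qed.

(* The code of a simulation game, but for the power of two in the row of [VInput]: the codes of
   the rest of that row and of its first entry, of the other rows, of the targets and threshold,
   and of the other components of the game. *)
Record template : Type := Template {
  tpl_row_end : nat;
  tpl_row_start : nat;
  tpl_rows : nat;
  tpl_targets : nat;
  tpl_succ : nat;
  tpl_owner : nat;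
  tpl_start : nat;
  tpl_players : nat;
  tpl_size : nat
}.

Definition fill (T : template) (X : nat) : nat :=
  let row := S (cpair (tpl_row_start T)
    (S (cpair (cpair 1 X) (S (cpair (cpair (X - 1) X) (tpl_row_end T)))))) in
  S (cpair (tpl_size T) (S (cpair (tpl_players T) (S (cpair (tpl_start T)
    (S (cpair (tpl_owner T) (S (cpair (tpl_succ T)
    (S (cpair (S (cpair row (tpl_rows T))) (tpl_targets T)))))))))))).

Definition template_code (T : template) : nat :=
  cpair (tpl_row_end T) (cpair (tpl_row_start T) (cpair (tpl_rows T) (cpair (tpl_targets T)
    (cpair (tpl_succ T) (cpair (tpl_owner T) (cpair (tpl_start T) (cpair (tpl_players T)
    (cpair (tpl_size T) 0)))))))).

Definition CConsInputRow : cmd :=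
  CBlock CTriplicate [CMove 4 3; CDec 5; CPair; CMove 7 2; CConsLeft;
    CMove 3 6; CInc 5; CPair; CMove 7 2; CConsLeft].

Lemma exec_cons_input_row x t X :
  exec CConsInputRow (regs_of [x;t;0;X;0;0;0;0;0])
    (regs_of [x;S (cpair (cpair 1 X) (S (cpair (cpair (X - 1) X) t)));0;0;0;0;0;0;0]).
Proof.
  eapply exec_seq; [apply exec_triplicate|]. cbn [Nat.add]. exec_first_move.
  eapply exec_seq; [apply exec_dec_regs|]. cbn [list_set nth]. rewrite <- Nat.sub_1_r.
  eapply exec_seq; [apply exec_pair|]. exec_first_move.
  eapply exec_seq; [apply exec_cons_left|]. exec_first_move.
  eapply exec_seq; [apply exec_inc_regs|]. cbn [list_set nth].
  eapply exec_seq; [apply exec_pair|]. exec_first_move. apply exec_cons_left.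
Qed.

Definition CFill : cmd :=
  CBlock CExp
    [CPop; CMove 2 1; CConsInputRow;
     CPop; CConsLeft; CPop; CConsRight; CPop; CConsRight;
     CPop; CConsLeft; CPop; CConsLeft; CPop; CConsLeft; CPop; CConsLeft; CPop; CConsLeft;
     CMove 1 0].

Lemma exec_fill T :
  exec CFill (regs_of [template_code T;0;0;0;0;0;0;0;0])
    (regs_of [fill T (2 ^ template_code T);0;0;0;0;0;0;0;0]).
Proof.
  eapply exec_seq; [apply exec_exp|]. generalize (2 ^ template_code T). intros X.
  unfold template_code.
  eapply exec_seq; [apply exec_pop|]. exec_first_move.
  eapply exec_seq; [apply exec_cons_input_row|].
  repeat (eapply exec_seq; [apply exec_pop|];
    eapply exec_seq; [solve [apply exec_cons_left | apply exec_cons_right]|]).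
  eapply exec_eq; [apply exec_move_regs; discriminate|]. cbn [list_set nth].
  now rewrite Nat.add_0_r.
Qed.

Lemma avoids_fill : avoids 8 CFill.
Proof. simpl. lia. Qed.

(** * Diagonalisation *)

Definition relocate_instr (o len : nat) (i : instr) : instr :=
  match i with INC r => INC r | DEC r j => DEC r (o + Nat.min j len) end.

Definition relocate (o : nat) (M : program) : program := map (relocate_instr o (length M)) M.

Lemma relocate_run P o M : code_at P o (relocate o M) -> forall n s,
  steps P (o + Nat.min (fst s) (length M), snd s)
          (o + Nat.min (fst (mrun M n s)) (length M), snd (mrun M n s)).
Proof.
  intros Hc n. induction n as [|n IH]; intros s; [apply steps_refl|].
  eapply steps_trans; [|apply (IH (mstep M s))]. destruct s as [pc regs]. cbn [fst snd].
  destruct (nth_error M pc) as [i|] eqn:E.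
  - pose proof (nth_error_lt M pc i E) as Hlt.
    pose proof (code_at_nth P o _ pc _ Hc (map_nth_error _ _ _ E)) as HP.
    rewrite (Nat.min_l pc) by lia. exists 1. cbn [mrun]. unfold mstep. rewrite HP, E.
    destruct i as [r|r j]; cbn [relocate_instr].
    + cbn [fst snd]. f_equal. lia.
    + destruct (regs r); cbn [fst snd]; f_equal. lia.
  - unfold mstep. rewrite E. apply steps_refl.
Qed.

Definition answer_test (o : nat) : program := [DEC 0 (o + 2); DEC 0 (o + 3)].

Lemma answer_test_run P o regs y : code_at P o (answer_test o) -> regs 0 = y ->
  exists regs', steps P (o, regs) (if Nat.eqb y 1 then o + 3 else o + 2, regs').
Proof.
  intros Hc Hy. pose proof Hc as Hsnd. apply (code_at_app P o [_]) in Hsnd as [_ Hsnd].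
  simpl length in Hsnd. rewrite Nat.add_1_r in Hsnd. destruct y as [|y].
  - exists regs. eapply steps_jump; eauto.
  - assert (Hfst : steps P (o, regs) (S o, set_reg regs 0 y)).
    { replace y with (pred (regs 0)) by lia. eapply steps_dec; [exact Hc|lia]. }
    destruct y as [|y]; eexists; (eapply steps_trans; [exact Hfst|]).
    + eapply steps_jump; [exact Hsnd|apply set_reg_same].
    + cbn [Nat.eqb]. replace (o + 2) with (S (S o)) by lia.
      eapply steps_dec; [exact Hsnd|]. now rewrite set_reg_same.
Qed.

Definition diag (M : program) : program :=
  compile 8 0 CFill ++ relocate (code_length CFill) M ++
  answer_test (code_length CFill + length M).

Lemma length_diag M : length (diag M) = code_length CFill + length M + 2.
Proof.
  unfold diag, relocate. rewrite !length_app, length_compile, length_map. simpl length. lia.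
Qed.

Lemma init_state_regs v : init_state v = (0, regs_of [v;0;0;0;0;0;0;0;0]).
Proof.
  unfold init_state. f_equal. apply functional_extensionality. intros q.
  unfold regs_of. do 10 (destruct q as [|q]; [easy|]). now destruct q.
Qed.

Lemma diag_run M T y : halts_with M (fill T (2 ^ template_code T)) y ->
  exists n, fst (mrun (diag M) n (init_state (template_code T))) =
    if Nat.eqb y 1 then S (length (diag M)) else length (diag M).
Proof.
  intros (n & Hn & Hy). set (input := fill T (2 ^ template_code T)) in *.
  assert (Hall : code_at (diag M) 0 (diag M))
    by (exists [], []; split; [now rewrite app_nil_r|easy]).
  apply code_at_app in Hall as [Hfill Hrest]. apply code_at_app in Hrest as [HM Htest].
  rewrite length_compile in HM, Htest. unfold relocate in Htest. rewrite length_map in Htest.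
  cbn [Nat.add] in HM, Htest. set (o := code_length CFill) in *.
  assert (Hprepare : steps (diag M) (init_state (template_code T)) (o, snd (init_state input))).
  { rewrite !init_state_regs. apply (compile_correct 8 (diag M) CFill); auto using avoids_fill.
    apply exec_fill. }
  pose proof (relocate_run (diag M) o M HM n (init_state input)) as Hdecide.
  rewrite (Nat.min_r (fst (mrun M n (init_state input)))) in Hdecide by lia.
  change (Nat.min (fst (init_state input)) (length M)) with 0 in Hdecide.
  rewrite Nat.add_0_r in Hdecide.
  destruct (answer_test_run (diag M) (o + length M) _ y Htest Hy) as (regs & Hanswer).
  destruct (steps_trans _ _ _ _ Hprepare (steps_trans _ _ _ _ Hdecide Hanswer)) as [m Hm].
  exists m. rewrite Hm, length_diag. fold o. destruct (Nat.eqb y 1); cbn [fst]; lia.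
Qed.

Definition register_count (Q : program) : nat := S (list_max (map instr_reg Q)).

Lemma instr_reg_lt Q i : In i Q -> instr_reg i < register_count Q.
Proof. intros H. apply Nat.lt_succ_r, le_list_max. now apply in_map. Qed.

Definition game_template (Q : program) (nr : nat) : template := {|
  tpl_row_end := enc_list enc_qn (map (fun _ => (0, 1)) (ordinary_vertices Q nr));
  tpl_row_start := enc_qn (0, 1);
  tpl_rows := enc_list (enc_list enc_qn) (map (fun v => map (probability Q nr 0 v) (vertices Q nr))
    (VStop Keep true 0 :: VPay 0 false :: ordinary_vertices Q nr));
  tpl_targets := enc_list (fun a => a)
    [enc_list (enc_list (fun a => a)) (g_target (sim_game Q nr 0)); 0; 1];
  tpl_succ := enc_list (enc_list (fun a => a)) (g_succ (sim_game Q nr 0));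
  tpl_owner := enc_list enc_opt (g_owner (sim_game Q nr 0));
  tpl_start := g_v0 (sim_game Q nr 0);
  tpl_players := g_k (sim_game Q nr 0);
  tpl_size := g_nV (sim_game Q nr 0)
|}.

Lemma encode_sim_game Q nr x :
  encode_instance (sim_game Q nr x) 0 1 = fill (game_template Q nr) (2 ^ x).
Proof. unfold encode_instance. rewrite sim_game_prob. reflexivity. Qed.

Theorem theorem3 :
  forall c : sclass,
    ~ (exists M : program,
         forall (G : game) (a b : nat),
           valid_instance G a b ->
           exists y, halts_with M (encode_instance G a b) y /\
                     (y = 1%nat <-> NCRSP_gt c G (INR a / INR b)%R)).
Proof.
  intros c (M & HM).
  set (Q := diag M). set (nr := register_count Q). set (T := game_template Q nr).
  assert (Hnr : 0 < nr) by apply Nat.lt_0_succ.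
  assert (Hvalid : valid_instance (sim_game Q nr (template_code T)) 0 1)
    by (split; [now apply sim_game_wf|lia]).
  destruct (HM _ 0 1 Hvalid) as (y & Hhalts & Hy). rewrite encode_sim_game in Hhalts.
  replace (INR 0 / INR 1)%R with 0%R in Hy by (simpl; lra).
  destruct (diag_run M T y Hhalts) as [n Hn]. fold Q in Hn.
  destruct (Nat.eqb_spec y 1) as [Haccept|Hreject].
  - apply (accepting_run_not_NCRSP Q nr (template_code T) Hnr c n Hn). now apply Hy.
  - apply Hreject, Hy. apply (rejecting_run_NCRSP Q nr (template_code T) Hnr c n); auto.
    + apply instr_reg_lt.
    + unfold Q. rewrite length_diag. lia.
Qed.
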